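(* Let $\omega\in\mathbb{R}\setminus\mathbb{Q}$ be badly approximable and let $r\in[0,3)$. Let $h_0(x,x')=\frac12(x-x')^2$. Then there is a constant $C>0$, independent of $\epsilon$, such that for every sufficiently small $\epsilon>0$ there exists a real trigonometric polynomial $R_N(x)$ (of period $1$) of degree \[N\le C\epsilon^{-\frac{3}{2(3-r)}}\] with $\|R_N\|_{C^r}<\epsilon$ such that the exact area-preserving twist map generated by $h_0(x,x')+R_N(x')$ admits no invariant circle with frequency $\omega$.
   Context: An irrational $\omega$ is badly approximable if it is $0$-well approximable but not $\mu$-well approximable for any $\mu>0$, where $\omega$ is $\mu$-well approximable if there are infinitely many $q\in\mathbb{N}$ and integers $p$ with $|q\omega-p|<q^{-1-\mu}$ (equivalently, the partial quotients of its continued fraction are bounded). A function $h(x,x')$ with $h(x+1,x'+1)=h(x,x')$ generates the map $F(x,y)=(x',y')$ of $\mathbb{R}^2$ given implicitly by $y=-\partial_1h(x,x')$, $y'=\partial_2h(x,x')$, which induces an exact area-preserving twist map $f$ of the cylinder $\mathbb{T}\times\mathbb{R}$. An invariant circle is an $f$-invariant simple closed curve not homotopic to a point; it has frequency $\omega$ if the restriction of $f$ to it has rotation number $\omega$. For $u\in C^r(\mathbb{T})$, $\|u\|_{C^r}=\max_{0\le j\le r}\max_{x}|u^{(j)}(x)|$ over integer orders $j\le r$. *)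

(* Defs.v *)
From Stdlib Require Import Reals Lra.
From Coquelicot Require Import Coquelicot.
Open Scope R_scope.

Definition approx_ok (w mu : R) (q : nat) : Prop :=
  exists p : Z, Rabs (INR q * w - IZR p) < Rpower (INR q) (-1 - mu).

Definition well_approximable (mu w : R) : Prop :=
  forall M : nat, exists q : nat, (M < q)%nat /\ approx_ok w mu q.

Definition irrational (w : R) : Prop :=
  forall (p : Z) (q : Z), q <> 0%Z -> w <> IZR p / IZR q.

Definition badly_approximable (w : R) : Prop :=
  irrational w /\ well_approximable 0 w /\
  forall mu : R, 0 < mu -> ~ well_approximable mu w.

Definition trig_poly_deg_le (N : nat) (P : R -> R) : Prop :=
  exists (a b : nat -> R), forall x : R,
    P x = sum_f_R0 (fun k => a k * cos (2 * PI * INR k * x)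
                           + b k * sin (2 * PI * INR k * x)) N.

(* ||u||_{C^r} < eps : max over integer orders j <= r and over x of |u^(j)(x)|
   is < eps (for continuous 1-periodic u the max is attained, so this is the
   pointwise condition). *)
Definition Cr_norm_lt (r : R) (u : R -> R) (eps : R) : Prop :=
  forall (j : nat) (x : R), INR j <= r -> Rabs (Derive_n u j x) < eps.

(* The (lifted) map F generated by h, given implicitly:
   F(x,y) = (x',y') iff y = -d1 h(x,x') and y' = d2 h(x,x'). *)
Definition twist_rel (h : R -> R -> R) (p q : R * R) : Prop :=
  is_derive (fun t => h t (fst q)) (fst p) (- snd p) /\
  is_derive (fun t => h (fst p) t) (fst q) (snd q).

(* Lift to R^2 of a simple closed curve on the cylinder T x R that is not
   homotopic to a point (winding once around the cylinder). *)
Definition noncontractible_simple_lift (g : R -> R * R) : Prop :=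
  continuity (fun s => fst (g s)) /\ continuity (fun s => snd (g s)) /\
  (forall s, g (s + 1) = (fst (g s) + 1, snd (g s))) /\
  (forall (s s' : R) (k : Z),
      g s = (fst (g s') + IZR k, snd (g s')) -> s = s' + IZR k).

Definition on_curve (g : R -> R * R) (p : R * R) : Prop := exists s, g s = p.

Definition invariant_curve (h : R -> R -> R) (g : R -> R * R) : Prop :=
  (forall p q, on_curve g p -> twist_rel h p q -> on_curve g q) /\
  (forall q, on_curve g q -> exists p, on_curve g p /\ twist_rel h p q).

(* The restriction of f to the curve has rotation number w, computed through
   the lift F: every orbit on the curve has mean x-displacement w. *)
Definition has_frequency (h : R -> R -> R) (g : R -> R * R) (w : R) : Prop :=
  forall orb : nat -> R * R,
    on_curve g (orb 0%nat) ->
    (forall n, twist_rel h (orb n) (orb (S n))) ->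
    Un_cv (fun n => (fst (orb (S n)) - fst (orb 0%nat)) / INR (S n)) w.

Definition invariant_circle_with_frequency (h : R -> R -> R) (w : R) : Prop :=
  exists g : R -> R * R,
    noncontractible_simple_lift g /\ invariant_curve h g /\ has_frequency h g w.

Definition h0 (x x' : R) : R := (x - x') ^ 2 / 2.

(* Main.v *)
(* Only integer orders of differentiation enter the C^r norm.  For r < 1 the kick
   cos(2 pi q x) / q^2 is so strong that no graph can be invariant.  For r >= 1 choose p / q close
   to w and take R(x) = V(q x) / q^2, where V(x) = (1 / P^2 + b F(x - xi)) (1 - cos 2 pi x) and F is
   a Fejer kernel of degree of order P.

   An invariant circle is a graph: the running maximum M of the x-coordinate x(s) along the curve
   is a subsolution of x(phi s) + x(phi^-1 s) = 2 x(s) + R'(x(s)); by exactness the integral of the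
   defect against dM over a period vanishes, so the defect vanishes on the support of dM, and the
   two ends of a plateau of M would be the same point of the curve.  Orbits on an invariant graph
   are strictly action minimizing.  In the coordinates X_i = q x_i - i p they minimize for V and
   have rotation number |q w - p|, much smaller than the Lyapunov exponent 1 / P of the hyperbolic
   fixed points at the integers.  Hence they spend a long time exponentially close to some integer,
   and steps can be removed there at almost no cost.  So the part of a minimizer through xi that goes
   from 0 to 1 is, up to an exponentially small error, optimal among all paths from 0 to 1 of
   comparable length.
   But V was built from a nearly optimal path z for the potential (1 - cos 2 pi x) / P^2, with the
   bump centred at a point xi which z avoids on average: passing through xi costs b, while z pays at
   most b / 4. *)

Require Import Defs.
From Stdlib Require Import Reals ZArith Lra Lia Psatz Classical ClassicalEpsilon.
From Coquelicot Require Import Coquelicot.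
From Stdlib Require Import List FinFun.
Import ListNotations.
Open Scope R_scope.

(** * Monotone functions and Stieltjes integrals *)

(** The parameters are [P = n^4], [k = n] and [q] between [n^4] and [100 n^5], so the degree is
    [2400 n^9], while the derivatives of orders 0, 1, 2 are at most a constant times n^-16, n^-12,
    n^-8. The bump cannot be higher than order P^-4: its Fejer factor has degree of order P, and its
    second derivative must not spoil the hyperbolicity of the integers, where V'' is of order P^-2.
    Hence 2^-k must beat P^-4, and the comparison of paths needs a time of order k P during which
    the rescaled orbit advances by less than 1. With k about log P, q would be about P log P; the
    powers of n trade this logarithm for a power. The exponents obtained are 9/8 for order 2, where
    at least 3/2 is allowed, and 9/12 for order 1, exactly what r = 1 allows. For order 0 it would
    be 9/16 against the 1/2 allowed at r = 0, which is why r < 1 gets its own perturbation. Neither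
    the running maximum nor the circle map is known to be more than continuous and monotone, so
    identities along them are proved from increments with quadratic errors, removed by bisection. *)

Definition nondecreasing (u : R -> R) : Prop := forall s t, s <= t -> u s <= u t.
Definition strictly_increasing (u : R -> R) : Prop := forall s t, s < t -> u s < u t.

Lemma continuity_eps (u : R -> R) :
  continuity u <->
  forall x eps, 0 < eps ->
    exists d, 0 < d /\ forall y, Rabs (y - x) < d -> Rabs (u y - u x) < eps.
Proof.
  split.
  - intros H x eps He. destruct (H x eps He) as [d [Hd H1]].
    exists d; split; [exact Hd|]. intros y Hy.
    destruct (Req_dec y x) as [->|n].
    + rewrite Rminus_diag, Rabs_R0. exact He.
    + apply (H1 y). split; [split; [exact I | congruence]|exact Hy].
  - intros H x eps He. destruct (H x eps He) as [d [Hd H1]].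
    exists d; split; [exact Hd|]. intros y [_ Hy]. apply (H1 y Hy).
Qed.

Lemma ivt_value (u : R -> R) (a b v : R) :
  continuity u -> a <= b -> u a <= v <= u b -> exists c, a <= c <= b /\ u c = v.
Proof.
  intros Hc Hab Hv.
  destruct (IVT_cor (fun x => u x - v) a b) as [z [Hz Hz']]; auto.
  - apply continuity_minus; [exact Hc | apply continuity_const; intros x y; reflexivity].
  - cut (0 <= (v - u a) * (u b - v)); [lra|]. apply Rmult_le_pos; lra.
  - exists z; split; [exact Hz | lra].
Qed.

Lemma strictly_increasing_le (u : R -> R) :
  strictly_increasing u -> nondecreasing u.
Proof.
  intros H s t [Hst|Hst]; [left; apply H, Hst | right; congruence].
Qed.

Lemma strictly_increasing_lt_inv (u : R -> R) (s t : R) :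
  strictly_increasing u -> u s < u t -> s < t.
Proof.
  intros H Hu. destruct (Rlt_le_dec s t) as [|Hle]; auto.
  apply (strictly_increasing_le _ H) in Hle. lra.
Qed.

Lemma inverse_strictly_increasing (u v : R -> R) :
  strictly_increasing u -> (forall x, u (v x) = x) -> strictly_increasing v.
Proof.
  intros H Huv s t Hst. apply (strictly_increasing_lt_inv u); auto.
  rewrite !Huv. exact Hst.
Qed.

Lemma increasing_bijection_continuous (u v : R -> R) :
  strictly_increasing u -> (forall x, u (v x) = x) -> (forall x, v (u x) = x) ->
  continuity u.
Proof.
  intros Hu Huv Hvu. apply continuity_eps. intros x eps He.
  assert (Hv := inverse_strictly_increasing u v Hu Huv).
  assert (H1 : v (u x - eps) < x) by (rewrite <- (Hvu x) at 2; apply Hv; lra).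
  assert (H2 : x < v (u x + eps)) by (rewrite <- (Hvu x) at 1; apply Hv; lra).
  exists (Rmin (x - v (u x - eps)) (v (u x + eps) - x)); split.
  - apply Rmin_pos; lra.
  - intros y Hy.
    assert (H3 := Rmin_l (x - v (u x - eps)) (v (u x + eps) - x)).
    assert (H4 := Rmin_r (x - v (u x - eps)) (v (u x + eps) - x)).
    apply Rabs_def2 in Hy. apply Rabs_def1.
    + assert (u y < u (v (u x + eps))) by (apply Hu; lra). rewrite Huv in H. lra.
    + assert (u (v (u x - eps)) < u y) by (apply Hu; lra). rewrite Huv in H. lra.
Qed.

(* Bisecting at a point where [al] takes its middle value halves the defect. *)
Lemma nondecreasing_of_quadratic_defect (c : R) (E al B : R -> R) :
  continuity al -> nondecreasing al -> nondecreasing B ->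
  (forall s t, c <= s -> s <= t -> - (al t - al s) * (B t - B s) <= E t - E s) ->
  forall s t, c <= s -> s <= t -> E s <= E t.
Proof.
  intros Hc Hal HB H s t Hcs Hst.
  assert (Hn : forall n s t, c <= s -> s <= t ->
     - ((al t - al s) * (B t - B s)) <= (E t - E s) * 2 ^ n).
  { clear s t Hcs Hst. induction n as [|n IH]; intros s t Hcs Hst.
    - generalize (H s t Hcs Hst). simpl. lra.
    - destruct (ivt_value al s t ((al s + al t) / 2)) as [p [Hp Hp']]; auto.
      { generalize (Hal s t Hst). lra. }
      generalize (IH s p Hcs (proj1 Hp)) (IH p t (Rle_trans _ _ _ Hcs (proj1 Hp)) (proj2 Hp)).
      rewrite Hp'. simpl. lra. }
  destruct (Rle_lt_dec (E s) (E t)) as [|Hlt]; auto. exfalso.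
  set (D := (al t - al s) * (B t - B s)) in *.
  destruct (Pow_x_infinity 2 ltac:(rewrite Rabs_pos_eq; lra) ((D + 1) / (E s - E t))) as [N HN].
  specialize (HN N (le_n N)). rewrite Rabs_pos_eq in HN by (apply pow_le; lra).
  specialize (Hn N s t Hcs Hst). fold D in Hn.
  apply Rge_le, (Rmult_le_compat_l (E s - E t)) in HN; [|lra].
  replace ((E s - E t) * ((D + 1) / (E s - E t))) with (D + 1) in HN by (field; lra).
  lra.
Qed.

Section Stieltjes.
Variables A B : R -> R.
Hypothesis HA : nondecreasing A.
Hypothesis HB : nondecreasing B.

(** Left end point sums of the Stieltjes integral of [A] against [B] over partitions of [0, t]; each
    step appends a partition point. A supremum of such sums needs no differentiability of [B]. *)
Inductive lower_sum : R -> R -> Prop :=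
| lower_sum_0 : lower_sum 0 0
| lower_sum_step t t' v : lower_sum t v -> t <= t' ->
    lower_sum t' (v + A t * (B t' - B t)).

Lemma lower_sum_bound t v : lower_sum t v -> 0 <= t /\ v <= A t * (B t - B 0).
Proof.
  induction 1 as [|t t' v H IH Ht].
  - split; lra.
  - split; [lra|].
    generalize (HA t t' Ht) (HB t t' Ht) (HB 0 t (proj1 IH)). nra.
Qed.

Definition stieltjes (t : R) : R := epsilon (inhabits 0) (is_lub (lower_sum t)).

Lemma lower_sum_exists t : 0 <= t -> lower_sum t (0 + A 0 * (B t - B 0)).
Proof. intros H. apply lower_sum_step; [constructor|exact H]. Qed.

Lemma stieltjes_lub t : 0 <= t -> is_lub (lower_sum t) (stieltjes t).
Proof.
  intros Ht. unfold stieltjes. apply epsilon_spec.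
  destruct (completeness (lower_sum t)) as [m Hm].
  - exists (A t * (B t - B 0)). intros v Hv. apply lower_sum_bound, Hv.
  - eexists. apply lower_sum_exists, Ht.
  - exists m. exact Hm.
Qed.

(** Drop the part of the partition beyond [s] and let a step that straddles [s] end there; on [s, t]
    the integrand is at most [A t]. *)
Lemma lower_sum_cut t v : lower_sum t v -> forall s, 0 <= s <= t ->
  exists v', lower_sum s v' /\ v <= v' + A t * (B t - B s).
Proof.
  induction 1 as [|t t' v H IH Ht]; intros s Hs.
  - assert (s = 0) as -> by lra. exists 0; split; [constructor|lra].
  - destruct (Rle_lt_dec s t) as [Hst|Hst].
    + destruct (IH s ltac:(lra)) as [v' [H1 H2]]. exists v'; split; auto.
      generalize (HA t t' Ht) (HB t t' Ht) (HB s t Hst). nra.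
    + exists (v + A t * (B s - B t)); split.
      * apply lower_sum_step; auto; lra.
      * generalize (HA t t' Ht) (HB s t' (proj2 Hs)). nra.
Qed.

(** Together with the matching upper bound by [A t], this is what is used of the integral; the two
    bounds differ by the product of the increments of [A] and [B], the quadratic error that
    bisection removes. *)
Lemma stieltjes_ge s t : 0 <= s -> s <= t ->
  A s * (B t - B s) <= stieltjes t - stieltjes s.
Proof.
  intros Hs Hst. destruct (stieltjes_lub s Hs) as [_ H1].
  destruct (stieltjes_lub t ltac:(lra)) as [H2 _].
  cut (stieltjes s <= stieltjes t - A s * (B t - B s)); [lra|].
  apply H1. intros v Hv.
  generalize (H2 _ (lower_sum_step s t v Hv Hst)). lra.
Qed.

Lemma stieltjes_le s t : 0 <= s -> s <= t ->
  stieltjes t - stieltjes s <= A t * (B t - B s).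
Proof.
  intros Hs Hst. destruct (stieltjes_lub s Hs) as [H1 _].
  destruct (stieltjes_lub t ltac:(lra)) as [_ H2].
  cut (stieltjes t <= stieltjes s + A t * (B t - B s)); [lra|].
  apply H2. intros v Hv.
  destruct (lower_sum_cut t v Hv s (conj Hs Hst)) as [v' [H3 H4]].
  generalize (H1 _ H3). lra.
Qed.

End Stieltjes.

(** * Invariant curves are graphs *)

Lemma shift_INR (u : R -> R) :
  (forall s, u (s + 1) = u s + 1) -> forall n s, u (s + INR n) = u s + INR n.
Proof.
  intros H n s. induction n as [|n IH].
  - simpl. rewrite !Rplus_0_r. reflexivity.
  - rewrite S_INR, <- !Rplus_assoc, H, IH. reflexivity.
Qed.

(** * The running maximum of a lift of degree one *)

Section Hull.
Variable x : R -> R.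
Hypothesis x_cont : continuity x.
Hypothesis x_shift : forall s, x (s + 1) = x s + 1.

Definition hull (s : R) : R :=
  epsilon (inhabits 0) (is_lub (fun v => exists t, t <= s /\ v = x t)).

Lemma hull_lub s : is_lub (fun v => exists t, t <= s /\ v = x t) (hull s).
Proof.
  unfold hull. apply epsilon_spec.
  destruct (completeness (fun v => exists t, t <= s /\ v = x t)) as [m Hm].
  (* One period suffices: moving [t] up by an integer into [s - 1, s] only raises [x]. *)
  - destruct (continuity_ab_maj x (s - 1) s ltac:(lra) (fun c _ => x_cont c)) as [c [Hc _]].
    exists (x c). intros v [t [Ht ->]].
    destruct (nfloor_ex (s - t) ltac:(lra)) as [n [Hn1 Hn2]].
    generalize (Hc (t + INR n) ltac:(lra)).
    rewrite (shift_INR x x_shift). generalize (pos_INR n). lra.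
  - exists (x s), s. split; [lra|reflexivity].
  - exists m; exact Hm.
Qed.

Lemma hull_ge s t : t <= s -> x t <= hull s.
Proof. intros H. apply (proj1 (hull_lub s)). exists t; auto. Qed.

Lemma hull_least s b : (forall t, t <= s -> x t <= b) -> hull s <= b.
Proof. intros H. apply (proj2 (hull_lub s)). intros v [t [Ht ->]]. auto. Qed.

Lemma hull_nondecreasing : nondecreasing hull.
Proof. intros s t H. apply hull_least. intros u Hu. apply hull_ge. lra. Qed.

Lemma hull_shift s : hull (s + 1) = hull s + 1.
Proof.
  apply Rle_antisym.
  - apply hull_least. intros t Ht. replace t with (t - 1 + 1) by ring.
    rewrite x_shift. generalize (hull_ge s (t - 1) ltac:(lra)). lra.
  - cut (hull s <= hull (s + 1) - 1); [lra|].
    apply hull_least. intros t Ht. generalize (hull_ge (s + 1) (t + 1) ltac:(lra)).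
    rewrite x_shift. lra.
Qed.

Lemma hull_step s t b : s <= t -> hull s <= b -> (forall u, s <= u <= t -> x u <= b) ->
  hull t <= b.
Proof.
  intros Hst H1 H2. apply hull_least. intros u Hu.
  destruct (Rle_lt_dec s u); [apply H2; lra|].
  apply Rle_trans with (hull s); auto. apply hull_ge; lra.
Qed.

Lemma hull_continuous : continuity hull.
Proof.
  apply continuity_eps. intros s eps He.
  destruct (proj1 (continuity_eps x) x_cont s (eps / 3) ltac:(lra)) as [d [Hd H]].
  exists d; split; auto. intros t Ht. apply Rabs_def2 in Ht.
  assert (Hx : forall u, Rabs (u - s) < d -> x s - eps / 3 < x u < x s + eps / 3).
  { intros u Hu. generalize (Rabs_def2 _ _ (H u Hu)). lra. }
  assert (Hs := Hx t ltac:(apply Rabs_def1; lra)).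
  destruct (Rle_lt_dec s t) as [Hst|Hst].
  - assert (hull t <= hull s + eps / 3).
    { apply (hull_step s); auto; [lra|]. intros u Hu.
      generalize (Hx u ltac:(apply Rabs_def1; lra)) (hull_ge s s ltac:(lra)). lra. }
    generalize (hull_nondecreasing s t Hst). intros. apply Rabs_def1; lra.
  - assert (hull s <= hull t + 2 * (eps / 3)).
    { apply (hull_step t); auto; [lra|lra|]. intros u Hu.
      generalize (Hx u ltac:(apply Rabs_def1; lra)) (hull_ge t t ltac:(lra)). lra. }
    generalize (hull_nondecreasing t s ltac:(lra)). intros. apply Rabs_def1; lra.
Qed.

(** If [x s] were below the running maximum, [x] would stay below it near [s], so the maximum could
    not have increased just before [s]. *)
Lemma hull_left_support s : (forall t, t < s -> hull t < hull s) -> x s = hull s.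
Proof.
  intros H. apply Rle_antisym; [apply hull_ge; lra|].
  apply Rnot_lt_le; intros Hlt.
  destruct (proj1 (continuity_eps x) x_cont s ((hull s - x s) / 2) ltac:(lra)) as [d [Hd Hx]].
  cut (hull s <= Rmax (hull (s - d / 2)) ((hull s + x s) / 2)).
  { apply Rlt_not_le. apply Rmax_lub_lt; [apply H|]; lra. }
  apply (hull_step (s - d / 2)); [lra|apply Rmax_l|].
  intros u Hu. eapply Rle_trans; [|apply Rmax_r].
  generalize (Rabs_def2 _ _ (Hx u ltac:(apply Rabs_def1; lra))). lra.
Qed.

Lemma hull_right_support s : (forall t, s < t -> hull s < hull t) -> x s = hull s.
Proof.
  intros H. apply Rle_antisym; [apply hull_ge; lra|].
  apply Rnot_lt_le; intros Hlt.
  destruct (proj1 (continuity_eps x) x_cont s ((hull s - x s) / 2) ltac:(lra)) as [d [Hd Hx]].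
  cut (hull (s + d / 2) <= hull s).
  { apply Rlt_not_le, H. lra. }
  apply (hull_step s); [lra|lra|].
  intros u Hu.
  generalize (Rabs_def2 _ _ (Hx u ltac:(apply Rabs_def1; lra))). lra.
Qed.

End Hull.

(** * Birkhoff's theorem: monotonicity of the x-coordinate along an invariant curve *)

Section Birkhoff.
Variables (P P1 : R -> R) (L : R).
Hypothesis P_derive : forall y, is_derive P y (P1 y).
Hypothesis P_shift : forall y, P (y + 1) = P y.
Hypothesis L_nonneg : 0 <= L.
Hypothesis P1_lip : forall a b, Rabs (P1 b - P1 a) <= L * Rabs (b - a).
Variables x phi psi : R -> R.
Hypothesis x_cont : continuity x.
Hypothesis x_shift : forall s, x (s + 1) = x s + 1.
Hypothesis phi_inc : strictly_increasing phi.
Hypothesis phi_psi : forall s, phi (psi s) = s.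
Hypothesis psi_phi : forall s, psi (phi s) = s.
Hypothesis phi_shift : forall s, phi (s + 1) = phi s + 1.
Hypothesis x_eq : forall s, x (phi s) + x (psi s) = 2 * x s + P1 (x s).
Hypothesis x_inj : forall s t, x s = x t -> x (phi s) = x (phi t) -> s = t.

(* [A] and [C] are [M] after one step forward and backward, [D >= 0] is the defect of [M] as a
   subsolution, and the increments of the periodic function [K] dominate those of the integral of
   [D] against [dM]. *)
Let M := hull x.
Let A s := M (phi s).
Let C s := M (psi s).
Let D s := A s + C s - (2 * M s + P1 (M s)).
Let St := stieltjes A M.
Let K s := St s + M s * C s - St (psi s) - (M s * M s + P (M s)).

Let psi_inc : strictly_increasing psi := inverse_strictly_increasing phi psi phi_inc phi_psi.
Let phi_nd := strictly_increasing_le phi phi_inc.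
Let psi_nd := strictly_increasing_le psi psi_inc.
Let M_nd : nondecreasing M := hull_nondecreasing x x_cont x_shift.
Let M_shift : forall s, M (s + 1) = M s + 1 := hull_shift x x_cont x_shift.
Let M_cont : continuity M := hull_continuous x x_cont x_shift.

Lemma psi_shift s : psi (s + 1) = psi s + 1.
Proof. rewrite <- (phi_psi s) at 1. rewrite <- phi_shift. apply psi_phi. Qed.

Lemma hull_next_nondecreasing : nondecreasing A.
Proof. intros s t H. apply M_nd, phi_nd, H. Qed.

Lemma hull_next_shift s : A (s + 1) = A s + 1.
Proof. unfold A. rewrite phi_shift. apply M_shift. Qed.

Lemma hull_previous_nondecreasing : nondecreasing C.
Proof. intros s t H. apply M_nd, psi_nd, H. Qed.

Lemma hull_next_continuous : continuity A.
Proof.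
  apply (continuity_comp phi M); auto.
  apply (increasing_bijection_continuous phi psi); auto.
Qed.

Lemma hull_previous_continuous : continuity C.
Proof.
  apply (continuity_comp psi M); auto.
  apply (increasing_bijection_continuous psi phi); auto.
Qed.

Lemma periodic_derivative_shift y : P1 (y + 1) = P1 y.
Proof.
  rewrite <- (is_derive_unique P y (P1 y) (P_derive y)). symmetry. apply is_derive_unique.
  apply (is_derive_ext (fun z => P (z + 1))); [exact P_shift|].
  replace (P1 (y + 1)) with (scal 1 (P1 (y + 1))) by apply Rmult_1_l.
  apply (is_derive_comp P (fun z => z + 1)); [apply P_derive|].
  auto_derive; [exact I|ring].
Qed.

Lemma lipschitz_continuous : continuity P1.
Proof.
  apply continuity_eps. intros y eps He. exists (eps / (L + 1)). split.
  - apply Rdiv_lt_0_compat; lra.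
  - intros z Hz. apply Rle_lt_trans with (1 := P1_lip y z).
    generalize (Rabs_pos (z - y)); intros.
    apply (Rmult_lt_compat_r (L + 1)) in Hz; [|lra].
    replace (eps / (L + 1) * (L + 1)) with eps in Hz by (field; lra). nra.
Qed.

Lemma defect_continuous : continuity D.
Proof.
  apply continuity_minus; [apply continuity_plus; [apply hull_next_continuous|apply hull_previous_continuous]|].
  apply continuity_plus.
  - apply continuity_mult; [|exact M_cont]. apply continuity_const. intros a b; reflexivity.
  - apply (continuity_comp M P1); auto. apply lipschitz_continuous.
Qed.

(** Where the supremum [M s] is nearly attained by [x t] with [t <= s], the orbit equation holds at
    [t], and its left side is at most [A s + C s] because [phi] and [psi] preserve order; continuity
    of [P1] absorbs the error. *)
Lemma defect_nonneg s : 0 <= D s.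
Proof.
  apply Rnot_lt_le; intros Hlt.
  destruct (proj1 (continuity_eps _)
     (continuity_plus (fun y => 2 * y) P1
       (continuity_mult (fun _ => 2) id (continuity_const (fun _ => 2) (fun a b => eq_refl))
          (derivable_continuous id derivable_id)) lipschitz_continuous) (M s) (- D s) ltac:(lra)) as [d [Hd H]].
  unfold plus_fct in H.
  assert (Hex : exists t, t <= s /\ M s - d < x t).
  { apply NNPP; intros Hn. cut (M s <= M s - d); [lra|].
    apply hull_least; auto. intros t Ht. apply Rnot_lt_le; intros Hx. apply Hn. exists t; auto. }
  destruct Hex as [t [Ht Hx]].
  assert (Hx' := hull_ge x x_cont x_shift s t Ht). fold M in Hx'.
  assert (H1 := Rabs_def2 _ _ (H (x t) ltac:(apply Rabs_def1; lra))).
  assert (H2 := x_eq t).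
  assert (H3 := hull_ge x x_cont x_shift (phi s) (phi t) (phi_nd _ _ Ht)).
  assert (H4 := hull_ge x x_cont x_shift (psi s) (psi t) (psi_nd _ _ Ht)).
  fold M in H3, H4. unfold D, A, C in *. lra.
Qed.

(** Formally the derivative of [St (s + 1) - St s - M s] against [dM] is [A (s + 1) - A s - 1 = 0].
    Rigorously, its increments are bounded by a product of increments, and bisection is applied to
    it and to its negative. *)
Lemma I_shift s : 0 <= s -> St (s + 1) - St s - M s = St 1 - St 0 - M 0.
Proof.
  intros Hs.
  assert (H : forall s t, 0 <= s -> s <= t ->
    Rabs ((St (t + 1) - St t - M t) - (St (s + 1) - St s - M s)) <= (A t - A s) * (M t - M s)).
  { intros s0 t Hs0 Hst.
    generalize (stieltjes_ge A M hull_next_nondecreasing M_nd s0 t Hs0 Hst)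
      (stieltjes_le A M hull_next_nondecreasing M_nd s0 t Hs0 Hst)
      (stieltjes_ge A M hull_next_nondecreasing M_nd (s0 + 1) (t + 1) ltac:(lra) ltac:(lra))
      (stieltjes_le A M hull_next_nondecreasing M_nd (s0 + 1) (t + 1) ltac:(lra) ltac:(lra)).
    fold St. rewrite !hull_next_shift, !M_shift.
    intros. apply Rabs_le. split; lra. }
  replace (St 1) with (St (0 + 1)) by (f_equal; ring).
  apply Rle_antisym.
  - cut (- (St (0 + 1) - St 0 - M 0) <= - (St (s + 1) - St s - M s)); [lra|].
    apply (nondecreasing_of_quadratic_defect 0 (fun s => - (St (s + 1) - St s - M s)) A M hull_next_continuous hull_next_nondecreasing M_nd); try lra.
    intros s0 t Hs0 Hst. generalize (proj1 (Rabs_le_between _ _) (H s0 t Hs0 Hst)). lra.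
  - apply (nondecreasing_of_quadratic_defect 0 (fun s => (St (s + 1) - St s - M s)) A M hull_next_continuous hull_next_nondecreasing M_nd); try lra.
    intros s0 t Hs0 Hst. generalize (proj1 (Rabs_le_between _ _) (H s0 t Hs0 Hst)). lra.
Qed.

Lemma primitive_step a b : a <= b ->
  b * b + P b - (a * a + P a) <= (2 * a + P1 a) * (b - a) + (2 + L) * (b - a) ^ 2.
Proof.
  intros Hab.
  destruct (MVT_gen P a b P1) as [c [Hc Hc']].
  - intros z _. apply P_derive.
  - intros z _. apply continuity_pt_filterlim.
    apply (ex_derive_continuous P z). exists (P1 z). apply P_derive.
  - rewrite Rmin_left, Rmax_right in Hc by lra.
    generalize (proj1 (Rabs_le_between _ _) (P1_lip a c)). rewrite (Rabs_pos_eq (c - a)) by lra.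
    intros H. assert (H1 : P1 c <= P1 a + L * (b - a)) by nra.
    apply (Rmult_le_compat_r (b - a)) in H1; nra.
Qed.

(** Since [A (psi s) = M s], the term [St (psi s)] integrates [M] against [dC], and integration by
    parts with [M * C] leaves [C dM]. So [dK] is [(A + C) dM] minus the differential of
    [M^2 + P(M)], that is [D dM], up to a quadratic error. *)
Lemma balance_step s t : 0 <= s -> 0 <= psi s -> s <= t ->
  D s * (M t - M s) - (2 + L) * (M t - M s) ^ 2 <= K t - K s.
Proof.
  intros Hs Hps Hst.
  generalize (stieltjes_ge A M hull_next_nondecreasing M_nd s t Hs Hst)
    (stieltjes_le A M hull_next_nondecreasing M_nd (psi s) (psi t) Hps (psi_nd _ _ Hst))
    (primitive_step (M s) (M t) (M_nd _ _ Hst)).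
  fold St. unfold A at 2. rewrite phi_psi. fold (C s) (C t). unfold K, D. nra.
Qed.

(** [stieltjes] is controlled on nonnegative arguments only, so both [s] and [psi s] have to be
    nonnegative. *)
Let c0 := Rmax 0 (phi 0).

Lemma base_point_spec s : c0 <= s -> 0 <= s /\ 0 <= psi s.
Proof.
  intros H. assert (H1 := Rmax_l 0 (phi 0)). assert (H2 := Rmax_r 0 (phi 0)). fold c0 in H1, H2.
  split; [lra|]. rewrite <- (psi_phi 0). apply psi_nd. lra.
Qed.

Lemma balance_nondecreasing s t : c0 <= s -> s <= t -> K s <= K t.
Proof.
  apply (nondecreasing_of_quadratic_defect c0 K (fun s => (2 + L) * M s) M).
  - apply continuity_mult; [|exact M_cont]. apply continuity_const. intros a b; reflexivity.
  - intros a b Hab. generalize (M_nd a b Hab). nra.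
  - exact M_nd.
  - intros a b Ha Hab. destruct (base_point_spec a Ha) as [H1 H2].
    generalize (balance_step a b H1 H2 Hab) (defect_nonneg a) (M_nd a b Hab). nra.
Qed.

(** Exactness enters here: by [I_shift] at [s] and at [psi s] the two [St] terms contribute
    [M s - C s], which cancels the change of [M * C - M * M], and [P] is periodic. *)
Lemma balance_shift s : c0 <= s -> K (s + 1) = K s.
Proof.
  intros Hs. destruct (base_point_spec s Hs) as [H1 H2].
  generalize (I_shift s H1) (I_shift (psi s) H2). unfold K, C.
  rewrite psi_shift, !M_shift, P_shift. fold (C s). nra.
Qed.

Lemma balance_shift_INR n s : c0 <= s -> K (s + INR n) = K s.
Proof.
  intros Hs. induction n as [|n IH].
  - simpl. rewrite Rplus_0_r. reflexivity.
  - rewrite S_INR, <- Rplus_assoc, balance_shift; auto. generalize (pos_INR n). lra.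
Qed.

Lemma defect_shift_INR n s : D (s + INR n) = D s.
Proof.
  assert (H : forall s, D (s + 1) = D s).
  { intros u. unfold D, A, C. rewrite phi_shift, psi_shift, !M_shift.
    replace (P1 (M u + 1)) with (P1 (M u)); [ring|].
    symmetry. apply periodic_derivative_shift. }
  induction n as [|n IH].
  - simpl. rewrite Rplus_0_r. reflexivity.
  - rewrite S_INR, <- Rplus_assoc, H. exact IH.
Qed.

(** [K] is nondecreasing and periodic beyond [c0], so it cannot increase; [balance_step] then bounds
    [D s] after division by the increment of [M]. Periodicity first moves the points beyond [c0]. *)
Lemma defect_le s t : s <= t -> M s < M t -> D s <= (2 + L) * (M t - M s).
Proof.
  intros Hst HM.
  destruct (nfloor_ex (Rmax 0 (c0 - s)) (Rmax_l _ _)) as [n [_ Hn]].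
  assert (Hn' : c0 <= s + INR (S n)) by (rewrite S_INR; generalize (Rmax_r 0 (c0 - s)); lra).
  clear Hn. revert n Hn'. intros m. generalize (S m). clear m. intros n Hn'.
  destruct (base_point_spec _ Hn') as [H1 H2].
  assert (HK : K (t + INR n) <= K (s + INR n)).
  { destruct (nfloor_ex (t - s) ltac:(lra)) as [m [_ Hm]].
    rewrite <- (balance_shift_INR (S m) (s + INR n)) by auto.
    apply balance_nondecreasing; [lra|]. rewrite S_INR. lra. }
  generalize (balance_step _ (t + INR n) H1 H2 ltac:(lra)).
  rewrite defect_shift_INR, !(shift_INR M M_shift).
  replace (M t + INR n - (M s + INR n)) with (M t - M s) by ring.
  intros H. apply (Rmult_le_reg_r (M t - M s)); [lra|]. nra.
Qed.

(** Let the first point of [defect_le] tend to [s] from the left; [D] and [M] are continuous. *)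
Lemma defect_left_support s : (forall t, t < s -> M t < M s) -> D s <= 0.
Proof.
  intros H. apply Rnot_lt_le; intros Hlt.
  destruct (proj1 (continuity_eps D) defect_continuous s (D s / 2) ltac:(lra)) as [d1 [Hd1 H1]].
  destruct (proj1 (continuity_eps M) M_cont s (D s / 2 / (2 + L))) as [d2 [Hd2 H2]].
  { apply Rdiv_lt_0_compat; lra. }
  set (t := s - Rmin d1 d2 / 2).
  assert (Hm := Rmin_pos d1 d2 Hd1 Hd2).
  assert (Hm1 := Rmin_l d1 d2). assert (Hm2 := Rmin_r d1 d2).
  assert (Hts : t < s) by (unfold t; lra).
  generalize (defect_le t s ltac:(lra) (H t Hts))
    (Rabs_def2 _ _ (H1 t ltac:(apply Rabs_def1; unfold t; lra)))
    (Rabs_def2 _ _ (H2 t ltac:(apply Rabs_def1; unfold t; lra))).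
  intros Ha Hb [_ Hc].
  apply (Rmult_lt_compat_r (2 + L)) in Hc; [|lra].
  replace (- (D s / 2 / (2 + L)) * (2 + L)) with (- (D s / 2)) in Hc by (field; lra). lra.
Qed.

Lemma defect_right_support s : (forall t, s < t -> M s < M t) -> D s <= 0.
Proof.
  intros H. apply Rnot_lt_le; intros Hlt.
  destruct (proj1 (continuity_eps M) M_cont s (D s / (2 + L))) as [d2 [Hd2 H2]].
  { apply Rdiv_lt_0_compat; lra. }
  set (t := s + d2 / 2).
  assert (Hts : s < t) by (unfold t; lra).
  generalize (defect_le s t ltac:(lra) (H t Hts))
    (Rabs_def2 _ _ (H2 t ltac:(apply Rabs_def1; unfold t; lra))).
  intros Ha [Hc _].
  apply (Rmult_lt_compat_r (2 + L)) in Hc; [|lra].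
  replace (D s / (2 + L) * (2 + L)) with (D s) in Hc by (field; lra). lra.
Qed.

(** Both terms on the left of the orbit equation are at most their counterparts [A s] and [C s],
    while their sum is at least [A s + C s]; so both are equal to them. *)
Lemma next_on_support s : D s <= 0 -> x s = M s -> x (phi s) = A s.
Proof.
  intros HD Hx. generalize (x_eq s). rewrite Hx.
  generalize (hull_ge x x_cont x_shift (phi s) (phi s) ltac:(lra))
    (hull_ge x x_cont x_shift (psi s) (psi s) ltac:(lra)).
  fold M. unfold D, A, C in *. lra.
Qed.

(* The end points of a plateau of [M] would be the same point of the curve. *)
Lemma hull_strictly_increasing : strictly_increasing M.
Proof.
  intros a b Hab. destruct (M_nd a b ltac:(lra)) as [|Heq]; auto. exfalso.
  (* [s2] and [s1 = - m] are the ends of the plateau through [a]; the left end comes from a supremum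
     over reflected parameters. *)
  destruct (completeness (fun t => M t <= M a)) as [s2 [Hs2 Hs2']].
  { exists (a + 1). intros t Ht. apply Rnot_lt_le; intros Hlt.
    generalize (M_nd (a + 1) t ltac:(lra)). rewrite M_shift. lra. }
  { exists a. lra. }
  destruct (completeness (fun t => M a <= M (- t))) as [m [Hm Hm']].
  { exists (1 - a). intros t Ht. apply Rnot_lt_le; intros Hlt.
    generalize (M_nd (- t + 1) a ltac:(lra)). rewrite M_shift. lra. }
  { exists (- a). rewrite Ropp_involutive. lra. }
  set (s1 := - m).
  assert (Hb2 : b <= s2) by (apply Hs2; lra).
  assert (Ha1 : s1 <= a).
  { unfold s1. cut (- a <= m); [lra|]. apply Hm. rewrite Ropp_involutive. lra. }
  assert (Hr : forall t, s2 < t -> M a < M t).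
  { intros t Ht. apply Rnot_le_lt; intros Hle. generalize (Hs2 t Hle). lra. }
  assert (Hl : forall t, t < s1 -> M t < M a).
  { intros t Ht. apply Rnot_le_lt; intros Hle.
    generalize (Hm (- t)). rewrite Ropp_involutive. unfold s1 in Ht. intros Hx.
    generalize (Hx Hle). lra. }
  assert (HM2 : M s2 = M a).
  { apply Rle_antisym; [|apply M_nd; lra].
    apply Rnot_lt_le; intros Hlt.
    destruct (proj1 (continuity_eps M) M_cont s2 (M s2 - M a) ltac:(lra)) as [d [Hd H]].
    cut (s2 <= s2 - d / 2); [lra|]. apply Hs2'. intros t Ht. apply Rnot_lt_le; intros Ht'.
    generalize (M_nd (s2 - d / 2) t ltac:(lra))
      (Rabs_def2 _ _ (H (s2 - d / 2) ltac:(apply Rabs_def1; lra))). lra. }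
  assert (HM1 : M s1 = M a).
  { apply Rle_antisym; [apply M_nd; lra|].
    apply Rnot_lt_le; intros Hlt.
    destruct (proj1 (continuity_eps M) M_cont s1 (M a - M s1) ltac:(lra)) as [d [Hd H]].
    cut (m <= m - d / 2); [lra|]. apply Hm'. intros t Ht. apply Rnot_lt_le; intros Ht'.
    generalize (M_nd (- t) (s1 + d / 2) ltac:(unfold s1; lra))
      (Rabs_def2 _ _ (H (s1 + d / 2) ltac:(apply Rabs_def1; lra))). lra. }
  assert (Hl1 : forall t, t < s1 -> M t < M s1) by (rewrite HM1; exact Hl).
  assert (Hr2 : forall t, s2 < t -> M s2 < M t) by (rewrite HM2; exact Hr).
  assert (HD1 := defect_left_support s1 Hl1). assert (HD2 := defect_right_support s2 Hr2).
  assert (Hx1 : x s1 = M s1) by (apply hull_left_support; auto).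
  assert (Hx2 : x s2 = M s2) by (apply hull_right_support; auto).
  assert (H1 := next_on_support s1 HD1 Hx1). assert (H2 := next_on_support s2 HD2 Hx2).
  assert (Hs : s1 = s2); [|lra].
  (* The defect vanishes at both ends and [M] agrees there, so [A + C] agrees; both terms being
     monotone, [A] agrees as well. *)
  apply x_inj; [congruence|]. rewrite H1, H2.
  generalize (defect_nonneg s1) (defect_nonneg s2) (hull_next_nondecreasing s1 s2 ltac:(lra)) (hull_previous_nondecreasing s1 s2 ltac:(lra)).
  unfold D in *. rewrite HM1, HM2 in *. lra.
Qed.

Lemma invariant_curve_graph : strictly_increasing x.
Proof.
  assert (H : forall s, x s = M s).
  { intros s. apply hull_left_support; auto. intros t Ht. apply hull_strictly_increasing, Ht. }
  intros s t Hst. rewrite !H. apply hull_strictly_increasing, Hst.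
Qed.

End Birkhoff.

(** * Lifts of degree one, and the circle map of an invariant curve *)

Lemma shift_INR_opp (u : R -> R) :
  (forall s, u (s + 1) = u s + 1) -> forall n s, u (s - INR n) = u s - INR n.
Proof.
  intros H n s. generalize (shift_INR u H n (s - INR n)).
  replace (s - INR n + INR n) with s by ring. lra.
Qed.

Lemma shift_IZR (u : R -> R) :
  (forall s, u (s + 1) = u s + 1) -> forall z s, u (s + IZR z) = u s + IZR z.
Proof.
  intros H z s. destruct (Z.le_gt_cases 0 z) as [Hz|Hz].
  - rewrite <- (Z2Nat.id z Hz), <- INR_IZR_INZ. apply shift_INR, H.
  - replace z with (- Z.of_nat (Z.to_nat (- z)))%Z by lia.
    rewrite opp_IZR, <- INR_IZR_INZ. apply shift_INR_opp, H.
Qed.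

Lemma shift_surjective (u : R -> R) :
  continuity u -> (forall s, u (s + 1) = u s + 1) -> forall v, exists s, u s = v.
Proof.
  intros Hc Hs v. destruct (nfloor_ex (Rabs (v - u 0)) (Rabs_pos _)) as [n [_ Hn]].
  rewrite <- S_INR in Hn. apply Rabs_def2 in Hn.
  destruct (ivt_value u (0 - INR (S n)) (0 + INR (S n)) v) as [c [_ Hc']]; auto.
  - generalize (pos_INR (S n)). lra.
  - rewrite (shift_INR u Hs), (shift_INR_opp u Hs). lra.
  - exists c; exact Hc'.
Qed.

Lemma shift_displacement_bounded (u : R -> R) :
  continuity u -> (forall s, u (s + 1) = u s + 1) ->
  exists B, forall s, Rabs (u s - s) <= B.
Proof.
  intros Hc Hs.
  assert (Hv : continuity (fun s => u s - s)).
  { apply continuity_minus; auto. apply derivable_continuous, derivable_id. }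
  destruct (continuity_ab_maj (fun s => u s - s) 0 1 ltac:(lra) (fun c _ => Hv c)) as [M [HM _]].
  destruct (continuity_ab_min (fun s => u s - s) 0 1 ltac:(lra) (fun c _ => Hv c)) as [m [Hm _]].
  exists (Rabs (u M - M) + Rabs (u m - m)). intros s.
  destruct (base_Int_part s) as [H1 H2].
  generalize (HM (s - IZR (Int_part s)) ltac:(lra)) (Hm (s - IZR (Int_part s)) ltac:(lra)).
  assert (E := shift_IZR u Hs (- Int_part s) s). rewrite opp_IZR in E.
  unfold Rminus in *. rewrite E.
  generalize (Rle_abs (u M + - M)) (Rle_abs (- (u m + - m))) (Rabs_pos (u M + - M)) (Rabs_pos (u m + - m)).
  rewrite Rabs_Ropp. intros. apply Rabs_le. lra.
Qed.

(** If the order were reversed at [a < b], then [u] at a point [a + n] beyond [b] would exceed [u a]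
    again, and the value [u a] would be taken a second time at or after [b]. *)
Lemma shift_increasing (u : R -> R) :
  continuity u -> (forall s, u (s + 1) = u s + 1) -> (forall s t, u s = u t -> s = t) ->
  strictly_increasing u.
Proof.
  intros Hc Hs Hi a b Hab. apply Rnot_le_lt; intros Hle.
  destruct (nfloor_ex (b - a) ltac:(lra)) as [n [_ Hn]]. rewrite <- S_INR in Hn.
  destruct (ivt_value u b (a + INR (S n)) (u a)) as [c [Hc1 Hc2]]; auto; [lra| |].
  - rewrite (shift_INR u Hs). generalize (pos_INR (S n)). lra.
  - apply Hi in Hc2. lra.
Qed.

(* [f] is the circle map of an invariant graph for the potential [P], [P1 = P']:
   on it, [x_(n+1) + x_(n-1) = 2 x_n + P1 x_n] along [x_(n+1) = f x_n]. *)
Record graph_map (P1 : R -> R) (w : R) (f fi : R -> R) : Prop := {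
  gm_inc : strictly_increasing f;
  gm_f_fi : forall x, f (fi x) = x;
  gm_fi_f : forall x, fi (f x) = x;
  gm_shift : forall x, f (x + 1) = f x + 1;
  gm_eq : forall x, f x + fi x = 2 * x + P1 x;
  gm_freq : forall x,
    Un_cv (fun n => (Nat.iter (S n) f x - x) / INR (S n)) w }.

Section Curve.
Variables (P P1 : R -> R) (L w : R).
Hypothesis P_derive : forall y, is_derive P y (P1 y).
Hypothesis P_shift : forall y, P (y + 1) = P y.
Hypothesis L_nonneg : 0 <= L.
Hypothesis P1_lip : forall a b, Rabs (P1 b - P1 a) <= L * Rabs (b - a).

Let h := fun x x' => h0 x x' + P x'.

(** Derivatives are unique, so the implicit relation is the explicit map sending (x, y) to (x + y, y
    + P1 (x + y)). *)
Lemma twist_rel_iff p q :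
  twist_rel h p q <->
  snd p = fst q - fst p /\ snd q = fst q - fst p + P1 (fst q).
Proof.
  assert (H1 : is_derive (fun t => h t (fst q)) (fst p) (fst p - fst q)).
  { unfold h, h0. auto_derive; [exact I|field]. }
  assert (H2 : is_derive (fun t => h (fst p) t) (fst q) (fst q - fst p + P1 (fst q))).
  { apply (is_derive_plus (fun t => h0 (fst p) t) P); [|apply P_derive].
    unfold h0. auto_derive; [exact I|field]. }
  split.
  - intros [H3 H4].
    generalize (is_derive_unique _ _ _ H1) (is_derive_unique _ _ _ H2)
      (is_derive_unique _ _ _ H3) (is_derive_unique _ _ _ H4). lra.
  - intros [H3 H4]. split.
    + replace (- snd p) with (fst p - fst q) by lra. exact H1.
    + rewrite H4. exact H2.
Qed.

Section Gamma.
Variable g : R -> R * R.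
Hypothesis g_lift : noncontractible_simple_lift g.
Hypothesis g_inv : invariant_curve h g.

Let X s := fst (g s).
Let Y s := snd (g s).

Lemma g_inj s t : X s = X t -> Y s = Y t -> s = t.
Proof.
  intros H1 H2. destruct g_lift as [_ [_ [_ H]]].
  rewrite (H s t 0%Z); [ring|]. fold (X t) (Y t).
  rewrite Rplus_0_r, <- H1, <- H2. apply surjective_pairing.
Qed.

Lemma X_shift s : X (s + 1) = X s + 1.
Proof. destruct g_lift as [_ [_ [H _]]]. unfold X. rewrite H. reflexivity. Qed.

Lemma Y_shift s : Y (s + 1) = Y s.
Proof. destruct g_lift as [_ [_ [H _]]]. unfold Y. rewrite H. reflexivity. Qed.

Lemma next_exists s : exists t, X t = X s + Y s /\ Y t = Y s + P1 (X t).
Proof.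
  destruct g_inv as [H _].
  destruct (H (g s) (X s + Y s, Y s + P1 (X s + Y s))) as [t Ht].
  - exists s; reflexivity.
  - apply twist_rel_iff. simpl. unfold X, Y. split; ring.
  - exists t. unfold X at 1 3, Y at 2. rewrite Ht. simpl. auto.
Qed.

Lemma previous_exists s : exists t, X s = X t + Y t /\ Y s = Y t + P1 (X s).
Proof.
  destruct g_inv as [_ H]. destruct (H (g s)) as [p [[t <-] Ht]].
  - exists s; reflexivity.
  - apply twist_rel_iff in Ht. exists t. unfold X, Y. lra.
Qed.

Let phi s := proj1_sig (constructive_indefinite_description _ (next_exists s)).
Let psi s := proj1_sig (constructive_indefinite_description _ (previous_exists s)).

Lemma phi_spec s : X (phi s) = X s + Y s /\ Y (phi s) = Y s + P1 (X (phi s)).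
Proof. exact (proj2_sig (constructive_indefinite_description _ (next_exists s))). Qed.

Lemma psi_spec s : X s = X (psi s) + Y (psi s) /\ Y s = Y (psi s) + P1 (X s).
Proof. exact (proj2_sig (constructive_indefinite_description _ (previous_exists s))). Qed.

Lemma phi_psi s : phi (psi s) = s.
Proof.
  destruct (phi_spec (psi s)) as [H1 H2]. destruct (psi_spec s) as [H3 H4].
  apply g_inj; [lra|]. rewrite H2, H4. f_equal. f_equal. lra.
Qed.

Lemma psi_phi s : psi (phi s) = s.
Proof.
  destruct (phi_spec s) as [H1 H2]. destruct (psi_spec (phi s)) as [H3 H4].
  apply g_inj; lra.
Qed.

Lemma phi_shift s : phi (s + 1) = phi s + 1.
Proof.
  destruct (phi_spec (s + 1)) as [H1 H2]. destruct (phi_spec s) as [H3 H4].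
  rewrite X_shift, Y_shift in *. apply g_inj; rewrite ?X_shift, ?Y_shift; [lra|].
  rewrite H2, H4. f_equal. rewrite H1, H3. replace (X s + 1 + Y s) with (X s + Y s + 1) by ring.
  apply (periodic_derivative_shift P P1 P_derive P_shift).
Qed.

Lemma X_cont : continuity X.
Proof. exact (proj1 g_lift). Qed.

Lemma Y_cont : continuity Y.
Proof. exact (proj1 (proj2 g_lift)). Qed.

Lemma dist_cont a b : continuity (fun t => Rabs (X t - a) + Rabs (Y t - b)).
Proof.
  apply continuity_plus.
  - apply (continuity_comp (fun t => X t - a) Rabs); [|exact Rcontinuity_abs].
    apply continuity_minus; [exact X_cont | apply continuity_const; intros ? ?; reflexivity].
  - apply (continuity_comp (fun t => Y t - b) Rabs); [|exact Rcontinuity_abs].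
    apply continuity_minus; [exact Y_cont | apply continuity_const; intros ? ?; reflexivity].
Qed.

Lemma dist_lower_bound s u v : u <= v -> (forall t, u <= t <= v -> t <> s) ->
  exists m, 0 < m /\ forall t, u <= t <= v -> m <= Rabs (X t - X s) + Rabs (Y t - Y s).
Proof.
  intros Huv Hs.
  destruct (continuity_ab_min _ u v Huv (fun c _ => dist_cont (X s) (Y s) c)) as [m [H1 H2]].
  exists (Rabs (X m - X s) + Rabs (Y m - Y s)). split; [|exact H1].
  generalize (Rabs_pos (X m - X s)) (Rabs_pos (Y m - Y s)). intros H3 H4.
  destruct (Rle_lt_or_eq_dec 0 _ (Rplus_le_le_0_compat _ _ H3 H4)) as [|H5]; auto.
  exfalso. apply (Hs m H2). apply g_inj.
  - destruct (Req_dec (X m - X s) 0) as [|H6]; [lra|]. apply Rabs_pos_lt in H6. lra.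
  - destruct (Req_dec (Y m - Y s) 0) as [|H6]; [lra|]. apply Rabs_pos_lt in H6. lra.
Qed.

(** [phi] is the image curve read in the parameter of [g]. The image depends continuously on [s],
    and on a compact parameter window minus a neighbourhood of [phi s] the curve keeps a positive
    distance from the image point. *)
Lemma phi_cont : continuity phi.
Proof.
  apply continuity_eps. intros s eps He.
  destruct (shift_displacement_bounded X X_cont X_shift) as [B HB].
  (* [B] bounds [X t - t], so every parameter whose [X] is within 1 of [X (phi s)] lies in the
     window. *)
  destruct (dist_lower_bound (phi s) (Rmin (X (phi s) - B - 1) (phi s - eps)) (phi s - eps))
    as [m1 [Hm1 H1]]; [apply Rmin_r | intros t Ht; lra|].
  destruct (dist_lower_bound (phi s) (phi s + eps) (Rmax (X (phi s) + B + 1) (phi s + eps)))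
    as [m2 [Hm2 H2]]; [apply Rmax_r | intros t Ht; lra|].
  set (m := Rmin 1 (Rmin m1 m2)).
  assert (Hm : 0 < m <= 1 /\ m <= m1 /\ m <= m2).
  { unfold m. generalize (Rmin_l 1 (Rmin m1 m2)) (Rmin_r 1 (Rmin m1 m2)) (Rmin_l m1 m2) (Rmin_r m1 m2)
      (Rmin_pos 1 (Rmin m1 m2) ltac:(lra) (Rmin_pos _ _ Hm1 Hm2)). lra. }
  assert (HF1 : continuity (fun t => X t + Y t)) by (apply continuity_plus; [exact X_cont|exact Y_cont]).
  assert (HF2 : continuity (fun t => Y t + P1 (X t + Y t))).
  { apply continuity_plus; [exact Y_cont|].
    apply (continuity_comp (fun t => X t + Y t) P1); auto.
    apply (lipschitz_continuous P1 L); auto. }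
  destruct (proj1 (continuity_eps _) HF1 s (m / 2) ltac:(lra)) as [d1 [Hd1 Hc1]].
  destruct (proj1 (continuity_eps _) HF2 s (m / 2) ltac:(lra)) as [d2 [Hd2 Hc2]].
  exists (Rmin d1 d2). split; [apply Rmin_pos; auto|]. intros t Ht.
  specialize (Hc1 t ltac:(generalize (Rmin_l d1 d2); lra)).
  specialize (Hc2 t ltac:(generalize (Rmin_r d1 d2); lra)). simpl in Hc1, Hc2.
  destruct (phi_spec s) as [E1 E2]. destruct (phi_spec t) as [E3 E4].
  rewrite E1 in E2. rewrite E3 in E4. rewrite <- E1, <- E3 in Hc1. rewrite <- E2, <- E4 in Hc2.
  assert (HBt := proj1 (Rabs_le_between _ _) (HB (phi t))).
  assert (Hx := Rabs_def2 _ _ Hc1).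
  apply Rabs_def1; apply Rnot_le_lt; intros Hle.
  - generalize (H2 (phi t)). intros Hc. specialize (Hc ltac:(split; [lra|]; eapply Rle_trans; [|apply Rmax_l]; lra)). lra.
  - generalize (H1 (phi t)). intros Hc. specialize (Hc ltac:(split; [|lra]; eapply Rle_trans; [apply Rmin_l|]; lra)). lra.
Qed.

Lemma phi_inc : strictly_increasing phi.
Proof.
  apply shift_increasing; [exact phi_cont | exact phi_shift |].
  intros s t H. rewrite <- (psi_phi s), H. apply psi_phi.
Qed.

Lemma X_inc : strictly_increasing X.
Proof.
  apply (invariant_curve_graph P P1 L P_derive P_shift L_nonneg P1_lip X phi psi
    X_cont X_shift phi_inc phi_psi psi_phi phi_shift).
  - intros s. destruct (phi_spec s). destruct (psi_spec s). lra.
  - intros s t H1 H2. apply g_inj; auto. destruct (phi_spec s). destruct (phi_spec t). lra.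
Qed.

Hypothesis g_freq : has_frequency h g w.

(** The parameter map [phi] is conjugated by the increasing bijection [X], which turns the curve
    into a graph over the x-axis. *)
Lemma curve_graph_map : exists f fi, graph_map P1 w f fi.
Proof.
  pose (Xi v := proj1_sig (constructive_indefinite_description _ (shift_surjective X X_cont X_shift v))).
  assert (X_Xi : forall v, X (Xi v) = v).
  { intros v. exact (proj2_sig (constructive_indefinite_description _ (shift_surjective X X_cont X_shift v))). }
  assert (Xi_X : forall s, Xi (X s) = s).
  { intros s. destruct (Rtotal_order (Xi (X s)) s) as [H|[H|H]]; auto;
      apply X_inc in H; rewrite X_Xi in H; lra. }
  assert (Xi_shift : forall v, Xi (v + 1) = Xi v + 1).
  { intros v. rewrite <- (Xi_X (Xi v + 1)), X_shift, X_Xi. reflexivity. }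
  assert (Xi_inc := inverse_strictly_increasing X Xi X_inc X_Xi).
  exists (fun v => X (phi (Xi v))), (fun v => X (psi (Xi v))). split.
  - intros a b Hab. apply X_inc, phi_inc, Xi_inc, Hab.
  - intros v. rewrite Xi_X, phi_psi. apply X_Xi.
  - intros v. rewrite Xi_X, psi_phi. apply X_Xi.
  - intros v. rewrite Xi_shift, phi_shift, X_shift. reflexivity.
  - intros v. destruct (phi_spec (Xi v)). destruct (psi_spec (Xi v)). rewrite X_Xi in *. lra.
  - intros v.
    assert (Hit : forall n, Nat.iter n (fun v => X (phi (Xi v))) v = X (Nat.iter n phi (Xi v))).
    { induction n as [|n IH]; [symmetry; apply X_Xi|].
      simpl. rewrite IH, Xi_X. reflexivity. }
    intros eps He.
    destruct (g_freq (fun n => g (Nat.iter n phi (Xi v)))) with (eps := eps) as [N HN]; auto.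
    + exists (Xi v). reflexivity.
    + intros n. apply twist_rel_iff. cbn [Nat.iter].
      change (Nat.iter (S n) phi (Xi v)) with (phi (Nat.iter n phi (Xi v))).
      generalize (Nat.iter n phi (Xi v)). intros s. destruct (phi_spec s) as [H1 H2]. unfold X, Y in *. lra.
    + exists N. intros n Hn. specialize (HN n Hn). rewrite Hit.
      change (fst (g (Nat.iter 0 phi (Xi v)))) with (X (Xi v)) in HN. rewrite X_Xi in HN. exact HN.
Qed.

End Gamma.

Lemma invariant_circle_graph_map :
  invariant_circle_with_frequency (fun x x' => h0 x x' + P x') w ->
  exists f fi, graph_map P1 w f fi.
Proof. intros [g [H1 [H2 H3]]]. apply (curve_graph_map g); assumption. Qed.

End Curve.

(** * Orbits on an invariant graph minimize the action *)

(** The potential is charged at the end of each step, as in [h0 x x' + P x']; hence [V (z O)] is not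
    counted and consecutive pieces add up exactly. *)
Fixpoint action (V : R -> R) (z : nat -> R) (n : nat) : R :=
  match n with
  | O => 0
  | S k => action V z k + (z (S k) - z k) ^ 2 / 2 + V (z (S k))
  end.

(** The second clause is uniqueness: a competitor of no larger action coincides with the orbit. The
    crossing argument for monotonicity depends on it. *)
Definition strictly_minimizing (V : R -> R) (X : nat -> R) : Prop :=
  forall a n z, z O = X a -> z n = X (a + n)%nat ->
    action V (fun i => X (a + i)%nat) n <= action V z n /\
    (action V z n <= action V (fun i => X (a + i)%nat) n ->
     forall i, (i <= n)%nat -> z i = X (a + i)%nat).

Section Calibration.
Variables (P P1 : R -> R) (w : R) (f fi : R -> R).
Hypothesis P_derive : forall y, is_derive P y (P1 y).
Hypothesis Hgm : graph_map P1 w f fi.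

Let f_cont : continuity f := increasing_bijection_continuous f fi
  (gm_inc _ _ _ _ Hgm) (gm_f_fi _ _ _ _ Hgm) (gm_fi_f _ _ _ _ Hgm).
Let fi_inc : strictly_increasing fi :=
  inverse_strictly_increasing f fi (gm_inc _ _ _ _ Hgm) (gm_f_fi _ _ _ _ Hgm).

Definition primitive (x : R) : R := RInt (fun t => f t - t) 0 x.
Let U := primitive.

Lemma primitive_derive x : is_derive U x (f x - x).
Proof.
  assert (Hc : forall t, continuous (fun t => f t - t) t).
  { intros t. apply continuity_pt_filterlim.
    apply (continuity_minus f id); [exact f_cont | apply derivable_continuous, derivable_id]. }
  apply (is_derive_RInt (fun t => f t - t) U 0); [|apply Hc].
  apply filter_forall. intros t. apply (RInt_correct (fun t => f t - t)).
  apply ex_RInt_continuous. intros z _. apply Hc.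
Qed.

(** A calibration: the invariant graph is [y = f x - x], and correcting the generating function by
    increments of its primitive [U] makes both partial derivatives vanish at [x' = f x]. *)
Definition theta (x x' : R) : R := (x' - x) ^ 2 / 2 + P x' + U x - U x'.

Lemma theta_derive_1 x x' : derivable_pt_lim (fun t => theta t x') x (f x - x').
Proof.
  apply is_derive_Reals. unfold theta.
  replace (f x - x') with ((x - x' + 0 + (f x - x)) - 0) by ring.
  apply (is_derive_minus (fun t => (x' - t) ^ 2 / 2 + P x' + U t) (fun _ => U x'));
    [|apply (is_derive_const (U x'))].
  apply (is_derive_plus (fun t => (x' - t) ^ 2 / 2 + P x') U); [|apply primitive_derive].
  apply (is_derive_plus (fun t => (x' - t) ^ 2 / 2) (fun _ => P x'));
    [|apply (is_derive_const (P x'))].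
  auto_derive; [exact I|field].
Qed.

Lemma theta_derive_2 x x' : derivable_pt_lim (fun t => theta x t) x' (fi x' - x).
Proof.
  apply is_derive_Reals. unfold theta.
  replace (fi x' - x) with ((x' - x + P1 x' + 0) - (f x' - x'))
    by (generalize (gm_eq _ _ _ _ Hgm x'); lra).
  apply (is_derive_minus (fun t => (t - x) ^ 2 / 2 + P t + U x) U); [|apply primitive_derive].
  apply (is_derive_plus (fun t => (t - x) ^ 2 / 2 + P t) (fun _ => U x));
    [|apply (is_derive_const (U x))].
  apply (is_derive_plus (fun t => (t - x) ^ 2 / 2) P); [|apply P_derive].
  auto_derive; [exact I|field].
Qed.

(** The derivative [fi x' - x] in the second variable has the sign of [x' - f x], by monotonicity of
    [fi]. *)
Lemma theta_graph_lt x x' : x' <> f x -> theta x (f x) < theta x x'.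
Proof.
  intros Hne. destruct (Rtotal_order x' (f x)) as [H|[H|H]]; [|contradiction|].
  - destruct (MVT_cor2 (theta x) (fun t => fi t - x) x' (f x) H) as [c [E Hc]].
    { intros c _. apply theta_derive_2. }
    generalize (fi_inc c (f x) (proj2 Hc)). rewrite (gm_fi_f _ _ _ _ Hgm). nra.
  - destruct (MVT_cor2 (theta x) (fun t => fi t - x) (f x) x' H) as [c [E Hc]].
    { intros c _. apply theta_derive_2. }
    generalize (fi_inc (f x) c (proj1 Hc)). rewrite (gm_fi_f _ _ _ _ Hgm). nra.
Qed.

Lemma theta_graph_le x x' : theta x (f x) <= theta x x'.
Proof.
  destruct (Req_dec x' (f x)) as [->|H]; [lra|]. left. apply theta_graph_lt, H.
Qed.

Lemma theta_graph_variation a b : a <= b ->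
  Rabs (theta b (f b) - theta a (f a)) <= (f b - f a) * (b - a).
Proof.
  intros [Hab|<-]; [|rewrite Rminus_diag, Rabs_R0; lra].
  destruct (MVT_cor2 (fun t => theta t (f a)) (fun t => f t - f a) a b Hab) as [c [E Hc]].
  { intros c _. apply theta_derive_1. }
  destruct (MVT_cor2 (fun t => theta t (f b)) (fun t => f t - f b) a b Hab) as [d [E' Hd]].
  { intros d _. apply theta_derive_1. }
  generalize (theta_graph_le b (f a)) (theta_graph_le a (f b))
    (gm_inc _ _ _ _ Hgm c b (proj2 Hc)) (gm_inc _ _ _ _ Hgm a d (proj1 Hd)).
  intros. apply Rabs_le. nra.
Qed.

(** Both partial derivatives vanish along the graph, but [f] is only continuous, so there is no
    chain rule; [theta_graph_variation] gives a quadratic bound that bisection removes in both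
    directions. *)
Lemma theta_graph_const a b : theta a (f a) = theta b (f b).
Proof.
  assert (H : forall a b, a <= b -> theta a (f a) = theta b (f b)).
  { clear a b. intros a b Hab.
    assert (f_nd := strictly_increasing_le f (gm_inc _ _ _ _ Hgm)).
    apply Rle_antisym.
    - apply (nondecreasing_of_quadratic_defect a (fun x => theta x (f x)) f (fun x => x)); auto; try lra.
      + intros s t Hst; exact Hst.
      + intros s t _ Hst. generalize (proj1 (Rabs_le_between _ _) (theta_graph_variation s t Hst)). lra.
    - apply Ropp_le_cancel.
      apply (nondecreasing_of_quadratic_defect a (fun x => - theta x (f x)) f (fun x => x)); auto; try lra.
      + intros s t Hst; exact Hst.
      + intros s t _ Hst. generalize (proj1 (Rabs_le_between _ _) (theta_graph_variation s t Hst)). lra. }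
  destruct (Rle_lt_dec a b) as [Hab|Hab]; [apply H, Hab | symmetry; apply H; lra].
Qed.

Section Rescaling.
Variables (V : R -> R) (q : R) (p J : Z).
Hypothesis q_pos : 0 < q.
Hypothesis V_shift : forall (k : Z) x, V (x + IZR k) = V x.
Hypothesis P_V : forall x, P x = V (q * x) / q ^ 2.

Let unscale (i : nat) (x : R) : R := (x + INR i * IZR p - IZR J) / q.
Let m := theta 0 (f 0).
(** The lower bound obtained by summing [theta >= m] along the path in the original coordinates and
    telescoping; it depends only on the end points, their times and the length. The terms with
    [IZR p] come from expanding the square of [z (S i) - z i + IZR p]. *)
Let low (a : nat) (z : nat -> R) (n : nat) : R :=
  q ^ 2 * (INR n * m + U (unscale (a + n) (z n)) - U (unscale a (z O)))
  - IZR p * (z n - z O) - INR n * IZR p ^ 2 / 2.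

Lemma low_step a z n :
  low a z (S n) + q ^ 2 * (theta (unscale (a + n) (z n)) (unscale (a + S n) (z (S n))) - m)
  = low a z n + (z (S n) - z n) ^ 2 / 2 + V (z (S n)).
Proof.
  unfold low, theta. rewrite P_V.
  replace (V (q * unscale (a + S n) (z (S n)))) with (V (z (S n))).
  2:{ rewrite <- (V_shift (Z.of_nat (a + S n) * p - J) (z (S n))). f_equal.
      unfold unscale. rewrite minus_IZR, mult_IZR, <- INR_IZR_INZ. field. lra. }
  assert (E : unscale (a + S n) (z (S n)) - unscale (a + n) (z n) = (z (S n) - z n + IZR p) / q).
  { unfold unscale. rewrite !plus_INR, S_INR. field. lra. }
  rewrite E, S_INR. field. lra.
Qed.

Lemma theta_ge x x' : m <= theta x x'.
Proof. unfold m. rewrite (theta_graph_const 0 x). apply theta_graph_le. Qed.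

Lemma low_le a z n : low a z n <= action V z n.
Proof.
  induction n as [|n IH].
  - unfold low. simpl. rewrite Nat.add_0_r. lra.
  - generalize (low_step a z n) (theta_ge (unscale (a + n) (z n)) (unscale (a + S n) (z (S n)))).
    simpl action. intros E H. assert (0 < q ^ 2) by (apply pow_lt; auto). nra.
Qed.

(** Equality in the total forces equality in every step, and [theta] attains its minimum only on the
    graph. *)
Lemma low_tight a z n : action V z n <= low a z n ->
  forall i, (i < n)%nat -> unscale (a + S i) (z (S i)) = f (unscale (a + i) (z i)).
Proof.
  induction n as [|n IH]; intros H i Hi; [lia|].
  assert (E := low_step a z n). assert (H1 := low_le a z n).
  assert (H2 := theta_ge (unscale (a + n) (z n)) (unscale (a + S n) (z (S n)))).
  assert (Hq : 0 < q ^ 2) by (apply pow_lt; auto).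
  simpl action in H.
  destruct (Nat.eq_dec i n) as [->|Hne].
  - apply NNPP. intros Hn. apply theta_graph_lt in Hn.
    rewrite (theta_graph_const _ 0) in Hn. fold m in Hn. nra.
  - apply IH; [|lia]. nra.
Qed.

Lemma low_orbit a z n :
  (forall i, (i < n)%nat -> unscale (a + S i) (z (S i)) = f (unscale (a + i) (z i))) ->
  action V z n = low a z n.
Proof.
  induction n as [|n IH]; intros H.
  - unfold low. simpl. rewrite Nat.add_0_r. lra.
  - simpl action. rewrite IH by (intros i Hi; apply H; lia).
    assert (E := low_step a z n). rewrite (H n), (theta_graph_const _ 0) in E by lia. fold m in E. lra.
Qed.

(** [low] agrees for the orbit and for a competitor with the same end points; the orbit attains it,
    and any path attaining it follows [f] from the same start. *)
Lemma rescaled_orbit_minimizing y :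
  strictly_minimizing V (fun i => q * Nat.iter i f y - INR i * IZR p + IZR J).
Proof.
  set (X := fun i => q * Nat.iter i f y - INR i * IZR p + IZR J).
  intros a n z Hz0 Hzn.
  assert (HX : forall i, unscale i (X i) = Nat.iter i f y).
  { intros i. unfold unscale, X. field. lra. }
  assert (Ho : action V (fun i => X (a + i)%nat) n = low a (fun i => X (a + i)%nat) n).
  { apply low_orbit. intros i _. rewrite !HX, Nat.add_succ_r. reflexivity. }
  assert (El : low a (fun i => X (a + i)%nat) n = low a z n).
  { unfold low. rewrite Nat.add_0_r, Hz0, Hzn. reflexivity. }
  rewrite Ho, El. split; [apply low_le|].
  intros H i Hi. assert (Ht := low_tight a z n H).
  assert (Hu : unscale (a + i) (z i) = unscale (a + i) (X (a + i)%nat)).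
  { induction i as [|i IH].
    - rewrite Nat.add_0_r, Hz0. reflexivity.
    - rewrite Ht, IH by lia. rewrite !HX, Nat.add_succ_r. reflexivity. }
  unfold unscale in Hu. apply (f_equal (fun v => v * q)) in Hu. field_simplify in Hu; lra.
Qed.

End Rescaling.
End Calibration.

(** * Minimizers near a resonance *)

Lemma action_ext V z z' n : (forall i, (i <= n)%nat -> z i = z' i) -> action V z n = action V z' n.
Proof.
  induction n as [|n IH]; intros H; simpl; auto.
  rewrite (IH (fun i Hi => H i (le_S _ _ Hi))), (H n) by lia. rewrite (H (S n)) by lia. reflexivity.
Qed.

Lemma action_split V z n m :
  action V z (n + m) = action V z n + action V (fun i => z (n + i)%nat) m.
Proof.
  induction m as [|m IH].
  - rewrite Nat.add_0_r. simpl. ring.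
  - rewrite Nat.add_succ_r. simpl. rewrite IH, Nat.add_succ_r. ring.
Qed.

(** The quadratic interaction is submodular: at a step where the two paths cross, exchanging their
    tails lowers the sum of squares, while the potential terms are only permuted. *)
Lemma action_min_max V z w n :
  action V (fun i => Rmin (z i) (w i)) n + action V (fun i => Rmax (z i) (w i)) n
  <= action V z n + action V w n.
Proof.
  induction n as [|n IH]; simpl; [lra|].
  unfold Rmin, Rmax in *.
  destruct (Rle_dec (z n) (w n)); destruct (Rle_dec (z (S n)) (w (S n))); nra.
Qed.

Lemma action_same_tail V z z' n : (forall i, (0 < i <= S n)%nat -> z i = z' i) ->
  action V z (S n) - action V z' (S n) = ((z 1%nat - z O) ^ 2 - (z' 1%nat - z' O) ^ 2) / 2.
Proof.
  induction n as [|n IH]; intros H.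
  - cbn [action]. rewrite (H 1%nat) by lia. field.
  - cbn [action] in *. rewrite (H (S (S n))), (H (S n)) by lia.
    specialize (IH (fun i Hi => H i ltac:(lia))). rewrite (H (S n)) in IH by lia. lra.
Qed.

Lemma action_same_interior V z z' n : (forall i, (0 < i <= S n)%nat -> z i = z' i) ->
  action V z (S (S n)) - action V z' (S (S n)) =
    ((z 1%nat - z O) ^ 2 - (z' 1%nat - z' O) ^ 2) / 2
  + ((z (S (S n)) - z (S n)) ^ 2 - (z' (S (S n)) - z' (S n)) ^ 2) / 2
  + (V (z (S (S n))) - V (z' (S (S n)))).
Proof.
  intros H. generalize (action_same_tail V z z' n H). cbn [action]. lra.
Qed.

Definition path (V : R -> R) (n : nat) (x y A : R) : Prop :=
  exists z : nat -> R, z O = x /\ z n = y /\ action V z n <= A.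

Lemma path_cat V n m x y w A B :
  path V n x y A -> path V m y w B -> path V (n + m) x w (A + B).
Proof.
  intros [z1 [H1 [H2 H3]]] [z2 [H4 [H5 H6]]].
  set (z := fun i => if Nat.leb i n then z1 i else z2 (i - n)%nat).
  assert (E : forall i, z (n + i)%nat = z2 i).
  { intros [|i]; unfold z.
    - rewrite Nat.add_0_r, Nat.leb_refl. congruence.
    - rewrite (proj2 (Nat.leb_gt _ _)) by lia. f_equal. lia. }
  exists z. split; [exact H1|]. split; [rewrite E; exact H5|].
  rewrite action_split, (action_ext V z z1 n), (action_ext V (fun i => z (n + i)%nat) z2 m).
  - lra.
  - intros i _. apply E.
  - intros i Hi. unfold z. rewrite (proj2 (Nat.leb_le _ _)) by lia. reflexivity.
Qed.

Lemma path_step V x y : path V 1 x y ((y - x) ^ 2 / 2 + V y).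
Proof.
  exists (fun i => match i with O => x | _ => y end). simpl. repeat split. lra.
Qed.

Lemma path_wait V n x : V x = 0 -> path V n x x 0.
Proof.
  intros H. exists (fun _ => x). repeat split.
  induction n as [|n IH]; simpl; [lra|]. rewrite H, Rminus_diag. nra.
Qed.

Lemma path_ramp V n x y v : (0 < n)%nat -> (forall u, V u <= v) ->
  path V n x y ((y - x) ^ 2 / (2 * INR n) + INR n * v).
Proof.
  intros Hn Hv. assert (0 < INR n) by (apply lt_0_INR; lia).
  exists (fun i => x + (y - x) * (INR i / INR n)). simpl INR at 1.
  split; [field; lra|]. split; [field; lra|].
  assert (E : forall m, action V (fun i => x + (y - x) * (INR i / INR n)) m
     <= INR m * ((y - x) ^ 2 / (2 * INR n ^ 2) + v)).
  { induction m as [|m IH]; [simpl; lra|]. cbn [action]. rewrite S_INR.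
    specialize (Hv (x + (y - x) * ((INR m + 1) / INR n))).
    replace (x + (y - x) * ((INR m + 1) / INR n) - (x + (y - x) * (INR m / INR n)))
      with ((y - x) / INR n) by (field; lra).
    replace (((y - x) / INR n) ^ 2 / 2) with ((y - x) ^ 2 / (2 * INR n ^ 2)) by (field; lra).
    lra. }
  eapply Rle_trans; [apply E|]. right. field. lra.
Qed.

Section Nonneg.
Variable V : R -> R.
Hypothesis V_nonneg : forall x, 0 <= V x.

Lemma action_nonneg z n : 0 <= action V z n.
Proof.
  induction n as [|n IH]; simpl; [lra|].
  generalize (V_nonneg (z (S n))) (pow2_ge_0 (z (S n) - z n)). simpl. lra.
Qed.

Lemma action_ge_step z n i : (i < n)%nat ->
  (z (S i) - z i) ^ 2 / 2 + V (z (S i)) <= action V z n.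
Proof.
  induction n as [|n IH]; intros Hi; [lia|]. cbn [action].
  destruct (Nat.eq_dec i n) as [->|Hne].
  - generalize (action_nonneg z n). lra.
  - generalize (IH ltac:(lia)) (V_nonneg (z (S n))) (pow2_ge_0 (z (S n) - z n)). lra.
Qed.

Lemma action_ge_count z n c : (forall i, (0 < i <= n)%nat -> c <= V (z i)) ->
  INR n * c <= action V z n.
Proof.
  induction n as [|n IH]; intros H; [simpl; lra|]. rewrite S_INR. cbn [action].
  generalize (IH (fun i Hi => H i ltac:(lia))) (H (S n) ltac:(lia)) (pow2_ge_0 (z (S n) - z n)). lra.
Qed.
End Nonneg.

Lemma square_shift t u v : -1 <= t <= 1 -> 0 <= u <= v ->
  (t - u) ^ 2 - t ^ 2 <= 2 * v + v ^ 2.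
Proof.
  intros Ht Hu. assert (0 <= (1 + t) * u) by (apply Rmult_le_pos; lra).
  assert (u ^ 2 <= v ^ 2) by (apply pow_incr; lra). lra.
Qed.

(** Over [P] steps, second differences of at least [4 u / P^2] add up to [P (P - 1) / 2] times that,
    which is [(2 - 2 / P) u >= u]; so [u] doubles. *)
Lemma convex_growth (P : nat) (u : nat -> R) (n : nat) :
  (2 <= P)%nat -> (forall i, (i <= n)%nat -> 0 < u i) ->
  (forall i, (i < n)%nat -> u i < u (S i)) ->
  (forall i, (S i < n)%nat -> 4 / INR P ^ 2 * u (S i) <= u (S (S i)) - 2 * u (S i) + u i) ->
  forall m, (m * P <= n)%nat -> 2 ^ m * u O <= u (m * P)%nat.
Proof.
  intros HP Hpos Hinc Hconv.
  assert (HP' : 2 <= INR P) by (apply (le_INR 2); auto).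
  set (c := 4 / INR P ^ 2) in *.
  assert (Hc : 0 < c) by (apply Rdiv_lt_0_compat; [|apply pow_lt]; lra).
  assert (Hmono : forall i j, (i + j <= n)%nat -> u i <= u (i + j)%nat).
  { intros i. induction j as [|j IH]; intros Hj; [rewrite Nat.add_0_r; lra|].
    rewrite Nat.add_succ_r. generalize (IH ltac:(lia)) (Hinc (i + j)%nat ltac:(lia)). lra. }
  assert (Hd : forall i j, (S (i + j) <= n)%nat ->
     INR j * (c * u i) <= u (S (i + j)) - u (i + j)%nat).
  { intros i. induction j as [|j IH]; intros Hj.
    - rewrite Nat.add_0_r in *. generalize (Hinc i ltac:(lia)). simpl. lra.
    - rewrite Nat.add_succ_r in *. rewrite S_INR.
      generalize (IH ltac:(lia)) (Hconv (i + j)%nat ltac:(lia)) (Hmono i (S j) ltac:(lia)).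
      rewrite Nat.add_succ_r. nra. }
  assert (Hs : forall i j, (i + j <= n)%nat ->
     u i + INR j * (INR j - 1) / 2 * (c * u i) <= u (i + j)%nat).
  { intros i. induction j as [|j IH]; intros Hj.
    - rewrite Nat.add_0_r. simpl. lra.
    - rewrite Nat.add_succ_r in *. rewrite S_INR.
      generalize (IH ltac:(lia)) (Hd i j Hj). lra. }
  induction m as [|m IH]; intros Hm; [simpl; lra|].
  replace (S m * P)%nat with (m * P + P)%nat by lia.
  generalize (IH ltac:(lia)) (Hs (m * P)%nat P ltac:(lia)) (Hpos (m * P)%nat ltac:(lia)).
  intros H1 H2 H3.
  replace (INR P * (INR P - 1) / 2 * (c * u (m * P)%nat))
    with (u (m * P)%nat * (2 - 2 / INR P)) in H2 by (unfold c; field; lra).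
  assert (2 / INR P <= 1).
  { apply (Rmult_le_reg_r (INR P)); [lra|]. field_simplify; lra. }
  simpl. nra.
Qed.

(** The shape used near the hyperbolic points: [4 / INR P ^ 2] is the curvature behind the growth
    rate, the bounds by [u] limit a single step near an integer, and [cp_small] keeps the potential
    well below the kinetic cost [u ^ 2 / 2]. *)
Record comb_potential (P : nat) (V V1 : R -> R) : Prop := {
  cp_nonneg : forall x, 0 <= V x;
  cp_int : forall j, V (IZR j) = 0;
  cp_small : forall j u, V (IZR j + u) <= u ^ 2 / 8;
  cp_max : forall x, V x <= 3 / INR P ^ 2;
  cp_away : forall j x, IZR j + 1 / 8 <= x <= IZR j + 7 / 8 -> 1 / 4 / INR P ^ 2 <= V x;
  cp_right : forall j u, 0 <= u <= 1 / 8 ->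
    4 / INR P ^ 2 * u <= V1 (IZR j + u) <= u;
  cp_left : forall j u, 0 <= u <= 1 / 8 ->
    - u <= V1 (IZR j - u) <= - (4 / INR P ^ 2 * u) }.

(** * Passage times of a minimizer near the integers, and shortcuts there *)

Section Minimizer.
Variables (P : nat) (V V1 : R -> R).
Hypothesis P_ge : (2 <= P)%nat.
Hypothesis HV : comb_potential P V V1.
Variable X : nat -> R.
Hypothesis X_min : strictly_minimizing V X.
Hypothesis X_eq : forall i, X (S (S i)) + X i = 2 * X (S i) + V1 (X (S i)).
Hypothesis X_start : X O < X 1%nat.
Hypothesis X_unbounded : forall v N, exists i, (N <= i)%nat /\ v < X i.

Let V_nonneg := cp_nonneg P V V1 HV.
Let P_pos : 2 <= INR P := le_INR 2 P P_ge.

Definition segment_action (a n : nat) : R := action V (fun i => X (a + i)%nat) n.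
Let Sg := segment_action.

Lemma segment_split a n m : Sg a (n + m) = Sg a n + Sg (a + n) m.
Proof.
  unfold Sg, segment_action. rewrite action_split. f_equal.
  apply action_ext. intros i _. f_equal. lia.
Qed.

Lemma segment_path a n : path V n (X a) (X (a + n)%nat) (Sg a n).
Proof.
  exists (fun i => X (a + i)%nat). rewrite Nat.add_0_r. repeat split. unfold Sg, segment_action. lra.
Qed.

Lemma segment_le a n A : path V n (X a) (X (a + n)%nat) A -> Sg a n <= A.
Proof.
  intros [z [H1 [H2 H3]]]. destruct (X_min a n z H1 H2) as [H4 _].
  unfold Sg, segment_action. lra.
Qed.

(* Aubry's crossing argument, applied to [X] and its time shift. *)
Lemma minimizer_increasing i : X i < X (S i).
Proof.
  induction i as [|i IH]; [exact X_start|].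
  apply Rnot_le_lt. intros Hle.
  (* The sequence and its shift must be ordered in the same way at both ends of the window, so that
     minimum and maximum keep the end points; [X_unbounded] supplies the right end. *)
  assert (Hb : exists n, (3 <= n)%nat /\ X (i + n)%nat < X (S (i + n))).
  { apply NNPP. intros Hn.
    assert (H : forall m, X (i + 3 + m)%nat <= X (i + 3)%nat).
    { induction m as [|m IHm]; [rewrite Nat.add_0_r; lra|].
      apply Rle_trans with (2 := IHm). apply Rnot_lt_le. intros Hlt. apply Hn.
      exists (3 + m)%nat. split; [lia|].
      replace (i + (3 + m))%nat with (i + 3 + m)%nat by lia.
      rewrite <- Nat.add_succ_r. exact Hlt. }
    destruct (X_unbounded (X (i + 3)%nat) (i + 3)) as [m [Hm1 Hm2]].
    specialize (H (m - (i + 3))%nat). replace (i + 3 + (m - (i + 3)))%nat with m in H by lia. lra. }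
  destruct Hb as [n [Hn Hlt]].
  set (z := fun k => Rmin (X (i + k)%nat) (X (S i + k)%nat)).
  set (y := fun k => Rmax (X (i + k)%nat) (X (S i + k)%nat)).
  assert (Hz : z O = X i /\ z n = X (i + n)%nat).
  { unfold z. rewrite !Nat.add_0_r. split; apply Rmin_left; simpl; lra. }
  assert (Hy : y O = X (S i) /\ y n = X (S i + n)%nat).
  { unfold y. rewrite !Nat.add_0_r. split; apply Rmax_right; simpl; lra. }
  destruct (X_min i n z (proj1 Hz) (proj2 Hz)) as [_ H1].
  destruct (X_min (S i) n y (proj1 Hy) (proj2 Hy)) as [H2 _].
  assert (H3 : action V z n + action V y n <=
    action V (fun k => X (i + k)%nat) n + action V (fun k => X (S i + k)%nat) n)
    by apply action_min_max.
  specialize (H1 ltac:(lra)).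
  assert (E1 := H1 1%nat ltac:(lia)). assert (E2 := H1 2%nat ltac:(lia)).
  unfold z in E1, E2.
  assert (F1 := Rmin_r (X (i + 1)%nat) (X (S i + 1)%nat)).
  assert (F2 := Rmin_r (X (i + 2)%nat) (X (S i + 2)%nat)).
  rewrite E1 in F1. rewrite E2 in F2.
  replace (i + 1)%nat with (S i) in * by lia. replace (S i + 1)%nat with (S (S i)) in * by lia.
  replace (i + 2)%nat with (S (S i)) in * by lia. replace (S i + 2)%nat with (S (S (S i))) in * by lia.
  (* A stationary step after a moving one: the equation gives [V1 (X (S i)) = X i - X (S i) < 0],
     and applied once more it makes the following step negative, against [F2]. *)
  assert (E : X (S (S i)) = X (S i)) by lra.
  generalize (X_eq i) (X_eq (S i)). rewrite E in *. lra.
Qed.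

Lemma minimizer_le i j : (i <= j)%nat -> X i <= X j.
Proof.
  intros H. induction H as [|j H IH]; [lra|]. generalize (minimizer_increasing j). lra.
Qed.

Lemma minimizer_lt i j : (i < j)%nat -> X i < X j.
Proof.
  intros H. apply Rlt_le_trans with (X (S i)); [apply minimizer_increasing | apply minimizer_le, H].
Qed.

Lemma minimizer_lt_inv i j : X i < X j -> (i < j)%nat.
Proof.
  intros H. destruct (le_lt_dec j i) as [Hle|]; auto. apply minimizer_le in Hle. lra.
Qed.

Lemma crossing v i k : (i <= k)%nat -> X i <= v < X k ->
  exists s, (i <= s < k)%nat /\ X s <= v < X (S s).
Proof.
  intros Hik. induction Hik as [|k Hik IH]; intros Hv; [lra|].
  destruct (Rlt_le_dec v (X k)) as [Hlt|Hle].
  - destruct IH as [s [Hs1 Hs2]]; [lra|]. exists s. split; [lia|auto].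
  - exists k. split; [lia|lra].
Qed.

(** A longer stay costs more than [28 P / (4 P^2) = 7 / P], while going to the integer in [P] steps,
    waiting there for free and returning in [P] steps costs at most [7 / P]. *)
Lemma time_middle j i r :
  IZR j + 1 / 8 <= X i -> X (i + r)%nat <= IZR j + 7 / 8 -> (r <= 28 * P)%nat.
Proof.
  intros H1 H2. destruct (le_lt_dec r (28 * P)) as [|Hr]; auto. exfalso.
  set (m := (r - 2 * P)%nat).
  assert (Hup : forall x, path V P x (IZR j) (1 / 2 * (x - IZR j) ^ 2 / INR P + 3 / INR P)).
  { intros x. destruct (path_ramp V P x (IZR j) (3 / INR P ^ 2) ltac:(lia) (cp_max P V V1 HV))
      as [z [E1 [E2 E3]]].
    exists z. repeat split; auto. eapply Rle_trans; [exact E3|]. right. field. lra. }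
  assert (Hdown : forall x, path V P (IZR j) x (1 / 2 * (x - IZR j) ^ 2 / INR P + 3 / INR P)).
  { intros x. destruct (path_ramp V P (IZR j) x (3 / INR P ^ 2) ltac:(lia) (cp_max P V V1 HV))
      as [z [E1 [E2 E3]]].
    exists z. repeat split; auto. eapply Rle_trans; [exact E3|]. right. field. lra. }
  assert (Hp := path_cat V _ _ _ _ _ _ _ (path_cat V _ _ _ _ _ _ _ (Hup (X i))
     (path_wait V m (IZR j) (cp_int P V V1 HV j))) (Hdown (X (i + r)%nat))).
  replace (P + m + P)%nat with r in Hp by (unfold m; lia).
  apply segment_le in Hp.
  assert (Hcount : INR r * (1 / 4 / INR P ^ 2) <= Sg i r).
  { apply action_ge_count; auto. intros s Hs. apply (cp_away P V V1 HV j).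
    generalize (minimizer_le i (i + s) ltac:(lia)) (minimizer_le (i + s) (i + r) ltac:(lia)). lra. }
  assert (Hx := minimizer_le i (i + r) ltac:(lia)).
  assert (Hr' : 28 * INR P < INR r).
  { apply lt_INR in Hr. rewrite mult_INR in Hr. simpl (INR 28) in Hr. lra. }
  assert (G : forall x, IZR j + 1 / 8 <= x <= IZR j + 7 / 8 ->
     1 / 2 * (x - IZR j) ^ 2 / INR P + 3 / INR P <= 7 / 2 / INR P).
  { intros x Hx'. apply (Rmult_le_reg_r (INR P)); [lra|]. field_simplify; [|lra|lra]. nra. }
  generalize (G (X i) ltac:(lra)) (G (X (i + r)%nat) ltac:(lra)). intros G1 G2.
  assert (G3 : INR r * (1 / 4 / INR P ^ 2) <= 7 / INR P) by lra.
  apply (Rmult_le_compat_r (4 * INR P ^ 2)) in G3; [|nra].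
  field_simplify in G3; lra.
Qed.

Variable k : nat.
(** A distance from an integer that grows to [1 / 8] within [k P] steps, by the doubling of
    [convex_growth]. *)
Let rho : R := / (8 * 2 ^ k).

Lemma rho_pow : 2 ^ k * rho = 1 / 8.
Proof. unfold rho. field. apply pow_nonzero. lra. Qed.

Lemma rho_pos : 0 < rho.
Proof. apply Rinv_0_lt_compat. generalize (pow_lt 2 k ltac:(lra)). lra. Qed.

Lemma time_right j i r :
  IZR j + rho <= X i -> X (i + r)%nat <= IZR j + 1 / 8 -> (r <= k * P)%nat.
Proof.
  intros H1 H2. destruct (le_lt_dec r (k * P)) as [|Hr]; auto. exfalso.
  assert (Hrho := rho_pos).
  assert (Hin : forall s, (s <= r)%nat -> IZR j + rho <= X (i + s)%nat <= IZR j + 1 / 8).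
  { intros s Hs. generalize (minimizer_le i (i + s) ltac:(lia)) (minimizer_le (i + s) (i + r) ltac:(lia)). lra. }
  assert (G := convex_growth P (fun s => X (i + s)%nat - IZR j) r P_ge).
  cbv beta in G.
  assert (G' : 2 ^ k * (X (i + 0)%nat - IZR j) <= X (i + k * P)%nat - IZR j).
  { apply G; [| | |lia].
    - intros s Hs. generalize (Hin s Hs). lra.
    - intros s Hs. rewrite Nat.add_succ_r. generalize (minimizer_increasing (i + s)). lra.
    - intros s Hs. rewrite !Nat.add_succ_r. generalize (X_eq (i + s)%nat).
      assert (Hu := Hin (S s) ltac:(lia)). rewrite Nat.add_succ_r in Hu.
      destruct (cp_right P V V1 HV j (X (S (i + s)) - IZR j) ltac:(lra)) as [C1 _].
      replace (IZR j + (X (S (i + s)) - IZR j)) with (X (S (i + s))) in C1 by ring. lra. }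
  rewrite Nat.add_0_r in G'.
  generalize (minimizer_lt (i + k * P) (i + r) ltac:(lia)) rho_pow (pow_lt 2 k ltac:(lra)). nra.
Qed.

Lemma time_left j i r :
  IZR j - 1 / 8 <= X i -> X (i + r)%nat <= IZR j - rho -> (r <= k * P)%nat.
Proof.
  intros H1 H2. destruct (le_lt_dec r (k * P)) as [|Hr]; auto. exfalso.
  assert (Hrho := rho_pos).
  assert (Hin : forall s, (s <= r)%nat -> IZR j - 1 / 8 <= X (i + s)%nat <= IZR j - rho).
  { intros s Hs. generalize (minimizer_le i (i + s) ltac:(lia)) (minimizer_le (i + s) (i + r) ltac:(lia)). lra. }
  (* Approaching the integer is growth of the distance in reversed time. *)
  assert (G := convex_growth P (fun s => IZR j - X (i + (r - s))%nat) r P_ge).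
  cbv beta in G.
  assert (G' : 2 ^ k * (IZR j - X (i + (r - 0))%nat) <= IZR j - X (i + (r - k * P))%nat).
  { apply G; [| | |lia].
    - intros s Hs. generalize (Hin (r - s)%nat ltac:(lia)). lra.
    - intros s Hs. replace (i + (r - s))%nat with (S (i + (r - S s))) by lia.
      generalize (minimizer_increasing (i + (r - S s))). lra.
    - intros s Hs. replace (i + (r - s))%nat with (S (S (i + (r - S (S s))))) by lia.
      replace (i + (r - S s))%nat with (S (i + (r - S (S s)))) by lia.
      assert (Hu := Hin (S (r - S (S s))) ltac:(lia)). rewrite Nat.add_succ_r in Hu.
      generalize (X_eq (i + (r - S (S s)))%nat).
      set (t := (i + (r - S (S s)))%nat) in *.
      destruct (cp_left P V V1 HV j (IZR j - X (S t)) ltac:(lra)) as [_ C1].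
      replace (IZR j - (IZR j - X (S t))) with (X (S t)) in C1 by ring. lra. }
  rewrite Nat.sub_0_r in G'.
  generalize (minimizer_lt i (i + (r - k * P)) ltac:(lia)) rho_pow (pow_lt 2 k ltac:(lra)). nra.
Qed.

Definition slow_range (j : Z) (c K : nat) : Prop :=
  forall s, (s <= K)%nat -> Rabs (X (c + s)%nat - IZR j) <= rho.

(** On each side of the integer at most [28 P] steps are spent between the distances 1/2 and 1/8 and
    at most [k P] between 1/8 and [rho]; each count is exceeded by one, which gives
    [(28 + k) * P + 2]. *)
Lemma slow_range_of_passage j i K :
  IZR j - 1 / 2 <= X i -> X (i + (2 * ((28 + k) * P + 2) + K))%nat <= IZR j + 1 / 2 ->
  slow_range j (i + ((28 + k) * P + 2)) K.
Proof.
  intros H1 H2. assert (Hrho := rho_pos).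
  set (d := (28 * P + 1)%nat).
  assert (A1 : IZR j - 1 / 8 < X (i + d)%nat).
  { apply Rnot_le_lt. intros Hle.
    (* To the left of [j], the distances between 1/8 and 1/2 belong to the middle range of the cell
       of [j - 1]. *)
    generalize (time_middle (j - 1) i d). rewrite minus_IZR. intros Ht.
    specialize (Ht ltac:(lra) ltac:(lra)). unfold d in Ht. lia. }
  assert (A2 : IZR j - rho < X (i + ((28 + k) * P + 2))%nat).
  { apply Rnot_le_lt. intros Hle.
    generalize (time_left j (i + d) (k * P + 1) ltac:(lra)).
    replace (i + d + (k * P + 1))%nat with (i + ((28 + k) * P + 2))%nat by (unfold d; lia).
    intros Ht. specialize (Ht ltac:(lra)). lia. }
  set (e := (i + (2 * ((28 + k) * P + 2) + K))%nat) in *.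
  assert (A3 : X (e - d)%nat < IZR j + 1 / 8).
  { apply Rnot_le_lt. intros Hle.
    generalize (time_middle j (e - d) d Hle).
    replace (e - d + d)%nat with e by (unfold e, d; lia).
    intros Ht. specialize (Ht ltac:(lra)). unfold d in Ht. lia. }
  assert (A4 : X (e - ((28 + k) * P + 2))%nat < IZR j + rho).
  { apply Rnot_le_lt. intros Hle.
    generalize (time_right j (e - ((28 + k) * P + 2)) (k * P + 1) Hle).
    replace (e - ((28 + k) * P + 2) + (k * P + 1))%nat with (e - d)%nat by (unfold e, d; lia).
    intros Ht. specialize (Ht ltac:(lra)). lia. }
  intros s Hs. apply Rabs_le.
  generalize (minimizer_le (i + ((28 + k) * P + 2)) (i + ((28 + k) * P + 2) + s) ltac:(lia))
    (minimizer_le (i + ((28 + k) * P + 2) + s) (e - ((28 + k) * P + 2)) ltac:(unfold e; lia)). lra.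
Qed.

(* Extra steps are paid for by skipping as many steps of a later slow range. *)
Lemma segment_le_longer_path j c K a n n' A :
  slow_range j c K -> (a + n <= c)%nat -> (n <= n')%nat -> (n' < n + K)%nat ->
  path V n' (X a) (X (a + n)%nat) A -> Sg a n - 2 * rho ^ 2 <= A.
Proof.
  intros Hs Hc Hn HK Hp.
  set (e := (n' - n)%nat). set (d := (c - (a + n))%nat).
  (* One step replaces [S e] steps inside the slow range, whose points are within [2 rho] of each
     other; the value of [V] at its end is no extra cost, since the last replaced step pays it
     too. *)
  assert (Hjump : path V 1 (X c) (X (c + S e)%nat) (2 * rho ^ 2 + V (X (c + S e)%nat))).
  { destruct (path_step V (X c) (X (c + S e)%nat)) as [z [E1 [E2 E3]]].
    exists z. repeat split; auto. eapply Rle_trans; [exact E3|].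
    assert (B1 := proj1 (Rabs_le_between _ _) (Hs O ltac:(lia))).
    assert (B2 := proj1 (Rabs_le_between _ _) (Hs (S e) ltac:(unfold e; lia))).
    rewrite Nat.add_0_r in B1. assert (Hrho := rho_pos). nra. }
  assert (Hm := segment_path (a + n) d).
  replace (a + n + d)%nat with c in Hm by (unfold d; lia).
  assert (Hq := path_cat V _ _ _ _ _ _ _ (path_cat V _ _ _ _ _ _ _ Hp Hm) Hjump).
  replace (c + S e)%nat with (a + (n + d + S e))%nat in Hq by (unfold d; lia).
  replace (n' + d + 1)%nat with (n + d + S e)%nat in Hq by (unfold e; lia).
  apply segment_le in Hq. rewrite segment_split, segment_split in Hq.
  assert (Hlast := action_ge_step V V_nonneg (fun i => X (a + (n + d) + i)%nat) (S e) e ltac:(lia)).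
  cbv beta in Hlast.
  replace (a + (n + d) + S e)%nat with (a + (n + d + S e))%nat in Hlast by lia.
  unfold Sg, segment_action in *.
  generalize (pow2_ge_0 (X (a + (n + d + S e))%nat - X (a + (n + d) + e)%nat)). lra.
Qed.

(** Insert the midpoint of a step of length y: the kinetic term drops by y^2 / 4, the potential at
    the midpoint, within y / 2 of the integer, is at most y^2 / 32, and the additional step costs
    [2 * rho ^ 2]. So y^2 is at most 64 rho^2 / 7. *)
Lemma crossing_step_small j c K j0 i :
  slow_range j c K -> (2 <= K)%nat -> (S i <= c)%nat->
  X i <= IZR j0 < X (S i) -> X (S i) - X i <= 4 * rho.
Proof.
  intros Hs HK Hi Hx.
  set (y := X (S i) - X i) in *.
  assert (Hp := path_cat V _ _ _ _ _ _ _ (path_step V (X i) (X i + y / 2))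
     (path_step V (X i + y / 2) (X (S i)))).
  replace (S i) with (i + 1)%nat in Hp by lia.
  apply (segment_le_longer_path j c K i 1 2) in Hp; [|auto|lia|lia|lia].
  unfold Sg, segment_action in Hp. cbn [action] in Hp. rewrite Nat.add_0_r in Hp.
  replace (i + 1)%nat with (S i) in Hp by lia. fold y in Hp.
  generalize (cp_small P V V1 HV j0 (X i + y / 2 - IZR j0)).
  replace (IZR j0 + (X i + y / 2 - IZR j0)) with (X i + y / 2) by ring.
  intros Hv.
  assert (Hb : (X i + y / 2 - IZR j0) ^ 2 <= (y / 2) ^ 2) by (unfold y in *; nra).
  replace (X (S i) - (X i + y / 2)) with (y / 2) in Hp by (unfold y; field).
  assert (Hrho := rho_pos). apply Rnot_lt_le. intros Hlt.
  assert (16 * rho ^ 2 < y ^ 2) by nra. nra.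
Qed.

Let theta := / 2 ^ k.

Lemma theta_rho : theta = 8 * rho.
Proof. unfold theta, rho. field. apply pow_nonzero. lra. Qed.

(* The minimizer through [xi] is spliced into a path [0 -> 1] through [xi], and the cheap path
   into a competitor for the minimizer; all end point corrections are of order [theta]. *)
Lemma no_minimizer_through (xi E b : R) (i0 : nat) :
  let L := ((2 * k + 28) * P + 4)%nat in
  theta <= 1 / 32 -> 6 * theta < b -> E + b / 2 <= 1 / 2 ->
  1 / 4 <= xi <= 3 / 4 -> X i0 = xi -> X O <= 0 ->
  (forall n z, (n <= L)%nat -> z O = 0 -> z n = 1 ->
     (exists i, (i <= n)%nat /\ z i = xi) -> E + b <= action V z n) ->
  path V L 0 1 (E + b / 2) ->
  (forall N, exists j i, (N <= i)%nat /\ IZR j - 1 / 2 <= X i /\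
     X (i + (2 * ((28 + k) * P + 2) + (L + 2)))%nat <= IZR j + 1 / 2) ->
  False.
Proof.
  intros L Hth Hb HE Hxi Hi0 HX0 Hlow [z [Hz0 [HzL HzA]]] Hpass.
  assert (Hrho := rho_pos). assert (Htr := theta_rho).
  assert (V_int0 : V 0 = 0) by exact (cp_int P V V1 HV 0).
  assert (V_int1 : V 1 = 0) by exact (cp_int P V V1 HV 1).
  destruct (X_unbounded 1 i0) as [i1 [Hi1 Hi1']].
  destruct (crossing 0 O i0 ltac:(lia) ltac:(lra)) as [a0 [Ha0 Ha0']].
  destruct (crossing 1 i0 i1 ltac:(lia) ltac:(lra)) as [b0 [Hb0 Hb0']].
  destruct (Hpass (b0 + 2)%nat) as [j [i [Hi [Hj1 Hj2]]]].
  assert (Hslow := slow_range_of_passage j i (L + 2) Hj1 Hj2).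
  set (c := (i + ((28 + k) * P + 2))%nat) in *.
  assert (Hs0 := crossing_step_small j c (L + 2) 0 a0 Hslow ltac:(lia) ltac:(lia) Ha0').
  assert (Hs1 := crossing_step_small j c (L + 2) 1 b0 Hslow ltac:(lia) ltac:(lia) Hb0').
  (* [X a1] is the last point not beyond [theta] and [X (S b1)] the first beyond [1 - theta]: the
     ends of the piece compared with paths from 0 to 1. *)
  destruct (crossing theta (S a0) i0) as [a1 [Ha1 Ha1']]; [| lra |].
  { apply minimizer_lt_inv. lra. }
  destruct (crossing (1 - theta) i0 b0) as [b1 [Hb1 Hb1']]; [lia | lra |].
  assert (Ha1p : 0 < X a1) by (generalize (minimizer_le (S a0) a1 ltac:(lia)); lra).
  (* By the equation, [X (S a1) = 2 X a1 - X (a1 - 1) + V1 (X a1)], at most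
     [2 theta + 4 rho + theta]. *)
  assert (Hxa : X (S a1) <= 4 * theta).
  { assert (Hprev : - (4 * rho) <= X (pred a1)) by (generalize (minimizer_le a0 (pred a1) ltac:(lia)); lra).
    generalize (X_eq (pred a1)). replace (S (pred a1)) with a1 by lia.
    destruct (cp_right P V V1 HV 0 (X a1) ltac:(lra)) as [_ C]. rewrite Rplus_0_l in C. lra. }
  assert (Hxb1 : X (S b1) <= 1) by (generalize (minimizer_le (S b1) b0 ltac:(lia)); lra).
  assert (Hxb : 1 - 4 * theta <= X b1).
  { assert (Hnext : X (S (S b1)) <= 1 + 4 * rho) by (generalize (minimizer_le (S (S b1)) (S b0) ltac:(lia)); lra).
    generalize (X_eq b1).
    destruct (cp_left P V V1 HV 1 (1 - X (S b1)) ltac:(lra)) as [C _].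
    replace (1 - (1 - X (S b1))) with (X (S b1)) in C by ring. lra. }
  assert (Hab : (S a1 <= i0 <= b1)%nat) by lia.
  set (m := (b1 - S a1)%nat).
  set (n := S (S m)).
  assert (Hn : (a1 + n)%nat = S b1) by (unfold n, m; lia).
  (* Transit time: [k P] steps up to 1/8, [28 P] up to 7/8 and [k P] up to [1 - rho], which
     [X b1 <= 1 - theta] has not reached. *)
  assert (HnL : (n <= L)%nat).
  { apply Nat.nlt_ge. intros Hlt.
    assert (T1 : 1 / 8 < X (S a1 + (k * P + 1))%nat).
    { apply Rnot_le_lt. intros Hle.
      generalize (time_right 0 (S a1) (k * P + 1) ltac:(lra) ltac:(lra)). lia. }
    assert (T2 : 7 / 8 < X (S a1 + (k * P + 1) + (28 * P + 1))%nat).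
    { apply Rnot_le_lt. intros Hle.
      generalize (time_middle 0 (S a1 + (k * P + 1)) (28 * P + 1) ltac:(lra) ltac:(lra)). lia. }
    assert (T3 : 1 - rho < X (S a1 + (k * P + 1) + (28 * P + 1) + (k * P + 1))%nat).
    { apply Rnot_le_lt. intros Hle.
      generalize (time_left 1 (S a1 + (k * P + 1) + (28 * P + 1)) (k * P + 1) ltac:(lra) ltac:(lra)). lia. }
    assert (T4 := minimizer_le (S a1 + (k * P + 1) + (28 * P + 1) + (k * P + 1)) b1
      ltac:(unfold n, m, L in *; lia)). lra. }
  (* The end points of the minimizer are moved to 0 and 1. Only the two end steps change, and their
     new lengths are at most [4 theta]. *)
  assert (Hlower : E + b - 16 * theta ^ 2 <= segment_action a1 n).
  { set (o := fun s => match s with O => 0 | _ => if Nat.eqb s n then 1 else X (a1 + s)%nat end).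
    assert (Ho : forall s, (0 < s <= S m)%nat -> o s = X (a1 + s)%nat).
    { intros [|s] Hs; [lia|]. unfold o. rewrite (proj2 (Nat.eqb_neq _ _)) by (unfold n; lia). reflexivity. }
    assert (Hon : o n = 1) by (unfold o, n; rewrite Nat.eqb_refl; reflexivity).
    assert (Hxio : E + b <= action V o n).
    { apply Hlow; auto. exists (i0 - a1)%nat. split; [unfold n, m; lia|].
      rewrite Ho by (unfold m; lia). replace (a1 + (i0 - a1))%nat with i0 by lia. exact Hi0. }
    assert (Hdiff := action_same_interior V o (fun s => X (a1 + s)%nat) m Ho).
    fold n in Hdiff. rewrite Hon in Hdiff. rewrite (Ho 1%nat), (Ho (S m)) in Hdiff by lia.
    replace (a1 + n)%nat with (S b1) in Hdiff by lia.
    replace (a1 + S m)%nat with b1 in Hdiff by (unfold m; lia).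
    replace (a1 + 1)%nat with (S a1) in Hdiff by lia.
    rewrite Nat.add_0_r, V_int1 in Hdiff. simpl (o O) in Hdiff.
    unfold segment_action. generalize (V_nonneg (X (S b1))).
    assert (Q1 : X (S a1) ^ 2 <= 16 * theta ^ 2) by nra.
    assert (Q2 : (1 - X b1) ^ 2 <= 16 * theta ^ 2) by nra.
    assert (Q3 := pow2_ge_0 (X (S a1) - X a1)). assert (Q4 := pow2_ge_0 (X (S b1) - X b1)).
    rewrite Rminus_0_r in Hdiff. lra. }
  assert (Hupper : path V L (X a1) (X (a1 + n)%nat) (E + b / 2 + 2 * theta + 2 * theta ^ 2)).
  { destruct L as [|[|l]] eqn:EL; [unfold L in EL; lia | unfold L in EL; lia |].
    set (o := fun s => match s with O => X a1 | _ => if Nat.eqb s (S (S l)) then X (S b1) else z s end).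
    assert (Ho : forall s, (0 < s <= S l)%nat -> o s = z s).
    { intros [|s] Hs; [lia|]. unfold o. rewrite (proj2 (Nat.eqb_neq _ _)) by lia. reflexivity. }
    assert (Hon : o (S (S l)) = X (S b1)) by (unfold o; rewrite Nat.eqb_refl; reflexivity).
    exists o. split; [reflexivity|]. split; [rewrite Hn; exact Hon|].
    assert (Hdiff := action_same_interior V o z l Ho).
    rewrite Hon, HzL, Hz0, V_int1, !Rminus_0_r in Hdiff. rewrite (Ho 1%nat), (Ho (S l)) in Hdiff by lia.
    simpl (o O) in Hdiff.
    assert (S1 := action_ge_step V V_nonneg z (S (S l)) O ltac:(lia)).
    assert (S2 := action_ge_step V V_nonneg z (S (S l)) (S l) ltac:(lia)).
    rewrite Hz0, Rminus_0_r in S1. rewrite HzL in S2.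
    assert (N1 := V_nonneg (z 1%nat)). rewrite V_int1 in S2.
    (* A total action of at most 1/2 keeps the end steps of [z] within length 1, as [square_shift]
       requires. *)
    assert (R1 : -1 <= z 1%nat <= 1) by nra.
    assert (R2 : -1 <= 1 - z (S l) <= 1) by nra.
    assert (R3 := cp_small P V V1 HV 1 (X (S b1) - 1)).
    replace (1 + (X (S b1) - 1)) with (X (S b1)) in R3 by ring.
    assert (R4 : (X (S b1) - 1) ^ 2 <= theta ^ 2) by nra.
    assert (R5 := square_shift (z 1%nat) (X a1) theta R1 ltac:(lra)).
    assert (R6 := square_shift (1 - z (S l)) (1 - X (S b1)) theta R2 ltac:(lra)).
    replace (1 - z (S l) - (1 - X (S b1))) with (X (S b1) - z (S l)) in R6 by ring.
    generalize (pow2_ge_0 theta). lra. }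
  (* The [L - n] surplus steps are recovered in the slow range. What remains is [b / 2 <= 2 theta +
     18 theta ^ 2 + 2 rho ^ 2 < 3 theta], against [6 theta < b]. *)
  apply (segment_le_longer_path j c (L + 2) a1 n L) in Hupper; auto; try (unfold c; lia).
  fold Sg in Hlower. assert (theta ^ 2 <= theta / 32) by nra.
  assert (rho ^ 2 <= theta ^ 2) by nra. lra.
Qed.

End Minimizer.

(** * Trigonometric polynomials *)

(* [(a, k, t)] stands for [a cos (2 pi k x + t)]. *)
Definition trig : Type := list (R * Z * R).

Fixpoint trig_eval (l : trig) (x : R) : R :=
  match l with
  | [] => 0
  | (a, k, t) :: l' => a * cos (2 * PI * IZR k * x + t) + trig_eval l' x
  end.

Fixpoint trig_norm (l : trig) : R :=
  match l with [] => 0 | (a, _, _) :: l' => Rabs a + trig_norm l' end.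

Definition trig_deg_le (N : nat) (l : trig) : Prop :=
  Forall (fun m => (Z.abs (snd (fst m)) <= Z.of_nat N)%Z) l.

Definition trig_derive (l : trig) : trig :=
  map (fun m => match m with (a, k, t) => (a * (2 * PI * IZR k), k, t + PI / 2) end) l.

Definition trig_scale (c : R) (q : Z) (l : trig) : trig :=
  map (fun m => match m with (a, k, t) => (c * a, (q * k)%Z, t) end) l.

Definition trig_mul (l1 l2 : trig) : trig :=
  flat_map (fun m1 => match m1 with (a, k, t) =>
    flat_map (fun m2 => match m2 with (b, j, s) =>
      [(a * b / 2, (k + j)%Z, t + s); (a * b / 2, (k - j)%Z, t - s)] end) l2 end) l1.

Lemma trig_eval_app l1 l2 x : trig_eval (l1 ++ l2) x = trig_eval l1 x + trig_eval l2 x.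
Proof.
  induction l1 as [|[[a k] t] l1 IH]; simpl; [ring|]. rewrite IH. ring.
Qed.

Lemma trig_norm_app l1 l2 : trig_norm (l1 ++ l2) = trig_norm l1 + trig_norm l2.
Proof.
  induction l1 as [|[[a k] t] l1 IH]; simpl; [ring|]. rewrite IH. ring.
Qed.

Lemma trig_norm_nonneg l : 0 <= trig_norm l.
Proof.
  induction l as [|[[a k] t] l IH]; simpl; [lra|]. generalize (Rabs_pos a). lra.
Qed.

Lemma trig_eval_scale c q l x : trig_eval (trig_scale c q l) x = c * trig_eval l (IZR q * x).
Proof.
  induction l as [|[[a k] t] l IH]; simpl; [ring|]. rewrite IH, mult_IZR.
  replace (2 * PI * IZR k * (IZR q * x)) with (2 * PI * (IZR q * IZR k) * x) by ring. ring.
Qed.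

Lemma trig_norm_scale c q l : trig_norm (trig_scale c q l) = Rabs c * trig_norm l.
Proof.
  induction l as [|[[a k] t] l IH]; simpl; [ring|]. rewrite IH, Rabs_mult. ring.
Qed.

Lemma trig_deg_scale c q N M l : (Z.abs q * Z.of_nat N <= Z.of_nat M)%Z ->
  trig_deg_le N l -> trig_deg_le M (trig_scale c q l).
Proof.
  intros HM H. induction H as [|[[a k] t] l Hk H IH]; constructor; auto.
  simpl in *. rewrite Z.abs_mul. nia.
Qed.

Lemma trig_eval_mul l1 l2 x :
  trig_eval (trig_mul l1 l2) x = trig_eval l1 x * trig_eval l2 x.
Proof.
  induction l1 as [|[[a k] t] l1 IH]; simpl; [ring|].
  rewrite trig_eval_app, IH, Rmult_plus_distr_r. f_equal. clear IH l1.
  induction l2 as [|[[b j] s] l2 IH]; simpl; [ring|]. rewrite IH.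
  rewrite plus_IZR, minus_IZR.
  replace (2 * PI * (IZR k + IZR j) * x + (t + s))
    with (2 * PI * IZR k * x + t + (2 * PI * IZR j * x + s)) by ring.
  replace (2 * PI * (IZR k - IZR j) * x + (t - s))
    with (2 * PI * IZR k * x + t - (2 * PI * IZR j * x + s)) by ring.
  rewrite cos_plus, cos_minus. field.
Qed.

Lemma trig_norm_mul l1 l2 : trig_norm (trig_mul l1 l2) = trig_norm l1 * trig_norm l2.
Proof.
  induction l1 as [|[[a k] t] l1 IH]; simpl; [ring|].
  rewrite trig_norm_app, IH, Rmult_plus_distr_r. f_equal. clear IH l1.
  induction l2 as [|[[b j] s] l2 IH]; simpl; [ring|]. rewrite IH.
  unfold Rdiv. rewrite !Rabs_mult, (Rabs_pos_eq (/ 2)) by lra. field.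
Qed.

Lemma trig_deg_app N l1 l2 : trig_deg_le N l1 -> trig_deg_le N l2 -> trig_deg_le N (l1 ++ l2).
Proof. intros H1 H2. apply Forall_app. split; assumption. Qed.

Lemma trig_deg_mul N1 N2 l1 l2 :
  trig_deg_le N1 l1 -> trig_deg_le N2 l2 -> trig_deg_le (N1 + N2) (trig_mul l1 l2).
Proof.
  intros H1 H2. induction H1 as [|[[a k] t] l1 Hk H1 IH]; [constructor|].
  apply trig_deg_app; [|exact IH]. clear IH H1 l1. simpl in Hk.
  induction H2 as [|[[b j] s] l2 Hj H2 IH]; [constructor|]. simpl in Hj.
  constructor; [simpl; lia|]. constructor; [simpl; lia|exact IH].
Qed.

Lemma trig_deg_derive N l : trig_deg_le N l -> trig_deg_le N (trig_derive l).
Proof.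
  intros H. induction H as [|[[a k] t] l Hk H IH]; constructor; auto.
Qed.

Lemma trig_norm_derive N l : trig_deg_le N l ->
  trig_norm (trig_derive l) <= 2 * PI * INR N * trig_norm l.
Proof.
  assert (HPI := PI_RGT_0).
  intros H. induction H as [|[[a k] t] l Hk H IH]; simpl; [lra|]. simpl in Hk.
  apply IZR_le in Hk. rewrite <- INR_IZR_INZ, abs_IZR in Hk.
  rewrite !Rabs_mult, (Rabs_pos_eq 2), (Rabs_pos_eq PI) by lra.
  assert (0 <= (2 * PI * Rabs a) * (INR N - Rabs (IZR k))).
  { apply Rmult_le_pos; [|lra]. generalize (Rabs_pos a). nra. }
  lra.
Qed.

Lemma trig_eval_derive l x : is_derive (trig_eval l) x (trig_eval (trig_derive l) x).
Proof.
  induction l as [|[[a k] t] l IH].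
  - apply (is_derive_const 0).
  - simpl. apply (is_derive_plus (fun x => a * cos (2 * PI * IZR k * x + t)) (trig_eval l)); auto.
    auto_derive; [exact I|].
    replace (2 * PI * IZR k * x + (t + PI / 2)) with (PI / 2 + (2 * PI * IZR k * x + t)) by ring.
    rewrite cos_plus, cos_PI2, sin_PI2. ring.
Qed.

Lemma trig_eval_bound l x : Rabs (trig_eval l x) <= trig_norm l.
Proof.
  induction l as [|[[a k] t] l IH]; simpl; [rewrite Rabs_R0; lra|].
  eapply Rle_trans; [apply Rabs_triang|]. rewrite Rabs_mult.
  assert (Rabs (cos (2 * PI * IZR k * x + t)) <= 1) by (apply Rabs_le, COS_bound).
  generalize (Rabs_pos a). nra.
Qed.

Lemma cos_shift_IZR (k : Z) x : cos (x + 2 * PI * IZR k) = cos x.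
Proof.
  destruct (Z.le_gt_cases 0 k) as [Hk|Hk].
  - rewrite <- (Z2Nat.id k Hk), <- INR_IZR_INZ.
    replace (2 * PI * INR (Z.to_nat k)) with (2 * INR (Z.to_nat k) * PI) by ring. apply cos_period.
  - rewrite <- (cos_period _ (Z.to_nat (- k))). rewrite INR_IZR_INZ, Z2Nat.id, opp_IZR by lia.
    f_equal. ring.
Qed.

Lemma trig_eval_shift l (j : Z) x : trig_eval l (x + IZR j) = trig_eval l x.
Proof.
  induction l as [|[[a k] t] l IH]; simpl; auto. rewrite IH. f_equal. f_equal.
  rewrite <- (cos_shift_IZR (k * j) (2 * PI * IZR k * x + t)), mult_IZR. f_equal. ring.
Qed.

Lemma sum_f_R0_single (u : nat -> R) k N : (k <= N)%nat ->
  sum_f_R0 (fun m => if Nat.eqb m k then u m else 0) N = u k.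
Proof.
  intros Hk. induction N as [|N IH].
  - assert (k = O) as -> by lia. reflexivity.
  - rewrite tech5. destruct (Nat.eq_dec k (S N)) as [->|Hne].
    + rewrite Nat.eqb_refl.
      rewrite (sum_eq _ (fun _ => 0)); [rewrite sum_cte; ring|].
      intros i Hi. rewrite (proj2 (Nat.eqb_neq _ _)) by lia. reflexivity.
    + rewrite IH by lia. rewrite (proj2 (Nat.eqb_neq _ _)) by lia. ring.
Qed.

(** Negative frequencies are folded onto their absolute values; only the sine coefficient changes
    sign. *)
Lemma trig_poly_of_trig N l : trig_deg_le N l -> trig_poly_deg_le N (trig_eval l).
Proof.
  intros H. induction H as [|[[a k] t] l Hk H [A [B IH]]].
  - exists (fun _ => 0), (fun _ => 0). intros x. simpl.
    rewrite (sum_eq _ (fun _ => 0)); [rewrite sum_cte; ring|]. intros i _. ring.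
  - simpl in Hk. set (n := Z.to_nat (Z.abs k)).
    exists (fun m => (if Nat.eqb m n then a * cos t else 0) + A m),
           (fun m => (if Nat.eqb m n then - a * sin t * IZR (Z.sgn k) else 0) + B m).
    intros x. simpl. rewrite IH.
    set (u := fun m => a * cos t * cos (2 * PI * INR m * x)
      + - a * sin t * IZR (Z.sgn k) * sin (2 * PI * INR m * x)).
    transitivity (u n + sum_f_R0 (fun m => A m * cos (2 * PI * INR m * x)
      + B m * sin (2 * PI * INR m * x)) N).
    2:{ rewrite <- (sum_f_R0_single u n N) by (unfold n; lia). rewrite <- sum_plus.
        apply sum_eq. intros m _. unfold u. destruct (Nat.eqb m n); ring. }
    unfold u.
    f_equal. unfold n. rewrite INR_IZR_INZ, Z2Nat.id by lia. rewrite cos_plus.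
    destruct (Z.lt_trichotomy k 0) as [Hk'|[->|Hk']].
    + rewrite Z.abs_neq, Z.sgn_neg, opp_IZR by lia.
      replace (2 * PI * - IZR k * x) with (- (2 * PI * IZR k * x)) by ring.
      rewrite cos_neg, sin_neg. ring.
    + simpl. replace (2 * PI * 0 * x) with 0 by ring. rewrite cos_0, sin_0. ring.
    + rewrite Z.abs_eq, Z.sgn_pos by lia. ring.
Qed.

Fixpoint trig_derive_n (l : trig) (j : nat) : trig :=
  match j with O => l | S i => trig_derive (trig_derive_n l i) end.

Lemma trig_eval_derive_n l j x : Derive_n (trig_eval l) j x = trig_eval (trig_derive_n l j) x.
Proof.
  revert x. induction j as [|j IH]; intros x; [reflexivity|].
  simpl. rewrite (Derive_ext _ _ x IH). apply is_derive_unique, trig_eval_derive.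
Qed.

(** * The Fejer kernel *)

Fixpoint rsum (u : nat -> R) (n : nat) : R :=
  match n with O => 0 | S m => rsum u m + u m end.

Lemma rsum_ext u v n : (forall i, (i < n)%nat -> u i = v i) -> rsum u n = rsum v n.
Proof.
  induction n as [|n IH]; intros H; simpl; auto.
  rewrite IH, (H n); auto.
Qed.

Lemma rsum_plus u v n : rsum (fun i => u i + v i) n = rsum u n + rsum v n.
Proof. induction n as [|n IH]; simpl; [ring|]. rewrite IH. ring. Qed.

Lemma rsum_mult c u n : rsum (fun i => c * u i) n = c * rsum u n.
Proof. induction n as [|n IH]; simpl; [ring|]. rewrite IH. ring. Qed.

Lemma rsum_const c n : rsum (fun _ => c) n = INR n * c.
Proof. induction n as [|n IH]; [simpl; ring|]. rewrite S_INR. simpl. rewrite IH. ring. Qed.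

Lemma rsum_exchange (u : nat -> nat -> R) n m :
  rsum (fun i => rsum (fun j => u i j) m) n = rsum (fun j => rsum (fun i => u i j) n) m.
Proof.
  induction n as [|n IH]; simpl.
  - rewrite rsum_const. ring.
  - rewrite IH. symmetry. apply rsum_plus.
Qed.

Lemma rsum_single (k n : nat) c : (k < n)%nat ->
  rsum (fun i => if Nat.eqb k i then c else 0) n = c.
Proof.
  induction n as [|n IH]; intros Hk; [lia|]. simpl.
  destruct (Nat.eq_dec k n) as [->|Hne].
  - rewrite Nat.eqb_refl, (rsum_ext _ (fun _ => 0)); [rewrite rsum_const; ring|].
    intros i Hi. rewrite (proj2 (Nat.eqb_neq _ _)) by lia. reflexivity.
  - rewrite IH by lia. rewrite (proj2 (Nat.eqb_neq _ _)) by lia. ring.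
Qed.

Lemma rsum_le u v n : (forall i, (i < n)%nat -> u i <= v i) -> rsum u n <= rsum v n.
Proof.
  induction n as [|n IH]; intros H; simpl; [lra|].
  generalize (IH (fun i Hi => H i (Nat.lt_lt_succ_r _ _ Hi))) (H n ltac:(lia)). lra.
Qed.

Lemma rsum_nonneg u n : (forall i, (i < n)%nat -> 0 <= u i) -> 0 <= rsum u n.
Proof.
  intros H. replace 0 with (rsum (fun _ => 0) n) by (rewrite rsum_const; ring).
  apply rsum_le, H.
Qed.

Lemma rsum_app u n m : rsum u (n + m) = rsum u n + rsum (fun i => u (n + i)%nat) m.
Proof.
  induction m as [|m IH]; [rewrite Nat.add_0_r; simpl; ring|].
  rewrite Nat.add_succ_r. simpl. rewrite IH. ring.
Qed.

(** The squared modulus of the sum of exp(i k y) over k < M, normalized by its value at 0. *)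
Definition fejer (M : nat) (y : R) : R :=
  / INR M ^ 2 * rsum (fun k => rsum (fun l => cos ((INR k - INR l) * y)) M) M.

Lemma fejer_square M y :
  fejer M y = / INR M ^ 2 *
    (rsum (fun k => cos (INR k * y)) M ^ 2 + rsum (fun k => sin (INR k * y)) M ^ 2).
Proof.
  unfold fejer. f_equal.
  set (c := rsum (fun k => cos (INR k * y)) M). set (s := rsum (fun k => sin (INR k * y)) M).
  rewrite (rsum_ext _ (fun k => c * cos (INR k * y) + s * sin (INR k * y))).
  - rewrite rsum_plus, !rsum_mult. fold c s. ring.
  - intros k _.
    rewrite (rsum_ext _ (fun l => cos (INR k * y) * cos (INR l * y) + sin (INR k * y) * sin (INR l * y))).
    + rewrite rsum_plus, !rsum_mult. fold c s. ring.
    + intros l _. rewrite Rmult_minus_distr_r. apply cos_minus.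
Qed.

Lemma fejer_nonneg M y : (0 < M)%nat -> 0 <= fejer M y.
Proof.
  intros HM. apply lt_0_INR in HM. rewrite fejer_square. apply Rmult_le_pos.
  - left. apply Rinv_0_lt_compat, pow_lt, HM.
  - apply Rplus_le_le_0_compat; apply pow2_ge_0.
Qed.

Lemma fejer_0 M : (0 < M)%nat -> fejer M 0 = 1.
Proof.
  intros HM. apply lt_0_INR in HM. unfold fejer.
  rewrite (rsum_ext _ (fun _ => INR M)).
  - rewrite rsum_const. field. lra.
  - intros k _. rewrite (rsum_ext _ (fun _ => 1)).
    + rewrite rsum_const. ring.
    + intros l _. rewrite Rmult_0_r. apply cos_0.
Qed.

Lemma rsum_cos_arith a h n :
  2 * sin h * rsum (fun j => cos (a - 2 * h * INR j)) n
  = sin (a + h) - sin (a + h - 2 * h * INR n).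
Proof.
  induction n as [|n IH].
  - simpl. replace (a + h - 2 * h * 0) with (a + h) by ring. ring.
  - rewrite S_INR. simpl. rewrite Rmult_plus_distr_l, IH.
    replace (a + h - 2 * h * (INR n + 1)) with (a - 2 * h * INR n - h) by ring.
    replace (a + h - 2 * h * INR n) with (a - 2 * h * INR n + h) by ring.
    rewrite (sin_plus (a - 2 * h * INR n) h), (sin_minus (a - 2 * h * INR n) h). ring.
Qed.

(** Discrete orthogonality: for [k <> l] the arithmetic cosine sum telescopes over full periods
    after multiplication by [2 sin h], and [sin h] is nonzero because [|k - l| < M]. *)
Lemma rsum_cos_roots (M k l : nat) y : (k < M)%nat -> (l < M)%nat ->
  rsum (fun j => cos ((INR k - INR l) * (y - 2 * PI * INR j / INR M))) M
  = if Nat.eqb k l then INR M else 0.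
Proof.
  intros Hk Hl. assert (HM : 0 < INR M) by (apply lt_0_INR; lia).
  destruct (Nat.eq_dec k l) as [->|Hne].
  - rewrite Nat.eqb_refl. rewrite (rsum_ext _ (fun _ => 1)).
    + rewrite rsum_const. ring.
    + intros j _. rewrite Rminus_diag, Rmult_0_l. apply cos_0.
  - rewrite (proj2 (Nat.eqb_neq _ _)) by exact Hne.
    set (D := INR k - INR l). set (h := PI * D / INR M).
    assert (HD : D <> 0).
    { unfold D. intros H. apply Hne, INR_eq. lra. }
    assert (HDM : - INR M < D < INR M).
    { unfold D. apply lt_INR in Hk. apply lt_INR in Hl. generalize (pos_INR k) (pos_INR l). lra. }
    assert (Hsin : sin h <> 0).
    { assert (HPI := PI_RGT_0).
      assert (Hh : forall d, 0 < d < INR M -> 0 < sin (PI * d / INR M)).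
      { intros d Hd. apply sin_gt_0.
        - apply Rdiv_lt_0_compat; [apply Rmult_lt_0_compat|]; lra.
        - apply (Rmult_lt_reg_r (INR M)); [exact HM|]. field_simplify; [|lra]. nra. }
      destruct (Rtotal_order D 0) as [Hlt|[Heq|Hgt]]; [|contradiction|].
      - generalize (Hh (- D) ltac:(lra)). replace (PI * - D / INR M) with (- h) by (unfold h; field; lra).
        rewrite sin_neg. lra.
      - generalize (Hh D ltac:(lra)). fold h. lra. }
    rewrite (rsum_ext _ (fun j => cos (D * y - 2 * h * INR j))).
    + assert (E := rsum_cos_arith (D * y) h M).
      replace (sin (D * y + h - 2 * h * INR M)) with (sin (D * y + h)) in E.
      * rewrite Rminus_diag in E. apply (Rmult_eq_reg_l (2 * sin h)); [rewrite E; ring | lra].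
      * rewrite <- (sin_period (D * y + h - 2 * h * INR M) k), <- (sin_period (D * y + h) l).
        f_equal. unfold h, D. field. lra.
    + intros j _. f_equal. unfold h. field. lra.
Qed.

(** Only the [M] diagonal pairs survive the summation over translates, each contributing
    [M / M^2]. *)
Lemma fejer_partition M y : (0 < M)%nat ->
  rsum (fun j => fejer M (y - 2 * PI * INR j / INR M)) M = 1.
Proof.
  intros HM. unfold fejer. rewrite rsum_mult.
  rewrite rsum_exchange.
  rewrite (rsum_ext _ (fun _ => INR M)).
  - rewrite rsum_const. field. apply lt_0_INR in HM. lra.
  - intros k Hk. rewrite rsum_exchange.
    rewrite (rsum_ext _ (fun l => if Nat.eqb k l then INR M else 0)).
    + apply rsum_single, Hk.
    + intros l Hl. apply rsum_cos_roots; assumption.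
Qed.

(** The [M^2] monomials are kept separate with equal positive coefficients, so that [trig_norm] is
    exactly 1. *)
Definition fejer_trig (M : nat) (xi : R) : trig :=
  flat_map (fun k => flat_map (fun l =>
    [(/ INR M ^ 2, (Z.of_nat k - Z.of_nat l)%Z, - (2 * PI * (INR k - INR l) * xi))])
    (seq 0 M)) (seq 0 M).

Lemma trig_eval_flat_map g n x :
  trig_eval (flat_map g (seq 0 n)) x = rsum (fun i => trig_eval (g i) x) n.
Proof.
  induction n as [|n IH]; [reflexivity|].
  rewrite seq_S, flat_map_app, trig_eval_app, IH. simpl. rewrite app_nil_r. reflexivity.
Qed.

Lemma trig_norm_flat_map g n :
  trig_norm (flat_map g (seq 0 n)) = rsum (fun i => trig_norm (g i)) n.
Proof.
  induction n as [|n IH]; [reflexivity|].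
  rewrite seq_S, flat_map_app, trig_norm_app, IH. simpl. rewrite app_nil_r. reflexivity.
Qed.

Lemma fejer_trig_eval M xi x : trig_eval (fejer_trig M xi) x = fejer M (2 * PI * (x - xi)).
Proof.
  unfold fejer_trig, fejer. rewrite trig_eval_flat_map, <- rsum_mult.
  apply rsum_ext. intros k _. rewrite trig_eval_flat_map, <- rsum_mult.
  apply rsum_ext. intros l _. simpl. rewrite minus_IZR, <- !INR_IZR_INZ, Rplus_0_r.
  f_equal. f_equal. ring.
Qed.

Lemma fejer_trig_norm M xi : (0 < M)%nat -> trig_norm (fejer_trig M xi) = 1.
Proof.
  intros HM. apply lt_0_INR in HM. unfold fejer_trig. rewrite trig_norm_flat_map.
  rewrite (rsum_ext _ (fun _ => / INR M)).
  - rewrite rsum_const. field. lra.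
  - intros k _. rewrite trig_norm_flat_map. rewrite (rsum_ext _ (fun _ => / INR M ^ 2)).
    + rewrite rsum_const. field. lra.
    + intros l _. simpl. rewrite Rabs_pos_eq; [simpl; ring|].
      left. apply Rinv_0_lt_compat. nra.
Qed.

Lemma fejer_trig_deg M xi : trig_deg_le (pred M) (fejer_trig M xi).
Proof.
  apply Forall_forall. intros m Hm. apply in_flat_map in Hm. destruct Hm as [k [Hk Hm]].
  apply in_flat_map in Hm. destruct Hm as [l [Hl [<-|[]]]].
  apply in_seq in Hk. apply in_seq in Hl. simpl. lia.
Qed.

(** * The resonant potential *)

Lemma action_plus V v z n :
  action (fun x => V x + v x) z n = action V z n + rsum (fun i => v (z (S i))) n.
Proof. induction n as [|n IH]; simpl; [ring|]. rewrite IH. ring. Qed.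

Lemma trig_mvt l a b : exists c, Rmin a b <= c <= Rmax a b /\
  trig_eval l b - trig_eval l a = trig_eval (trig_derive l) c * (b - a).
Proof.
  destruct (MVT_gen (trig_eval l) a b (trig_eval (trig_derive l))) as [c Hc].
  - intros x _. apply trig_eval_derive.
  - intros x _. apply continuity_pt_filterlim, (ex_derive_continuous (trig_eval l)).
    exists (trig_eval (trig_derive l) x). apply trig_eval_derive.
  - exists c. exact Hc.
Qed.

Lemma trig_derive_app l1 l2 : trig_derive (l1 ++ l2) = trig_derive l1 ++ trig_derive l2.
Proof. apply map_app. Qed.

Lemma cos_PI4_bounds : 7 / 10 <= cos (PI / 4) <= 3 / 4.
Proof.
  assert (H := sin2_cos2 (PI / 4)). unfold Rsqr in H.
  assert (E : sin (PI / 4) = cos (PI / 4)) by (rewrite sin_PI4, cos_PI4; reflexivity).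
  rewrite E in H. assert (HPI := PI_RGT_0).
  assert (0 < cos (PI / 4)) by (apply cos_gt_0; lra). nra.
Qed.

Lemma cos_small_angle u : Rabs u <= 1 / 8 -> 7 / 10 <= cos (2 * PI * u).
Proof.
  intros Hu. assert (HPI := PI_RGT_0).
  replace (cos (2 * PI * u)) with (cos (2 * PI * Rabs u)).
  - apply Rle_trans with (1 := proj1 cos_PI4_bounds).
    generalize (Rabs_pos u). intros. apply cos_decr_1; nra.
  - unfold Rabs. destruct (Rcase_abs u); auto.
    replace (2 * PI * - u) with (- (2 * PI * u)) by ring. apply cos_neg.
Qed.

Lemma cos_large_angle u : 1 / 8 <= u <= 7 / 8 -> cos (2 * PI * u) <= 3 / 4.
Proof.
  intros Hu. assert (HPI := PI_RGT_0).
  apply Rle_trans with (2 := proj2 cos_PI4_bounds).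
  destruct (Rle_lt_dec u (1 / 2)).
  - apply cos_decr_1; nra.
  - replace (cos (2 * PI * u)) with (cos (2 * PI * (1 - u))).
    + apply cos_decr_1; nra.
    + rewrite <- (cos_neg (2 * PI * u)), <- (cos_shift_IZR 1 (- (2 * PI * u))). f_equal. ring.
Qed.

Definition one_minus_cos : trig := [(1, 0%Z, 0); (-1, 1%Z, 0)].

Lemma one_minus_cos_eval x : trig_eval one_minus_cos x = 1 - cos (2 * PI * x).
Proof.
  simpl. replace (2 * PI * 0 * x + 0) with 0 by ring.
  replace (2 * PI * 1 * x + 0) with (2 * PI * x) by ring. rewrite cos_0. ring.
Qed.

Lemma one_minus_cos_norm : trig_norm one_minus_cos = 2.
Proof.
  simpl. rewrite (Rabs_pos_eq 1), (Rabs_left (-1)) by lra. ring.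
Qed.

Lemma one_minus_cos_deg : trig_deg_le 1 one_minus_cos.
Proof. repeat constructor; simpl; lia. Qed.

Section Potential.
Variable P : nat.
Hypothesis P_ge : (40 <= P)%nat.

Let P_ge' : 40 <= INR P.
Proof. apply le_INR in P_ge. simpl in P_ge. lra. Qed.

(** The order that curvature allows: [bump_norm_derive] needs [2 (192 P)^2 beta <= 1 / (10 P^2)],
    where [192 P] bounds the frequency factor [2 pi (24 P)] by means of [PI <= 4]. *)
Definition bump_height : R := / (10 ^ 6 * INR P ^ 4).
Let beta := bump_height.

Lemma bump_height_pos : 0 < beta.
Proof.
  unfold beta, bump_height. apply Rinv_0_lt_compat, Rmult_lt_0_compat; apply pow_lt; lra.
Qed.

Definition base_trig : trig := trig_scale (/ INR P ^ 2) 1 one_minus_cos.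
(** The factor [one_minus_cos] makes the bump vanish at the integers, so that these stay minima of
    value 0. *)
Definition bump_trig (xi : R) : trig :=
  trig_mul (trig_scale beta 1 (fejer_trig (24 * P) xi)) one_minus_cos.
Definition potential (xi : R) : trig := base_trig ++ bump_trig xi.

Lemma base_eval x : trig_eval base_trig x = / INR P ^ 2 * (1 - cos (2 * PI * x)).
Proof.
  unfold base_trig. rewrite trig_eval_scale, one_minus_cos_eval, Rmult_1_l. reflexivity.
Qed.

Lemma bump_eval xi x : trig_eval (bump_trig xi) x =
  beta * fejer (24 * P) (2 * PI * (x - xi)) * (1 - cos (2 * PI * x)).
Proof.
  unfold bump_trig. rewrite trig_eval_mul, trig_eval_scale, fejer_trig_eval, one_minus_cos_eval,
    Rmult_1_l. reflexivity.
Qed.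

Lemma base_deg : trig_deg_le 1 base_trig.
Proof. apply (trig_deg_scale _ _ 1); [reflexivity | apply one_minus_cos_deg]. Qed.

Lemma bump_deg xi : trig_deg_le (24 * P) (bump_trig xi).
Proof.
  replace (24 * P)%nat with (pred (24 * P) + 1)%nat at 1 by lia.
  apply trig_deg_mul; [|apply one_minus_cos_deg].
  apply (trig_deg_scale _ _ (pred (24 * P))); [lia | apply fejer_trig_deg].
Qed.

Lemma potential_deg xi : trig_deg_le (24 * P) (potential xi).
Proof.
  apply trig_deg_app; [|apply bump_deg].
  apply Forall_impl with (2 := base_deg). simpl. lia.
Qed.

Lemma base_norm : trig_norm base_trig = 2 / INR P ^ 2.
Proof.
  unfold base_trig. rewrite trig_norm_scale, one_minus_cos_norm, Rabs_pos_eq.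
  - field. lra.
  - left. apply Rinv_0_lt_compat, pow_lt. lra.
Qed.

Lemma bump_norm xi : trig_norm (bump_trig xi) = 2 * beta.
Proof.
  unfold bump_trig. rewrite trig_norm_mul, trig_norm_scale, one_minus_cos_norm, fejer_trig_norm by lia.
  rewrite Rabs_pos_eq by (left; apply bump_height_pos). ring.
Qed.

Lemma trig_norm_derive_n N l B j : trig_deg_le N l -> 2 * PI * INR N <= B ->
  trig_norm (trig_derive_n l j) <= B ^ j * trig_norm l.
Proof.
  intros Hl HB. assert (HPI := PI_RGT_0). assert (HN := pos_INR N).
  assert (Hd : forall j, trig_deg_le N (trig_derive_n l j)).
  { intros i. induction i; simpl; auto. apply trig_deg_derive; auto. }
  induction j as [|j IH]; simpl; [lra|].
  apply Rle_trans with (1 := trig_norm_derive N _ (Hd j)).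
  generalize (trig_norm_nonneg (trig_derive_n l j)). intros H0.
  apply Rle_trans with (B * trig_norm (trig_derive_n l j)).
  - apply Rmult_le_compat_r; auto.
  - rewrite Rmult_assoc. apply Rmult_le_compat_l; auto. nra.
Qed.

Lemma trig_derive_n_app l1 l2 j :
  trig_derive_n (l1 ++ l2) j = trig_derive_n l1 j ++ trig_derive_n l2 j.
Proof. induction j as [|j IH]; simpl; auto. rewrite IH. apply trig_derive_app. Qed.

Lemma bump_norm_derive xi j : (j <= 2)%nat ->
  trig_norm (trig_derive_n (bump_trig xi) j) <= 1 / 10 / INR P ^ 2.
Proof.
  intros Hj. assert (HPI := PI_4). assert (HPI0 := PI_RGT_0).
  assert (HB : 2 * PI * INR (24 * P) <= 192 * INR P).
  { rewrite mult_INR. replace (INR 24) with 24 by (simpl; ring). nra. }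
  apply Rle_trans with (1 := trig_norm_derive_n _ _ _ j (bump_deg xi) HB).
  rewrite bump_norm.
  apply Rle_trans with ((192 * INR P) ^ 2 * (2 * beta)).
  - apply Rmult_le_compat_r; [generalize bump_height_pos; lra|]. apply Rle_pow; [lra|exact Hj].
  - replace ((192 * INR P) ^ 2 * (2 * beta)) with (73728 / 10 ^ 6 * / INR P ^ 2)
      by (unfold beta, bump_height; field; lra).
    apply Rmult_le_compat_r; [left; apply Rinv_0_lt_compat, pow_lt; lra | lra].
Qed.

Lemma potential_norm_derive xi j : (j <= 2)%nat ->
  trig_norm (trig_derive_n (potential xi) j) <= 129 / INR P ^ 2.
Proof.
  intros Hj. assert (HPI := PI_4).
  unfold potential. rewrite trig_derive_n_app, trig_norm_app.
  assert (H1 := bump_norm_derive xi j Hj).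
  assert (H2 := trig_norm_derive_n 1 base_trig 8 j base_deg ltac:(simpl; lra)).
  rewrite base_norm in H2.
  assert (H3 : 8 ^ j <= 64) by (replace 64 with (8 ^ 2) by ring; apply Rle_pow; [lra|exact Hj]).
  assert (H4 : 0 < / INR P ^ 2) by (apply Rinv_0_lt_compat, pow_lt; lra).
  unfold Rdiv in *. nra.
Qed.

Lemma inv_P_sq : 0 < / INR P ^ 2 <= 1 / 1600.
Proof.
  split; [apply Rinv_0_lt_compat, pow_lt; lra|].
  replace (1 / 1600) with (/ 40 ^ 2) by field.
  apply Rinv_le_contravar; [lra|]. apply pow_incr. lra.
Qed.

Lemma one_minus_cos_nonneg x : 0 <= 1 - cos (2 * PI * x).
Proof. generalize (COS_bound (2 * PI * x)). lra. Qed.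

Lemma base_nonneg x : 0 <= trig_eval base_trig x.
Proof.
  rewrite base_eval. apply Rmult_le_pos; [left; apply inv_P_sq | apply one_minus_cos_nonneg].
Qed.

Lemma bump_nonneg xi x : 0 <= trig_eval (bump_trig xi) x.
Proof.
  rewrite bump_eval. apply Rmult_le_pos; [|apply one_minus_cos_nonneg].
  apply Rmult_le_pos; [left; apply bump_height_pos | apply fejer_nonneg; lia].
Qed.

Lemma potential_eval xi x :
  trig_eval (potential xi) x = trig_eval base_trig x + trig_eval (bump_trig xi) x.
Proof. apply trig_eval_app. Qed.

Lemma one_minus_cos_int j : 1 - cos (2 * PI * IZR j) = 0.
Proof.
  rewrite <- (Rplus_0_l (2 * PI * IZR j)), cos_shift_IZR, cos_0. ring.
Qed.

Lemma base_int j : trig_eval base_trig (IZR j) = 0.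
Proof. rewrite base_eval, one_minus_cos_int. ring. Qed.

Lemma potential_int xi j : trig_eval (potential xi) (IZR j) = 0.
Proof. rewrite potential_eval, base_int, bump_eval, one_minus_cos_int. ring. Qed.

Lemma potential_nonneg xi x : 0 <= trig_eval (potential xi) x.
Proof.
  rewrite potential_eval. generalize (base_nonneg x) (bump_nonneg xi x). lra.
Qed.

Lemma potential_critical xi j : trig_eval (trig_derive (potential xi)) (IZR j) = 0.
Proof.
  assert (Hd : derivable_pt_lim (trig_eval (potential xi)) (IZR j)
    (trig_eval (trig_derive (potential xi)) (IZR j))) by apply is_derive_Reals, trig_eval_derive.
  assert (pr : derivable_pt (trig_eval (potential xi)) (IZR j)) by (eexists; exact Hd).
  rewrite <- (derive_pt_eq_0 _ _ _ pr Hd).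
  apply (deriv_minimum _ (IZR j - 1) (IZR j + 1)); try lra.
  intros x _ _. rewrite potential_int. apply potential_nonneg.
Qed.

Lemma base_second_derivative x :
  trig_eval (trig_derive_n base_trig 2) x = / INR P ^ 2 * (2 * PI) ^ 2 * cos (2 * PI * x).
Proof.
  cbn [trig_derive_n trig_derive base_trig trig_scale one_minus_cos map trig_eval].
  replace (2 * PI * IZR (1 * 1) * x + (0 + PI / 2 + PI / 2)) with (2 * PI * x + PI)
    by (simpl; field).
  rewrite neg_cos. simpl (IZR _). ring.
Qed.

(** In units of [1 / P^2] the base contributes at least [36 * 7 / 10], and the bump disturbs this by
    at most [1 / 10]. *)
Lemma potential_second_derivative xi j x : Rabs (x - IZR j) <= 1 / 8 ->
  4 / INR P ^ 2 <= trig_eval (trig_derive_n (potential xi) 2) x.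
Proof.
  intros Hx. unfold potential. rewrite trig_derive_n_app, trig_eval_app, base_second_derivative.
  generalize (trig_eval_bound (trig_derive_n (bump_trig xi) 2) x) (bump_norm_derive xi 2 (le_n 2)).
  intros H1 H2. assert (H3 := proj1 (Rabs_le_between _ _) (Rle_trans _ _ _ H1 H2)).
  assert (H4 := cos_small_angle (x - IZR j) Hx).
  replace (cos (2 * PI * (x - IZR j))) with (cos (2 * PI * x)) in H4.
  2:{ rewrite <- (cos_shift_IZR (- j) (2 * PI * x)), opp_IZR. f_equal. ring. }
  assert (HPI : 3 <= PI) by (generalize PI2_3_2; lra).
  assert (H5 := inv_P_sq). set (v := / INR P ^ 2) in *. unfold Rdiv in *. fold v in H3. fold v.
  assert (36 <= (2 * PI) ^ 2) by nra.
  assert (36 * (7 / 10) <= (2 * PI) ^ 2 * cos (2 * PI * x)) by nra. nra.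
Qed.

Lemma potential_second_derivative_bound xi x :
  Rabs (trig_eval (trig_derive_n (potential xi) 2) x) <= 129 / 1600.
Proof.
  apply Rle_trans with (1 := trig_eval_bound _ _).
  apply Rle_trans with (1 := potential_norm_derive xi 2 (le_n 2)).
  generalize inv_P_sq. unfold Rdiv. lra.
Qed.

(** Near an integer the bounds on [V] and [V'] follow from those on [V''] by the mean value theorem,
    since both vanish there. The global bound [129 / 1600], which comes from [P >= 40], is below
    [1 / 8]. *)
Lemma potential_comb xi : comb_potential P (trig_eval (potential xi)) (trig_eval (trig_derive (potential xi))).
Proof.
  split.
  - apply potential_nonneg.
  - apply potential_int.
  - intros j u.
    destruct (trig_mvt (potential xi) (IZR j) (IZR j + u)) as [c [Hc E1]].
    destruct (trig_mvt (trig_derive (potential xi)) (IZR j) c) as [d [_ E2]].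
    rewrite potential_critical in E2. rewrite potential_int in E1.
    change (trig_derive (trig_derive (potential xi))) with (trig_derive_n (potential xi) 2) in E2.
    assert (H := proj1 (Rabs_le_between _ _) (potential_second_derivative_bound xi d)).
    set (s := trig_eval (trig_derive_n (potential xi) 2) d) in *.
    replace (trig_eval (potential xi) (IZR j + u))
      with (trig_eval (trig_derive (potential xi)) c * u) by lra.
    replace (trig_eval (trig_derive (potential xi)) c) with (s * (c - IZR j)) by lra.
    rewrite Rmult_assoc.
    assert (0 <= (c - IZR j) * u <= u ^ 2).
    { revert Hc. unfold Rmin, Rmax. destruct (Rle_dec (IZR j) (IZR j + u)); intros; nra. }
    nra.
  - intros x. apply Rle_trans with (1 := Rle_abs _). apply Rle_trans with (1 := trig_eval_bound _ _).
    unfold potential. rewrite trig_norm_app, base_norm.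
    generalize (bump_norm_derive xi 0 ltac:(lia)) inv_P_sq. simpl trig_derive_n. unfold Rdiv. lra.
  - intros j x Hx. rewrite potential_eval, base_eval.
    assert (H := cos_large_angle (x - IZR j) ltac:(lra)).
    replace (cos (2 * PI * (x - IZR j))) with (cos (2 * PI * x)) in H.
    2:{ rewrite <- (cos_shift_IZR (- j) (2 * PI * x)), opp_IZR. f_equal. ring. }
    generalize (bump_nonneg xi x) inv_P_sq. unfold Rdiv. nra.
  - intros j u Hu.
    destruct (trig_mvt (trig_derive (potential xi)) (IZR j) (IZR j + u)) as [c [Hc E]].
    rewrite Rmin_left, Rmax_right in Hc by lra. rewrite potential_critical in E.
    change (trig_derive (trig_derive (potential xi))) with (trig_derive_n (potential xi) 2) in E.
    assert (H1 := proj1 (Rabs_le_between _ _) (potential_second_derivative_bound xi c)).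
    assert (H2 := potential_second_derivative xi j c ltac:(apply Rabs_le; lra)).
    set (s := trig_eval (trig_derive_n (potential xi) 2) c) in *.
    replace (trig_eval (trig_derive (potential xi)) (IZR j + u)) with (s * u) by lra.
    split; [apply Rmult_le_compat_r; lra | nra].
  - intros j u Hu.
    destruct (trig_mvt (trig_derive (potential xi)) (IZR j) (IZR j - u)) as [c [Hc E]].
    rewrite Rmin_right, Rmax_left in Hc by lra. rewrite potential_critical in E.
    change (trig_derive (trig_derive (potential xi))) with (trig_derive_n (potential xi) 2) in E.
    assert (H1 := proj1 (Rabs_le_between _ _) (potential_second_derivative_bound xi c)).
    assert (H2 := potential_second_derivative xi j c ltac:(apply Rabs_le; lra)).
    set (s := trig_eval (trig_derive_n (potential xi) 2) c) in *.
    replace (trig_eval (trig_derive (potential xi)) (IZR j - u)) with (- (s * u)) by lra.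
    split; [nra | apply Ropp_le_contravar, Rmult_le_compat_r; lra].
Qed.

(* Averaging over the [12 P] translates with centre in [[1/4, 3/4]]: the full family sums to 1. *)
Lemma bump_position (z : nat -> R) (n : nat) :
  rsum (fun i => 1 - cos (2 * PI * z (S i))) n <= 3 * INR P ->
  exists xi, 1 / 4 <= xi <= 3 / 4 /\
    rsum (fun i => trig_eval (bump_trig xi) (z (S i))) n <= beta / 4.
Proof.
  intros Hw. apply NNPP. intros Hn.
  set (M := (24 * P)%nat).
  assert (HM : INR M = 24 * INR P) by (unfold M; rewrite mult_INR; simpl; ring).
  set (S_ := fun j : nat => rsum (fun i => fejer M (2 * PI * (z (S i) - INR j / INR M))
     * (1 - cos (2 * PI * z (S i)))) n).
  assert (HS : forall j, 0 <= S_ j).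
  { intros j. apply rsum_nonneg. intros i _. apply Rmult_le_pos; [|apply one_minus_cos_nonneg].
    apply fejer_nonneg. unfold M. lia. }
  assert (Htotal : rsum S_ M = rsum (fun i => 1 - cos (2 * PI * z (S i))) n).
  { unfold S_. rewrite rsum_exchange. apply rsum_ext. intros i _.
    rewrite (rsum_ext _ (fun j => (1 - cos (2 * PI * z (S i))) *
      fejer M (2 * PI * z (S i) - 2 * PI * INR j / INR M))).
    - rewrite rsum_mult, fejer_partition by (unfold M; lia). ring.
    - intros j _. rewrite Rmult_comm. f_equal. f_equal. field. lra. }
  (* The centres [(6 P + j) / (24 P)] lie in [1/4, 3/4], so by assumption each of these translates
     weighs more than 1/4. *)
  assert (Hbig : forall j, (j < 12 * P)%nat -> 1 / 4 < S_ (6 * P + j)%nat).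
  { intros j Hj. apply Rnot_le_lt. intros Hle. apply Hn.
    exists (INR (6 * P + j) / INR M).
    assert (Hj' : 0 <= INR j <= 12 * INR P).
    { split; [apply pos_INR|]. apply Nat.lt_le_incl, le_INR in Hj. rewrite mult_INR in Hj.
      simpl (INR 12) in Hj. lra. }
    assert (E6 : INR (6 * P + j) = 6 * INR P + INR j).
    { rewrite plus_INR, mult_INR. simpl (INR 6). ring. }
    split.
    - rewrite E6, HM. split; apply (Rmult_le_reg_r (24 * INR P)); try lra; field_simplify; lra.
    - rewrite (rsum_ext _ (fun i => beta * (fejer M (2 * PI * (z (S i) - INR (6 * P + j) / INR M))
        * (1 - cos (2 * PI * z (S i)))))).
      + rewrite rsum_mult. fold (S_ (6 * P + j)%nat). generalize bump_height_pos. nra.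
      + intros i _. rewrite bump_eval. fold M. ring. }
  assert (HM' : M = (6 * P + (12 * P + 6 * P))%nat) by (unfold M; lia).
  rewrite HM' in Htotal. rewrite rsum_app, rsum_app in Htotal.
  assert (N1 := rsum_nonneg S_ (6 * P) (fun i _ => HS i)).
  assert (N2 := rsum_nonneg (fun i => S_ (6 * P + (12 * P + i))%nat) (6 * P) (fun i _ => HS _)).
  (* [12 P] translates of weight above 1/4 exceed the total, which is at most [3 P]. *)
  assert (N3 : rsum (fun i => S_ (6 * P + i)%nat) (12 * P) > rsum (fun _ => 1 / 4) (12 * P)).
  { assert (G : forall m, (0 < m <= 12 * P)%nat ->
      rsum (fun _ => 1 / 4) m < rsum (fun i => S_ (6 * P + i)%nat) m).
    { induction m as [|m IH]; intros Hm; [lia|]. cbn [rsum].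
      generalize (Hbig m ltac:(lia)).
      destruct m as [|m]; [cbn [rsum]; lra|]. generalize (IH ltac:(lia)). lra. }
    apply G. lia. }
  rewrite rsum_const, mult_INR in N3. simpl (INR 12) in N3. lra.
Qed.

Variable k : nat.
Let L := ((2 * k + 28) * P + 4)%nat.
Hypothesis k_large : 6 * / 2 ^ k < beta.

(** An infimum approximated to within [beta / 8] serves in place of a minimizer. Shorter paths are
    covered because waiting at 1 is free, and the last bound is the cost of a uniform ramp of [P]
    steps. *)
Lemma inf_base_action : exists E,
  (forall z n, (n <= L)%nat -> z O = 0 -> z n = 1 -> E <= action (trig_eval base_trig) z n) /\
  path (trig_eval base_trig) L 0 1 (E + beta / 8) /\ E <= 5 / 2 / INR P.
Proof.
  assert (Hramp : path (trig_eval base_trig) L 0 1 (5 / 2 / INR P)).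
  { assert (H1 := path_ramp (trig_eval base_trig) P 0 1 (2 / INR P ^ 2) ltac:(lia)).
    assert (H2 := path_wait (trig_eval base_trig) (L - P) 1 (base_int 1)).
    assert (Hb : forall u, trig_eval base_trig u <= 2 / INR P ^ 2).
    { intros u. rewrite <- base_norm. apply Rle_trans with (1 := Rle_abs _). apply trig_eval_bound. }
    assert (H3 := path_cat _ _ _ _ _ _ _ _ (H1 Hb) H2).
    replace (P + (L - P))%nat with L in H3 by (unfold L; lia).
    replace ((1 - 0) ^ 2 / (2 * INR P) + INR P * (2 / INR P ^ 2) + 0) with (5 / 2 / INR P) in H3
      by (field; lra).
    exact H3. }
  destruct (completeness (fun v => exists z, z O = 0 /\ z L = 1 /\ v = - action (trig_eval base_trig) z L))
    as [E [HE1 HE2]].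
  - exists 0. intros v [z [_ [_ ->]]]. generalize (action_nonneg _ base_nonneg z L). lra.
  - destruct Hramp as [z [H1 [H2 _]]]. eexists. exists z. split; [exact H1|]. split; [exact H2|reflexivity].
  - assert (Hlow : forall z, z O = 0 -> z L = 1 -> - E <= action (trig_eval base_trig) z L).
    { intros z H1 H2. cut (- action (trig_eval base_trig) z L <= E); [lra|]. apply HE1. exists z. auto. }
    exists (- E). split; [|split].
    + intros z n Hn H1 H2.
      assert (Hp : path (trig_eval base_trig) n 0 1 (action (trig_eval base_trig) z n)).
      { exists z. repeat split; auto. lra. }
      destruct (path_cat _ _ _ _ _ _ _ _ Hp (path_wait (trig_eval base_trig) (L - n) 1 (base_int 1)))
        as [y [Hy1 [Hy2 Hy3]]].
      replace (n + (L - n))%nat with L in * by lia.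
      generalize (Hlow y Hy1 Hy2). lra.
    + apply NNPP. intros Hn. generalize bump_height_pos. fold beta. intros Hb.
      cut (E <= E - beta / 8); [lra|]. apply HE2. intros v [z [H1 [H2 ->]]].
      apply Rnot_lt_le. intros Hlt. apply Hn. exists z. repeat split; auto. lra.
    + destruct Hramp as [z [H1 [H2 H3]]]. generalize (Hlow z H1 H2). lra.
Qed.

(** A path through [xi] pays at least [E + beta], as the kernel is 1 at its centre and [1 - cos] is
    at least 1 there; the path [z] pays at most [E + beta / 8 + beta / 4 < E + beta / 2]. The choice
    of [xi] precedes that of the orbit. *)
Lemma resonant_bump : exists xi, 1 / 4 <= xi <= 3 / 4 /\
  forall (X : nat -> R) (i0 : nat),
    let V := trig_eval (potential xi) in
    strictly_minimizing V X ->
    (forall i, X (S (S i)) + X i = 2 * X (S i) + trig_eval (trig_derive (potential xi)) (X (S i))) ->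
    X O < X 1%nat -> (forall v N, exists i, (N <= i)%nat /\ v < X i) ->
    X i0 = xi -> X O <= 0 ->
    (forall N, exists j i, (N <= i)%nat /\ IZR j - 1 / 2 <= X i /\
       X (i + (2 * ((28 + k) * P + 2) + (L + 2)))%nat <= IZR j + 1 / 2) ->
    False.
Proof.
  destruct inf_base_action as [E [HE1 [[z [Hz0 [HzL HzA]]] HE3]]].
  assert (Hb := bump_height_pos). fold beta in Hb.
  assert (HvP : / INR P <= 1 / 40).
  { replace (1 / 40) with (/ 40) by field. apply Rinv_le_contravar; lra. }
  assert (Hb' : beta <= / INR P ^ 2 / 10 ^ 6).
  { unfold beta, bump_height.
    replace (/ (10 ^ 6 * INR P ^ 4)) with (/ INR P ^ 2 / 10 ^ 6 * / INR P ^ 2) by (field; lra).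
    generalize inv_P_sq. nra. }
  assert (Hsq : / INR P ^ 2 = / INR P * / INR P) by (field; lra).
  assert (HP0 : 0 < / INR P) by (apply Rinv_0_lt_compat; lra).
  assert (Hbase : action (trig_eval base_trig) z L =
    / INR P ^ 2 * rsum (fun i => 1 - cos (2 * PI * z (S i))) L
    + action (fun _ => 0) z L).
  { assert (G : forall n, action (trig_eval base_trig) z n =
      / INR P ^ 2 * rsum (fun i => 1 - cos (2 * PI * z (S i))) n + action (fun _ => 0) z n).
    { induction n as [|n IH]; [simpl; ring|]. cbn [action rsum]. rewrite IH, base_eval. ring. }
    apply G. }
  destruct (bump_position z L) as [xi [Hxi Hsum]].
  (* The base action of [z] is at most [5 / 2 / P + beta / 8], and each unit of [1 - cos] costs
     [1 / P^2]; hence the weight [3 P]. *)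
  { assert (Hk := action_nonneg (fun _ => 0) (fun _ => Rle_refl 0) z L).
    apply (Rmult_le_reg_l (/ INR P ^ 2)); [apply inv_P_sq|].
    replace (/ INR P ^ 2 * (3 * INR P)) with (3 * / INR P) by (field; lra).
    assert (beta <= / INR P / 10 ^ 6) by nra. unfold Rdiv in *. lra. }
  exists xi. split; [exact Hxi|].
  intros X i0 V Hmin Heq H01 Hunb Hi0 HX0 Hpass.
  assert (HV : forall y n, action V y n =
     action (trig_eval base_trig) y n + rsum (fun i => trig_eval (bump_trig xi) (y (S i))) n).
  { intros y n. rewrite <- action_plus. unfold V. clear. induction n as [|n IH]; [reflexivity|].
    cbn [action]. rewrite IH, potential_eval. ring. }
  assert (Hth : / 2 ^ k <= 1 / 32).
  { assert (beta <= 1 / 1600 / 10 ^ 6) by (generalize inv_P_sq; unfold Rdiv in *; lra). lra. }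
  apply (no_minimizer_through P V (trig_eval (trig_derive (potential xi))) ltac:(lia)
    (potential_comb xi) X Hmin Heq H01 Hunb k xi E beta i0); auto.
  - assert (beta <= 1 / 1600 / 10 ^ 6) by (generalize inv_P_sq; unfold Rdiv in *; lra).
    unfold Rdiv in *. lra.
  - fold L. intros n y Hn Hy0 Hyn [i [Hi Hyi]].
    rewrite HV. apply Rplus_le_compat; [apply HE1; auto|].
    destruct i as [|i]; [lra|].
    apply Rle_trans with (trig_eval (bump_trig xi) (y (S i))).
    + rewrite Hyi, bump_eval, Rminus_diag, Rmult_0_r, fejer_0 by lia.
      assert (Hc : cos (2 * PI * xi) <= 0).
      { assert (HPI := PI_RGT_0). apply cos_le_0; nra. }
      fold beta. nra.
    + assert (G : forall m, (i < m)%nat -> trig_eval (bump_trig xi) (y (S i)) <=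
        rsum (fun i => trig_eval (bump_trig xi) (y (S i))) m).
      { induction m as [|m IH]; intros Hm; [lia|]. cbn [rsum].
        destruct (Nat.eq_dec i m) as [->|Hne].
        - generalize (rsum_nonneg (fun i => trig_eval (bump_trig xi) (y (S i))) m
            (fun i _ => bump_nonneg xi (y (S i)))). lra.
        - generalize (IH ltac:(lia)) (bump_nonneg xi (y (S m))). lra. }
      apply G. lia.
  - fold L. exists z. split; [exact Hz0|]. split; [exact HzL|]. rewrite HV. lra.
Qed.

End Potential.

(** * No invariant graph near the resonance *)

Lemma trig_derive_scale c q l :
  trig_derive (trig_scale c q l) = trig_scale (c * IZR q) q (trig_derive l).
Proof.
  unfold trig_derive, trig_scale. rewrite !map_map. apply map_ext. intros [[a k] t].
  rewrite mult_IZR. f_equal. f_equal. ring.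
Qed.

Lemma trig_derive_n_scale c q l j :
  trig_derive_n (trig_scale c q l) j = trig_scale (c * IZR q ^ j) q (trig_derive_n l j).
Proof.
  induction j as [|j IH]; simpl.
  - rewrite Rmult_1_r. reflexivity.
  - rewrite IH, trig_derive_scale. f_equal. ring.
Qed.

Lemma invariant_circle_trig_graph_map l w :
  invariant_circle_with_frequency (fun x x' => h0 x x' + trig_eval l x') w ->
  exists f fi, graph_map (trig_eval (trig_derive l)) w f fi.
Proof.
  apply (invariant_circle_graph_map _ _ (trig_norm (trig_derive (trig_derive l)))).
  - intros y. apply trig_eval_derive.
  - intros y. apply (trig_eval_shift l 1).
  - apply trig_norm_nonneg.
  - intros a b. destruct (trig_mvt (trig_derive l) a b) as [c [_ E]].
    rewrite E, Rabs_mult. apply Rmult_le_compat_r; [apply Rabs_pos | apply trig_eval_bound].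
Qed.

Lemma iter_add_shift (f : R -> R) n a x : (forall y, f (y + a) = f y + a) ->
  Nat.iter n f (x + a) = Nat.iter n f x + a.
Proof. intros H. induction n as [|n IH]; simpl; auto. rewrite IH. apply H. Qed.

(** Conjugation by the reflection of the line; it reduces [q w < p] to [q w > p]. *)
Lemma graph_map_opp P1 P1' w f fi : graph_map P1 w f fi ->
  (forall x, P1' x = - P1 (- x)) ->
  graph_map P1' (- w) (fun x => - f (- x)) (fun x => - fi (- x)).
Proof.
  intros [H1 H2 H3 H4 H5 H6] HP. split.
  - intros s t Hst. apply Ropp_lt_contravar, H1. lra.
  - intros x. rewrite Ropp_involutive, H2. ring.
  - intros x. rewrite Ropp_involutive, H3. ring.
  - intros x. generalize (H4 (- (x + 1))). replace (- (x + 1) + 1) with (- x) by ring. lra.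
  - intros x. rewrite HP. generalize (H5 (- x)). lra.
  - intros x eps He. destruct (H6 (- x) eps He) as [N HN]. exists N. intros n Hn.
    assert (E : forall m, Nat.iter m (fun x => - f (- x)) x = - Nat.iter m f (- x)).
    { induction m as [|m IH]; simpl; [ring|]. rewrite IH, Ropp_involutive. reflexivity. }
    specialize (HN n Hn). unfold Rdist in *. rewrite <- Rabs_Ropp, E.
    replace (- ((- Nat.iter (S n) f (- x) - x) / INR (S n) - - w))
      with ((Nat.iter (S n) f (- x) - - x) / INR (S n) - w); auto.
    field. apply not_0_INR. lia.
Qed.

Lemma strictly_minimizing_shift V X a :
  strictly_minimizing V X -> strictly_minimizing V (fun i => X (a + i)%nat).
Proof.
  intros H b n z H0 Hn. rewrite Nat.add_assoc in Hn.
  destruct (H (a + b)%nat n z H0 Hn) as [H1 H2].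
  assert (E : action V (fun i => X (a + (b + i))%nat) n = action V (fun i => X (a + b + i)%nat) n).
  { apply action_ext. intros i _. f_equal. lia. }
  rewrite E. split; [exact H1|]. intros H3 i Hi. rewrite Nat.add_assoc. apply H2; auto.
Qed.

(** Go back from [n] to the last index whose value does not exceed [X O]. *)
Lemma first_increase (X : nat -> R) n : X O < X n ->
  exists a, (a < n)%nat /\ X a <= X O /\ X a < X (S a).
Proof.
  induction n as [|n IH]; intros H; [lra|].
  destruct (Rlt_le_dec (X O) (X n)) as [Hlt|Hle].
  - destruct (IH Hlt) as [a Ha]. exists a. split; [lia|apply Ha].
  - exists n. split; [lia|]. split; [exact Hle|lra].
Qed.

Section Resonance.
Variables (P1 f fi : R -> R) (w q : R) (p : Z).
Hypothesis Hgm : graph_map P1 w f fi.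
Hypothesis q_pos : 0 < q.
Let delta := q * w - IZR p.
Hypothesis delta_pos : 0 < delta.
Let D n y := q * Nat.iter n f y - INR n * IZR p.

Lemma drift y eta : 0 < eta -> exists N, forall n, (N <= n)%nat ->
  Rabs (D n y - q * y - INR n * delta) <= INR n * eta.
Proof.
  intros He. destruct (gm_freq _ _ _ _ Hgm y (eta / q)) as [N HN].
  { apply Rdiv_lt_0_compat; lra. }
  exists (S N). intros [|n] Hn; [lia|]. specialize (HN n ltac:(lia)). unfold Rdist in HN.
  assert (Hn' : 0 < INR (S n)) by (apply lt_0_INR; lia).
  replace (D (S n) y - q * y - INR (S n) * delta)
    with ((q * INR (S n)) * ((Nat.iter (S n) f y - y) / INR (S n) - w))
    by (unfold D, delta; field; lra).
  rewrite Rabs_mult, (Rabs_pos_eq (q * INR (S n))) by nra.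
  apply Rle_trans with (q * INR (S n) * (eta / q)).
  - apply Rmult_le_compat_l; [nra|lra].
  - right. field. lra.
Qed.

Lemma drift_unbounded y v : exists N, forall n, (N <= n)%nat -> v < D n y.
Proof.
  destruct (drift y (delta / 2) ltac:(lra)) as [N HN].
  destruct (nfloor_ex (Rabs ((v - q * y) * 2 / delta)) (Rabs_pos _)) as [m [_ Hm]].
  exists (N + S m)%nat. intros n Hn.
  generalize (proj1 (Rabs_le_between _ _) (HN n ltac:(lia))).
  assert (Hnm : INR m + 1 <= INR n) by (rewrite <- S_INR; apply le_INR; lia).
  assert (H : (v - q * y) * 2 / delta < INR n) by (generalize (Rle_abs ((v - q * y) * 2 / delta)); lra).
  apply (Rmult_lt_compat_r (delta / 2)) in H; [|lra].
  replace ((v - q * y) * 2 / delta * (delta / 2)) with (v - q * y) in H by (field; lra). lra.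
Qed.

(** Otherwise the position would gain at least 1 in every [T] steps, so that the mean speed would be
    at least [1 / T > delta]. *)
Lemma slow_passage y a (T : nat) (J : R) : delta * INR T < 1 ->
  forall N, exists j i, (N <= i)%nat /\
    IZR j - 1 / 2 <= D (a + i) y + J /\ D (a + (i + T)) y + J <= IZR j + 1 / 2.
Proof.
  intros HT N. apply NNPP. intros Hn.
  set (j0 := Int_part (D (a + N) y + J + 1 / 2)).
  assert (Hj0 : IZR j0 <= D (a + N) y + J + 1 / 2 < IZR j0 + 1).
  { destruct (base_Int_part (D (a + N) y + J + 1 / 2)). unfold j0. lra. }
  assert (H : forall m, IZR j0 + INR m - 1 / 2 <= D (a + (N + m * T)) y + J).
  { induction m as [|m IH].
    - simpl. rewrite Nat.add_0_r. lra.
    - apply Rnot_lt_le. intros Hlt. apply Hn.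
      exists (j0 + Z.of_nat m)%Z, (N + m * T)%nat. split; [lia|].
      rewrite plus_IZR, <- INR_IZR_INZ. split; [lra|].
      replace (a + (N + m * T + T))%nat with (a + (N + S m * T))%nat by lia.
      rewrite S_INR in Hlt. lra. }
  destruct T as [|T'].
  { apply Hn. destruct (base_Int_part (D (a + N) y + J + 1 / 2)) as [B1 B2].
    exists j0, N. split; [lia|]. rewrite Nat.add_0_r. lra. }
  set (T := S T') in *.
  assert (HTp : 0 < INR T) by (apply lt_0_INR; unfold T; lia).
  (* Half of the slack: [INR T * (delta + eta) = 1 - INR T * eta], so each window still contributes
     a fixed contradiction of size [INR T * eta]. *)
  set (eta := (1 - delta * INR T) / (2 * INR T)).
  assert (Heta : 0 < eta) by (apply Rdiv_lt_0_compat; lra).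
  destruct (drift y eta Heta) as [N1 HN1].
  set (B := q * y + J - IZR j0 + 1 / 2 + INR (a + N) * (delta + eta)).
  destruct (nfloor_ex (Rabs (B / (eta * INR T))) (Rabs_pos _)) as [m [_ Hm]].
  set (m' := (S m + N1)%nat).
  assert (Hm' : B / (eta * INR T) < INR m').
  { apply Rle_lt_trans with (1 := Rle_abs _). apply Rlt_le_trans with (1 := Hm).
    rewrite <- S_INR. apply le_INR. unfold m'. lia. }
  apply (Rmult_lt_compat_r (eta * INR T)) in Hm'; [|nra].
  replace (B / (eta * INR T) * (eta * INR T)) with B in Hm' by (field; lra).
  generalize (H m') (proj1 (Rabs_le_between _ _) (HN1 (a + (N + m' * T))%nat ltac:(unfold m', T; nia))).
  replace (a + (N + m' * T))%nat with (a + N + m' * T)%nat by lia.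
  rewrite (plus_INR (a + N)), mult_INR.
  assert (E : INR T * (delta + eta) = 1 - INR T * eta) by (unfold eta; field; lra).
  intros G1 [_ G2].
  assert (E2 : (INR (a + N) + INR m' * INR T) * delta + (INR (a + N) + INR m' * INR T) * eta
    = INR (a + N) * (delta + eta) + INR m' * (1 - INR T * eta)) by (rewrite <- E; ring).
  unfold B in Hm'. lra.
Qed.

Lemma iter_inverse n x : Nat.iter n f (Nat.iter n fi x) = x.
Proof.
  revert x. induction n as [|n IH]; intros x; [reflexivity|].
  rewrite Nat.iter_succ_r. simpl (Nat.iter (S n) fi x). rewrite (gm_f_fi _ _ _ _ Hgm). apply IH.
Qed.

Lemma iter_inc n x y : Nat.iter n f x <= Nat.iter n f y -> x <= y.
Proof.
  revert x y. induction n as [|n IH]; intros x y H; [exact H|].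
  apply IH. apply Rnot_lt_le. intros Hlt.
  generalize (gm_inc _ _ _ _ Hgm _ _ Hlt). simpl in H. lra.
Qed.

End Resonance.

Lemma no_resonant_graph (P k : nat) :
  (40 <= P)%nat -> 6 * / 2 ^ k < bump_height P ->
  exists xi, forall (q : nat) (p : Z) (w : R) (f fi : R -> R),
    (0 < q)%nat ->
    graph_map (trig_eval (trig_derive
      (trig_scale (/ INR q ^ 2) (Z.of_nat q) (potential P xi)))) w f fi ->
    0 < INR q * w - IZR p ->
    (INR q * w - IZR p) * INR (2 * ((28 + k) * P + 2) + ((2 * k + 28) * P + 4 + 2)) < 1 ->
    False.
Proof.
  intros HP Hk. destruct (resonant_bump P HP k Hk) as [xi [Hxi H]].
  exists xi. intros q p w f fi Hq Hgm Hd0 Hd1.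
  assert (Hq' : 0 < INR q) by (apply lt_0_INR; exact Hq).
  (* The orbit must start left of 0 and pass through [xi], so it is traced back from [xi / q] by
     [s = m q] steps. A multiple of [q] makes the drift [s p / q] an integer, and iterates of [f]
     commute with integer translations. *)
  destruct (drift_unbounded _ f fi w (INR q) p Hgm Hq' Hd0 0 xi) as [m Hm].
  set (s := (m * q)%nat).
  specialize (Hm s ltac:(unfold s; nia)).
  set (y := Nat.iter s fi (xi / INR q)).
  set (J := (Z.of_nat s * p)%Z).
  assert (HJ : IZR J = INR s * IZR p) by (unfold J; rewrite mult_IZR, <- INR_IZR_INZ; reflexivity).
  set (Z := fun i => INR q * Nat.iter i f y - INR i * IZR p + IZR J).
  assert (HZs : Z s = xi).
  { unfold Z, y. rewrite (iter_inverse _ f fi w Hgm), HJ. field. lra. }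
  assert (HZ0 : Z O <= 0).
  { assert (Hy : y <= 0 + - (INR m * IZR p)).
    { apply (iter_inc _ f fi w Hgm s). unfold y at 1. rewrite (iter_inverse _ f fi w Hgm).
      rewrite iter_add_shift.
      - apply (Rmult_le_reg_l (INR q)); [exact Hq'|].
        unfold s in Hm at 2. rewrite mult_INR in Hm.
        replace (INR q * (xi / INR q)) with xi by (field; lra). lra.
      - intros u. generalize (shift_IZR f (gm_shift _ _ _ _ Hgm) (- (Z.of_nat m * p)) u).
        rewrite opp_IZR, mult_IZR, <- INR_IZR_INZ. auto. }
    unfold Z. rewrite HJ. unfold s. rewrite mult_INR. simpl. nra. }
  set (V := trig_eval (potential P xi)).
  set (l := trig_scale (/ INR q ^ 2) (Z.of_nat q) (potential P xi)) in *.
  assert (HZmin : strictly_minimizing V Z).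
  { apply (rescaled_orbit_minimizing (trig_eval l) (trig_eval (trig_derive l)) w f fi); auto.
    - intros u. apply trig_eval_derive.
    - intros z x. apply trig_eval_shift.
    - intros x. unfold l. rewrite trig_eval_scale, <- INR_IZR_INZ. unfold V, Rdiv. ring. }
  assert (HZeq : forall i, Z (S (S i)) + Z i =
     2 * Z (S i) + trig_eval (trig_derive (potential P xi)) (Z (S i))).
  { intros i. unfold Z at 1 2 3.
    assert (E := gm_eq _ _ _ _ Hgm (Nat.iter (S i) f y)).
    simpl (Nat.iter (S i) f y) in E at 2. rewrite (gm_fi_f _ _ _ _ Hgm) in E.
    unfold l in E. rewrite trig_derive_scale, trig_eval_scale, <- INR_IZR_INZ in E.
    replace (trig_eval (trig_derive (potential P xi)) (Z (S i)))
      with (trig_eval (trig_derive (potential P xi)) (INR q * Nat.iter (S i) f y)).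
    2:{ rewrite <- (trig_eval_shift _ (J - Z.of_nat (S i) * p)). f_equal.
        unfold Z. rewrite minus_IZR, mult_IZR, <- INR_IZR_INZ. ring. }
    change (Nat.iter (S (S i)) f y) with (f (Nat.iter (S i) f y)).
    apply (f_equal (Rmult (INR q))) in E.
    rewrite Rmult_plus_distr_l, Rmult_plus_distr_l in E.
    set (v := trig_eval (trig_derive (potential P xi)) (INR q * Nat.iter (S i) f y)) in *.
    replace (INR q * (/ INR q ^ 2 * INR q * v)) with v in E by (field; lra).
    rewrite (S_INR (S i)), (S_INR i). lra. }
  (* The analysis of minimizers starts from [X O < X 1], so the orbit is restarted at such an index
     before [s], still left of 0. *)
  destruct (first_increase Z s ltac:(lra)) as [a [Ha1 [Ha2 Ha3]]].
  apply (H (fun i => Z (a + i)%nat) (s - a)%nat).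
  - apply strictly_minimizing_shift, HZmin.
  - intros i. rewrite !Nat.add_succ_r. apply HZeq.
  - rewrite Nat.add_0_r, Nat.add_1_r. exact Ha3.
  - intros v N.
    destruct (drift_unbounded _ f fi w (INR q) p Hgm Hq' Hd0 y (v - IZR J)) as [n Hn].
    exists (N + n)%nat. split; [lia|]. specialize (Hn (a + (N + n))%nat ltac:(lia)). unfold Z. lra.
  - replace (a + (s - a))%nat with s by lia. exact HZs.
  - rewrite Nat.add_0_r. lra.
  - apply (slow_passage _ f fi w (INR q) p Hgm Hq' y a _ (IZR J)). exact Hd1.
Qed.

(** * Choice of the parameters *)

(** Pigeonhole: [Q + 1] fractional parts in [Q] half-open boxes, whence the strict inequality. *)
Lemma dirichlet (w : R) (Q : nat) : (0 < Q)%nat ->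
  exists (q : nat) (p : Z), (0 < q <= Q)%nat /\ Rabs (INR q * w - IZR p) < / INR Q.
Proof.
  intros HQ. assert (HQ' : 0 < INR Q) by (apply lt_0_INR; exact HQ).
  set (fr := fun i : nat => INR i * w - IZR (Int_part (INR i * w))).
  assert (Hfr : forall i, 0 <= fr i < 1).
  { intros i. destruct (base_Int_part (INR i * w)). unfold fr. lra. }
  set (box := fun i : nat => Z.to_nat (Int_part (fr i * INR Q))).
  assert (Hbox : forall i, INR (box i) <= fr i * INR Q < INR (box i) + 1).
  { intros i. destruct (base_Int_part (fr i * INR Q)) as [B1 B2].
    assert (Hz : (0 <= Int_part (fr i * INR Q))%Z).
    { apply Z.lt_succ_r, lt_IZR. rewrite succ_IZR. specialize (Hfr i). nra. }
    unfold box. rewrite INR_IZR_INZ, Z2Nat.id by exact Hz. lra. }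
  assert (Hex : exists i j, (i < j <= Q)%nat /\ box i = box j).
  { apply NNPP. intros Hn.
    assert (Hnd : NoDup (map box (seq 0 (S Q)))).
    { apply Injective_map_NoDup_in; [|apply seq_NoDup].
      intros i j Hi Hj E. apply in_seq in Hi. apply in_seq in Hj.
      destruct (Nat.lt_trichotomy i j) as [Hij|[Hij|Hij]]; auto; exfalso; apply Hn.
      - exists i, j. split; [lia|exact E].
      - exists j, i. split; [lia|symmetry; exact E]. }
    apply (NoDup_incl_length (l' := seq 0 Q)) in Hnd.
    - rewrite length_map, !length_seq in Hnd. lia.
    - intros m Hm. apply in_map_iff in Hm. destruct Hm as [i [<- _]]. apply in_seq.
      split; [lia|]. apply INR_lt. specialize (Hbox i). specialize (Hfr i). simpl. nra. }
  destruct Hex as [i [j [Hij E]]].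
  exists (j - i)%nat, (Int_part (INR j * w) - Int_part (INR i * w))%Z. split; [lia|].
  rewrite minus_INR, minus_IZR by lia.
  replace ((INR j - INR i) * w - (IZR (Int_part (INR j * w)) - IZR (Int_part (INR i * w))))
    with (fr j - fr i) by (unfold fr; ring).
  generalize (Hbox i) (Hbox j). rewrite E. intros B1 B2.
  apply Rabs_def1; apply (Rmult_lt_reg_r (INR Q)); auto.
  - rewrite Rinv_l by lra. lra.
  - rewrite Ropp_mult_distr_l_reverse, Rinv_l by lra. lra.
Qed.

Lemma irrational_not_integer w (q : nat) (p : Z) :
  irrational w -> (0 < q)%nat -> INR q * w - IZR p <> 0.
Proof.
  intros Hw Hq E. apply (Hw p (Z.of_nat q) ltac:(lia)). rewrite <- INR_IZR_INZ.
  apply lt_0_INR in Hq. apply (Rmult_eq_reg_l (INR q)); [|lra]. field_simplify; lra.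
Qed.

(** It serves to exclude the denominators up to the threshold [M] beyond which [w] admits no
    approximation of order 1/5. *)
Lemma irrational_gap w (M : nat) : irrational w ->
  exists c, 0 < c /\ forall q p, (0 < q <= M)%nat -> c <= Rabs (INR q * w - IZR p).
Proof.
  intros Hw. induction M as [|M [c [Hc IH]]].
  - exists 1. split; [lra|]. intros q p Hq. lia.
  - set (z := Int_part (INR (S M) * w)).
    destruct (base_Int_part (INR (S M) * w)) as [B1 B2]. fold z in B1, B2.
    assert (B3 := irrational_not_integer w (S M) z Hw ltac:(lia)).
    set (fr := INR (S M) * w - IZR z) in *.
    exists (Rmin c (Rmin fr (1 - fr))). split.
    + repeat apply Rmin_pos; unfold fr in *; lra.
    + intros q p Hq. destruct (Nat.eq_dec q (S M)) as [->|Hne].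
      * apply Rle_trans with (1 := Rmin_r _ _).
        destruct (Z.le_gt_cases p z) as [Hp|Hp].
        -- apply Rle_trans with (1 := Rmin_l _ _). apply IZR_le in Hp.
           apply Rle_trans with (2 := Rle_abs _). unfold fr. lra.
        -- apply Rle_trans with (1 := Rmin_r _ _). apply Zlt_le_succ, IZR_le in Hp.
           rewrite succ_IZR in Hp. rewrite Rabs_minus_sym.
           apply Rle_trans with (2 := Rle_abs _). unfold fr. lra.
      * apply Rle_trans with (1 := Rmin_l _ _). apply IH. lia.
Qed.

(* With [|q w - p| < 1 / (100 n^5)], failure of 1/5-well approximability prevents [q] from
   being much smaller than [n^5]. *)
Lemma good_denominator w : badly_approximable w ->
  exists n0 : nat, forall n : nat, (n0 <= n)%nat ->
    exists (q : nat) (p : Z), (n ^ 4 <= q <= 100 * n ^ 5)%nat /\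
      INR q * w - IZR p <> 0 /\ Rabs (INR q * w - IZR p) * INR (100 * n ^ 5) < 1.
Proof.
  intros [Hirr [_ Hbad]].
  assert (Hna := Hbad (1 / 5) ltac:(lra)).
  apply not_all_ex_not in Hna. destruct Hna as [M HM].
  destruct (irrational_gap w M Hirr) as [c [Hc Hgap]].
  destruct (nfloor_ex (/ c) ltac:(left; apply Rinv_0_lt_compat, Hc)) as [n1 [_ Hn1]].
  exists (S n1). intros n Hn.
  assert (HnR : 1 <= INR n) by (apply (le_INR 1); lia).
  set (Q := (100 * n ^ 5)%nat).
  assert (HQR : INR Q = 100 * INR n ^ 5).
  { unfold Q. rewrite mult_INR, pow_INR. simpl (INR 100). ring. }
  assert (Hn5 : INR n <= INR n ^ 5) by (replace (INR n) with (INR n ^ 1) at 1 by ring; apply Rle_pow; auto).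
  destruct (dirichlet w Q) as [q [p [Hq Hqp]]].
  { apply INR_lt. rewrite HQR. simpl (INR 0). lra. }
  assert (HQ0 : 0 < INR Q) by lra.
  assert (HqM : (M < q)%nat).
  { apply Nat.nle_gt. intros Hle. generalize (Hgap q p ltac:(lia)). intros Hg.
    assert (c < / INR Q) by lra.
    assert (INR Q < / c).
    { rewrite <- (Rinv_inv (INR Q)). apply Rinv_lt_contravar; auto.
      apply Rmult_lt_0_compat; [exact Hc|]. apply Rinv_0_lt_compat, HQ0. }
    apply le_INR in Hn. rewrite S_INR in Hn. lra. }
  assert (Hq0 : 0 < INR q) by (apply lt_0_INR; lia).
  exists q, p. split; [split; [|lia]|split].
  (* [q < n^4] would give [q^(6/5) < n^(24/5) <= n^5 < Q], hence an approximation of order 1/5 with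
     [q > M]. *)
  - apply Nat.nlt_ge. intros Hlt. apply HM. exists q. split; [exact HqM|]. exists p.
    apply Rlt_trans with (1 := Hqp).
    replace (-1 - 1 / 5) with (- (6 / 5)) by field. rewrite Rpower_Ropp.
    apply Rinv_lt_contravar; [apply Rmult_lt_0_compat; [apply exp_pos|exact HQ0]|].
    apply Rlt_le_trans with (Rpower (INR n ^ 4) (6 / 5)).
    + apply Rlt_Rpower_l; [lra|]. split; [exact Hq0|]. rewrite <- pow_INR. apply lt_INR, Hlt.
    + rewrite <- Rpower_pow by lra. rewrite Rpower_mult.
      apply Rle_trans with (Rpower (INR n) (INR 5)).
      * apply Rle_Rpower; [exact HnR|]. simpl. lra.
      * rewrite Rpower_pow by lra. lra.
  - apply irrational_not_integer; [exact Hirr | lia].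
  - apply (Rmult_lt_compat_r (INR Q)) in Hqp; [|exact HQ0]. rewrite Rinv_l in Hqp by lra. exact Hqp.
Qed.

(** With [m = n / 17] rounded down, [2^n >= (m + 1)^17 >= (n / 17)^17]. The power 16 is that of
    [P^4] for [P = n^4]. *)
Lemma exp_beats_power : exists n0 : nat, forall n : nat, (n0 <= n)%nat ->
  6 * / 2 ^ n < / (10 ^ 6 * INR n ^ 16).
Proof.
  destruct (nfloor_ex (6 * 10 ^ 6 * 17 ^ 17)) as [n1 [_ Hn1]].
  { apply Rmult_le_pos; [lra|]. apply pow_le. lra. }
  exists (S n1). intros n Hn.
  assert (HnR : 6 * 10 ^ 6 * 17 ^ 17 < INR n).
  { apply le_INR in Hn. rewrite S_INR in Hn. lra. }
  assert (Hn0 : 0 < INR n) by (apply lt_0_INR; lia).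
  set (m := (n / 17)%nat).
  assert (Hm : (17 * m <= n < 17 * (m + 1))%nat).
  { unfold m. generalize (Nat.div_mod n 17 ltac:(lia)) (Nat.mod_upper_bound n 17 ltac:(lia)). lia. }
  assert (H2 : forall i, INR i + 1 <= 2 ^ i).
  { induction i as [|i IH]; [simpl; lra|]. rewrite S_INR. simpl. generalize (pos_INR i). lra. }
  assert (H3 : (INR n / 17) ^ 17 <= 2 ^ n).
  { apply Rle_trans with ((2 ^ m) ^ 17).
    - apply pow_incr. split; [apply Rdiv_le_0_compat; lra|].
      apply Rle_trans with (2 := H2 m). destruct Hm as [_ Hm]. apply lt_INR in Hm.
      rewrite mult_INR, plus_INR in Hm. simpl (INR 17) in Hm. simpl (INR 1) in Hm. lra.
    - rewrite <- pow_mult. apply Rle_pow; [lra|lia]. }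
  assert (H4 : 6 * (10 ^ 6 * INR n ^ 16) < 2 ^ n).
  { apply Rlt_le_trans with (2 := H3). unfold Rdiv. rewrite Rpow_mult_distr, pow_inv.
    assert (Hc : 0 < 17 ^ 17) by (apply pow_lt; lra).
    set (c := 17 ^ 17) in *. clearbody c.
    assert (Hn16 : 0 < INR n ^ 16) by (apply pow_lt; exact Hn0).
    apply (Rmult_lt_reg_r c); [exact Hc|].
    replace (INR n ^ 17 * / c * c) with (INR n * INR n ^ 16) by (field; lra).
    replace (6 * (10 ^ 6 * INR n ^ 16) * c) with (6 * 10 ^ 6 * c * INR n ^ 16) by ring.
    apply Rmult_lt_compat_r; assumption. }
  assert (H5 : 0 < 10 ^ 6 * INR n ^ 16) by (apply Rmult_lt_0_compat; apply pow_lt; lra).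
  assert (H6 : 0 < 2 ^ n) by (apply pow_lt; lra).
  apply (Rmult_lt_reg_r (2 ^ n)); [exact H6|].
  rewrite Rmult_assoc, Rinv_l, Rmult_1_r by lra.
  apply (Rmult_lt_reg_l (10 ^ 6 * INR n ^ 16)); [exact H5|].
  rewrite <- Rmult_assoc, Rinv_r by lra. lra.
Qed.

(** [n] is the integer just above the solution [t] of [eps * t^s = K], and [n <= 2 t] since [t > 1].
    Later [n^-s] is the size of the norm and [n^9] that of the degree. *)
Lemma scale_choice (s : nat) (K : R) (n0 : nat) : (0 < s)%nat -> 0 < K ->
  exists C eps0, 0 < C /\ 0 < eps0 <= 1 /\ forall eps, 0 < eps < eps0 ->
    exists n : nat, (n0 <= n)%nat /\ K < eps * INR n ^ s /\
      INR n ^ 9 <= C * Rpower eps (- (9 / INR s)).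
Proof.
  intros Hs HK. assert (Hs' : 0 < INR s) by (apply lt_0_INR, Hs).
  set (m := INR (S n0)).
  assert (Hm : 1 <= m) by (apply (le_INR 1); lia).
  assert (Hms : 0 < m ^ s) by (apply pow_lt; lra).
  exists (2 ^ 9 * Rpower K (9 / INR s)), (Rmin 1 (K / m ^ s)). split; [|split; [split|]].
  - apply Rmult_lt_0_compat; [lra|apply exp_pos].
  - apply Rmin_pos; [lra|]. apply Rdiv_lt_0_compat; auto.
  - apply Rmin_l.
  - intros eps [He1 He2].
    assert (Hlt : eps < K / m ^ s) by (apply Rlt_le_trans with (1 := He2), Rmin_r).
    assert (HKe : 0 < K / eps) by (apply Rdiv_lt_0_compat; auto).
    set (t := Rpower (K / eps) (1 / INR s)).
    assert (Ht : t ^ s = K / eps).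
    { rewrite <- Rpower_pow by apply exp_pos. unfold t. rewrite Rpower_mult.
      replace (1 / INR s * INR s) with 1 by (field; lra). apply Rpower_1, HKe. }
    assert (Htm : m < t).
    { apply Rnot_le_lt. intros Hle.
      assert (Hp : t ^ s <= m ^ s) by (apply pow_incr; split; [left; apply exp_pos|exact Hle]).
      rewrite Ht in Hp. apply (Rmult_lt_compat_r (m ^ s)) in Hlt; auto.
      apply (Rmult_le_compat_r eps) in Hp; [|lra].
      replace (K / eps * eps) with K in Hp by (field; lra).
      replace (K / m ^ s * m ^ s) with K in Hlt by (field; lra). lra. }
    destruct (nfloor_ex t ltac:(lra)) as [n [Hn1 Hn2]].
    exists (S n). rewrite S_INR. split; [|split].
    + apply Nat.lt_le_incl, INR_lt. rewrite S_INR. unfold m in Htm. rewrite S_INR in Htm. lra.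
    + replace K with (eps * t ^ s) by (rewrite Ht; field; lra).
      apply Rmult_lt_compat_l; [exact He1|].
      clearbody t. clear - Hn2 Hs Htm Hm. assert (0 < t) by lra.
      destruct s as [|s]; [lia|]. clear Hs.
      induction s as [|s IH]; [simpl; lra|].
      change (t * t ^ S s < (INR n + 1) * (INR n + 1) ^ S s).
      apply Rmult_le_0_lt_compat; [lra | left; apply pow_lt; lra | lra | exact IH].
    + apply Rle_trans with ((2 * t) ^ 9).
      * apply pow_incr. split; [generalize (pos_INR n)|]; lra.
      * rewrite Rpow_mult_distr, Rmult_assoc. apply Rmult_le_compat_l; [lra|].
        rewrite <- Rpower_pow by apply exp_pos. unfold t. rewrite Rpower_mult.
        replace (1 / INR s * INR 9) with (9 / INR s) by (simpl (INR 9); field; lra).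
        unfold Rdiv at 1. rewrite <- Rpower_mult_distr by (auto; apply Rinv_0_lt_compat, He1).
        right. f_equal. unfold Rpower. rewrite ln_Rinv by exact He1. f_equal. ring.
Qed.

Lemma Rpower_exponent_le eps a b : 0 < eps < 1 -> a <= b -> Rpower eps (- a) <= Rpower eps (- b).
Proof.
  intros He Hab. rewrite !Rpower_Ropp. apply Rinv_le_contravar; [apply exp_pos|].
  unfold Rpower. assert (Hl : ln eps < 0) by (rewrite <- ln_1; apply ln_increasing; lra).
  destruct (Rle_lt_or_eq_dec _ _ Hab) as [Hlt|Heq]; [|rewrite Heq; lra].
  left. apply exp_increasing. nra.
Qed.

(** [B] stands for a bound on [q^(j - 2)], the factor that the rescaling produces in the derivative
    of order [j]. *)
Lemma potential_scaled_norm P xi (q : nat) (sg : Z) (j : nat) (B : R) :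
  (40 <= P)%nat -> (0 < q)%nat -> Z.abs sg = Z.of_nat q -> (j <= 2)%nat ->
  INR q ^ j <= B * INR q ^ 2 -> 0 <= B -> forall x,
  Rabs (Derive_n (trig_eval (trig_scale (/ INR q ^ 2) sg (potential P xi))) j x)
  <= B * (129 / INR P ^ 2).
Proof.
  intros HP Hq Hsg Hj HB HB0 x. assert (Hq' : 0 < INR q) by (apply lt_0_INR, Hq).
  rewrite trig_eval_derive_n. apply Rle_trans with (1 := trig_eval_bound _ _).
  rewrite trig_derive_n_scale, trig_norm_scale.
  apply Rmult_le_compat; [apply Rabs_pos | apply trig_norm_nonneg | |
    apply potential_norm_derive; assumption].
  rewrite Rabs_mult, <- RPow_abs, <- abs_IZR, Hsg, <- INR_IZR_INZ.
  assert (H2 : 0 < INR q ^ 2) by (apply pow_lt, Hq').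
  rewrite Rabs_pos_eq by (left; apply Rinv_0_lt_compat, H2).
  apply (Rmult_le_reg_l (INR q ^ 2)); [exact H2|].
  rewrite <- Rmult_assoc, Rinv_r by lra. lra.
Qed.

(* Here [P = n^4] and the tolerance is [2^-n]; [q <= 100 n^5] gives the degree, and [q >= n^4] turns
   the bounds [n^-8] (order 2) and [n^-8 / q] (orders 0 and 1) into powers of [n].  The sign of
   [q w - p] decides between the potential and its reflection. *)
Lemma resonant_trig_poly (w : R) : badly_approximable w ->
  exists n0 : nat, forall n : nat, (n0 <= n)%nat ->
    exists (q : nat) (l : trig), (n ^ 4 <= q)%nat /\
      trig_deg_le (2400 * n ^ 9) l /\
      (forall j B x, (j <= 2)%nat -> INR q ^ j <= B * INR q ^ 2 -> 0 <= B ->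
        Rabs (Derive_n (trig_eval l) j x) <= B * (129 / INR n ^ 8)) /\
      ~ invariant_circle_with_frequency (fun x x' => h0 x x' + trig_eval l x') w.
Proof.
  intros Hw. destruct (good_denominator w Hw) as [n1 H1]. destruct exp_beats_power as [n2 H2].
  exists (n1 + n2 + 40)%nat. intros n Hn.
  destruct (H1 n ltac:(lia)) as [q [p [Hq [Hne Hlt]]]].
  specialize (H2 n ltac:(lia)).
  set (P := (n ^ 4)%nat).
  assert (HP : (40 <= P)%nat).
  { unfold P. apply Nat.le_trans with (n ^ 1)%nat; [simpl; lia|].
    apply Nat.pow_le_mono_r; lia. }
  assert (HPR : INR P = INR n ^ 4) by (unfold P; apply pow_INR).
  destruct (no_resonant_graph P n HP) as [xi Hxi].
  { unfold bump_height. rewrite HPR, <- pow_mult. exact H2. }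
  assert (HT : (2 * ((28 + n) * P + 2) + ((2 * n + 28) * P + 4 + 2) <= 100 * n ^ 5)%nat).
  { replace (n ^ 5)%nat with (n * P)%nat by (unfold P; simpl; lia). nia. }
  apply le_INR in HT.
  assert (Hq0 : (0 < q)%nat) by (fold P in Hq; lia).
  assert (Hdeg : forall sg, Z.abs sg = Z.of_nat q ->
    trig_deg_le (2400 * n ^ 9) (trig_scale (/ INR q ^ 2) sg (potential P xi))).
  { intros sg Hsg. apply (trig_deg_scale _ _ (24 * P)); [|apply potential_deg, HP].
    rewrite Hsg, <- Nat2Z.inj_mul. apply inj_le.
    replace (2400 * n ^ 9)%nat with (100 * n ^ 5 * (24 * P))%nat.
    - apply Nat.mul_le_mono_r. lia.
    - unfold P. replace 9%nat with (5 + 4)%nat by reflexivity. rewrite Nat.pow_add_r. lia. }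
  assert (Hnorm : forall sg, Z.abs sg = Z.of_nat q ->
    forall j B x, (j <= 2)%nat -> INR q ^ j <= B * INR q ^ 2 -> 0 <= B ->
    Rabs (Derive_n (trig_eval (trig_scale (/ INR q ^ 2) sg (potential P xi))) j x)
      <= B * (129 / INR n ^ 8)).
  { intros sg Hsg j B x Hj HB HB0.
    replace (INR n ^ 8) with (INR P ^ 2) by (rewrite HPR, <- pow_mult; reflexivity).
    apply (potential_scaled_norm P xi q sg j B); assumption. }
  destruct (Rlt_le_dec 0 (INR q * w - IZR p)) as [Hpos|Hneg].
  - exists q, (trig_scale (/ INR q ^ 2) (Z.of_nat q) (potential P xi)).
    split; [apply Hq|]. split; [apply Hdeg; lia|]. split; [apply Hnorm; lia|].
    intros Hc. apply invariant_circle_trig_graph_map in Hc. destruct Hc as [f [fi Hgm]].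
    apply (Hxi q p w f fi Hq0 Hgm Hpos).
    rewrite Rabs_pos_eq in Hlt by lra. nra.
  - exists q, (trig_scale (/ INR q ^ 2) (- Z.of_nat q) (potential P xi)).
    split; [apply Hq|]. split; [apply Hdeg; lia|]. split; [apply Hnorm; lia|].
    intros Hc. apply invariant_circle_trig_graph_map in Hc. destruct Hc as [f [fi Hgm]].
    apply (graph_map_opp _ (trig_eval (trig_derive
      (trig_scale (/ INR q ^ 2) (Z.of_nat q) (potential P xi))))) in Hgm.
    + apply (Hxi q (- p)%Z (- w) _ _ Hq0 Hgm).
      * rewrite opp_IZR. lra.
      * rewrite opp_IZR. rewrite Rabs_left in Hlt by lra.
        apply Rle_lt_trans with (2 := Hlt). replace (INR q * - w - - IZR p) with (- (INR q * w - IZR p)) by ring.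
        apply Rmult_le_compat_l; lra.
    + intros x. rewrite !trig_derive_scale, !trig_eval_scale, opp_IZR.
      replace (- IZR (Z.of_nat q) * - x) with (IZR (Z.of_nat q) * x) by ring. ring.
Qed.

(** On a graph [f + fi] is increasing, hence so is [2 x + P1 x]; but from 0 to [y = 1 / (4 q)] the
    first term gains only [2 y] while [P1] falls by [8 pi y]. *)
Lemma large_kick_no_circle (q : nat) (w : R) : (0 < q)%nat ->
  ~ invariant_circle_with_frequency
      (fun x x' => h0 x x' + trig_eval [(/ INR q ^ 2, Z.of_nat q, 0)] x') w.
Proof.
  intros Hq Hc. assert (Hq' : 0 < INR q) by (apply lt_0_INR, Hq).
  apply invariant_circle_trig_graph_map in Hc. destruct Hc as [f [fi Hgm]].
  assert (fi_inc := inverse_strictly_increasing f fi (gm_inc _ _ _ _ Hgm) (gm_f_fi _ _ _ _ Hgm)).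
  set (y := / (4 * INR q)).
  assert (Hy : 0 < y) by (apply Rinv_0_lt_compat; lra).
  generalize (gm_inc _ _ _ _ Hgm 0 y Hy) (fi_inc 0 y Hy) (gm_eq _ _ _ _ Hgm 0) (gm_eq _ _ _ _ Hgm y).
  cbn [trig_derive map trig_eval]. rewrite <- INR_IZR_INZ.
  replace (2 * PI * INR q * 0 + (0 + PI / 2)) with (PI / 2) by field.
  replace (2 * PI * INR q * y + (0 + PI / 2)) with PI by (unfold y; field; lra).
  rewrite cos_PI2, cos_PI.
  replace (/ INR q ^ 2 * (2 * PI * INR q)) with (8 * PI * y) by (unfold y; field; lra).
  assert (HPI : 3 < 2 * PI) by (generalize PI2_3_2; lra). intros. nra.
Qed.

Lemma exponent_bound r a b : r < 3 -> 0 < b -> 2 * a * (3 - r) <= 3 * b -> a / b <= 3 / (2 * (3 - r)).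
Proof.
  intros Hr Hb H. apply (Rmult_le_reg_r (b * (2 * (3 - r)))); [nra|].
  replace (a / b * (b * (2 * (3 - r)))) with (2 * a * (3 - r)) by (field; lra).
  replace (3 / (2 * (3 - r)) * (b * (2 * (3 - r)))) with (3 * b) by (field; lra). exact H.
Qed.

Theorem theorem1p2 (w r : R) :
  badly_approximable w -> 0 <= r < 3 ->
  exists C : R, 0 < C /\
  exists eps0 : R, 0 < eps0 /\
  forall eps : R, 0 < eps < eps0 ->
  exists (N : nat) (RN : R -> R),
    INR N <= C * Rpower eps (- (3 / (2 * (3 - r)))) /\
    trig_poly_deg_le N RN /\
    Cr_norm_lt r RN eps /\
    ~ invariant_circle_with_frequency (fun x x' => h0 x x' + RN x') w.
Proof.
  intros Hw Hr. destruct (Rlt_le_dec r 1) as [Hr1|Hr1].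
  (* The degree is about [eps^(-1/2)] and the perturbation is the inverse square of the degree; 1/2
     is the value of [3 / (2 (3 - r))] at [r = 0], its smallest. *)
  - exists 2. split; [lra|]. exists 1. split; [lra|]. intros eps He.
    set (t := Rpower eps (- (1 / 2))).
    assert (Ht : 1 < t).
    { replace 1 with (Rpower eps (- 0)) by (rewrite Ropp_0; apply Rpower_O; lra).
      unfold t. rewrite !Rpower_Ropp.
      apply Rinv_lt_contravar; [apply Rmult_lt_0_compat; apply exp_pos|].
      unfold Rpower. apply exp_increasing.
      assert (Hl : ln eps < 0) by (rewrite <- ln_1; apply ln_increasing; lra). lra. }
    assert (Htt : eps * (t * t) = 1).
    { unfold t. rewrite <- Rpower_plus. replace (- (1 / 2) + - (1 / 2)) with (- (1)) by field.
      rewrite Rpower_Ropp, Rpower_1 by lra. apply Rinv_r. lra. }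
    destruct (nfloor_ex t ltac:(lra)) as [m [Hm1 Hm2]].
    exists (S m), (trig_eval [(/ INR (S m) ^ 2, Z.of_nat (S m), 0)]).
    assert (HS : t < INR (S m) <= 2 * t) by (rewrite S_INR; lra).
    split; [|split; [|split]].
    + apply Rle_trans with (2 * t); [lra|]. apply Rmult_le_compat_l; [lra|].
      apply Rpower_exponent_le; [exact He|]. apply exponent_bound; lra.
    + apply trig_poly_of_trig. repeat constructor. simpl. lia.
    + intros j x Hj. destruct j as [|j]; [|rewrite S_INR in Hj; generalize (pos_INR j); lra].
      apply Rle_lt_trans with (1 := trig_eval_bound _ _). cbn [trig_norm].
      assert (Hp : 0 < INR (S m) ^ 2) by (apply pow_lt; lra).
      rewrite Rplus_0_r, Rabs_pos_eq by (left; apply Rinv_0_lt_compat, Hp).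
      apply (Rmult_lt_reg_r (INR (S m) ^ 2)); [exact Hp|]. rewrite Rinv_l by lra. nra.
    + apply large_kick_no_circle. lia.
  - destruct (resonant_trig_poly w Hw) as [n0 Hn0].
    (* The highest order involved is 1 for [r < 2] and 2 otherwise, with norms of size [n^-12] and
       [n^-8]; against the degree [n^9] this gives the exponents 9/12 and 9/8. *)
    set (s := if Rlt_dec r 2 then 12%nat else 8%nat).
    destruct (scale_choice s 129 (S n0)) as [C [eps0 [HC [He0 Hscale]]]].
    { unfold s. destruct (Rlt_dec r 2); lia. } { lra. }
    exists (2400 * C). split; [lra|]. exists eps0. split; [lra|]. intros eps He.
    destruct (Hscale eps He) as [n [Hn1 [Hn2 Hn3]]].
    destruct (Hn0 n ltac:(lia)) as [q [l [Hq [Hdeg [Hnorm Hno]]]]].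
    assert (Hn : 1 <= INR n) by (apply (le_INR 1); lia).
    assert (Hn4 : 0 < INR n ^ 4) by (apply pow_lt; lra).
    assert (HqR : INR n ^ 4 <= INR q) by (rewrite <- pow_INR; apply le_INR, Hq).
    assert (Hq1 : 1 <= INR q).
    { apply Rle_trans with (2 := HqR). rewrite <- (pow1 4). apply pow_incr. lra. }
    assert (Hn8 : 0 < INR n ^ 8) by (apply pow_lt; lra).
    exists (2400 * n ^ 9)%nat, (trig_eval l). split; [|split; [|split]]; auto.
    + rewrite mult_INR, pow_INR. replace (INR 2400) with 2400 by (rewrite INR_IZR_INZ; reflexivity).
      rewrite Rmult_assoc. apply Rmult_le_compat_l; [lra|].
      apply Rle_trans with (1 := Hn3). apply Rmult_le_compat_l; [lra|].
      apply Rpower_exponent_le; [lra|].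
      unfold s. destruct (Rlt_dec r 2).
      * replace (INR 12) with 12 by (simpl; ring). apply exponent_bound; lra.
      * replace (INR 8) with 8 by (simpl; ring). apply exponent_bound; lra.
    + apply trig_poly_of_trig, Hdeg.
    + intros j x Hj.
      assert (Hj2 : (j <= 2)%nat).
      { apply Nat.lt_succ_r, INR_lt. simpl (INR 3). lra. }
      unfold s in Hn2. destruct (Rlt_dec r 2) as [Hr2|Hr2].
      * assert (Hj1 : (j <= 1)%nat) by (apply Nat.lt_succ_r, INR_lt; simpl (INR 2); lra).
        apply Rle_lt_trans with (/ INR n ^ 4 * (129 / INR n ^ 8)).
        -- apply Hnorm; [exact Hj2| |left; apply Rinv_0_lt_compat, Hn4].
           apply Rle_trans with (INR q ^ 1); [apply Rle_pow; assumption|].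
           apply (Rmult_le_reg_l (INR n ^ 4)); [exact Hn4|].
           rewrite <- Rmult_assoc, Rinv_r by lra. nra.
        -- apply (Rmult_lt_reg_r (INR n ^ 12)); [apply pow_lt; lra|].
           replace (/ INR n ^ 4 * (129 / INR n ^ 8) * INR n ^ 12) with 129 by (field; lra). exact Hn2.
      * apply Rle_lt_trans with (1 * (129 / INR n ^ 8)).
        -- apply Hnorm; [exact Hj2| |lra]. rewrite Rmult_1_l. apply Rle_pow; assumption.
        -- apply (Rmult_lt_reg_r (INR n ^ 8)); [exact Hn8|].
           replace (1 * (129 / INR n ^ 8) * INR n ^ 8) with 129 by (field; lra). exact Hn2.
Qed.
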